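(* Fix $\vec{p}\in\mathbb{N}^\omega$ (a sequence of positive integers). Let $\kappa$ be an infinite cardinal and $A\subset\kappa$. Then $S(\Lambda(\kappa,A),\vec{p})$ is $\frac1\kappa$-homogeneous, and for $A,A'\subset\kappa$, $A\neq A'$ implies $S(\Lambda(\kappa,A),\vec{p})\not\cong S(\Lambda(\kappa,A'),\vec{p})$. Hence, for any uncountable cardinal $\kappa$, there are $2^\kappa$-many (pairwise nonhomeomorphic) $\frac1\kappa$-homogeneous solenoids of the form $S(\Lambda,\vec{p})$ as $\Lambda$ varies over ordered continua of weight $\kappa$.
   Context: For a cardinal $\kappa\ge 1$, a space $Y$ is $\frac1\kappa$-homogeneous if the action of its homeomorphism group $\operatorname{Homeo}(Y)$ on $Y$ has exactly $\kappa$ orbits. The weight of a space is the least cardinality of a base. $\mathbb{N}$ is the set of positive integers; $\cong$ means homeomorphic. For an ordinal $\delta$, the long line of length $\delta$, denoted $[0,\delta)$, is obtained by putting a copy of the open unit interval $(0,1)$ between $\alpha$ and $\alpha+1$ for each $\alpha\in\delta$, with the natural order topology; the closed long line of length $\delta$, denoted $[0,\delta]$, adds $\delta$ as a last (compactifying) point. The standard long line is the one of length $\omega_1$. All products and powers of ordinals are ordinal arithmetic: $\alpha\cdot\beta$ is the order type of $\beta\times\alpha$ with the lexicographic order; $\gamma^0=1$, $\gamma^{\beta+1}=\gamma^\beta\cdot\gamma$, and $\gamma^\alpha=\sup\{\gamma^\beta:\beta<\alpha\}$ for limit $\alpha$. Cardinals are identified with initial ordinals. Definition of $\Lambda(\kappa,A)$: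 let $\Lambda(\kappa)$ be the closed long line of length $\omega_1\cdot\omega^\kappa$, and let $a_\beta=\omega_1\cdot\omega^\beta$. For each $\beta\in A$, in place of the copy of the standard long line from $a_\beta$ to $a_\beta+\omega_1$ put the reverse long line (i.e. replace the interval $[a_\beta,a_\beta+\omega_1]$, which is a copy of $[0,\omega_1]$, by a copy of $[0,\omega_1]$ with the reversed order, with its first point in the place of $a_\beta$ and its last point in the place of $a_\beta+\omega_1$). The resulting ordered continuum is $\Lambda(\kappa,A)$. An ordered continuum is a nondegenerate compact connected space $\Lambda$ which has a linear order and whose topology is the order topology; $\partial\Lambda$ is the set consisting of its first and last points. For $n\ge 1$, $\Lambda^{(n)}=\Lambda_1\vee\dots\vee\Lambda_n$ denotes $n$ copies of $\Lambda$ laid end to end (the last point of $\Lambda_i$ is identified with the first point of $\Lambda_{i+1}$, orders preserved), and $\Sigma^{(n)}=\Lambda^{(n)}/\partial\Lambda^{(n)}$ is the ''circle'' obtained by identifying the first and last points of $\Lambda^{(n)}$; $\Sigma=\Sigma^{(1)}$. The identified endpoints of the copies of $\Lambda$ in $\Sigma^{(n)}$ are labeled in cyclic order $\infty_0,\dots,\infty_{n-1}$, and for $x\in\Lambda\setminus\partial\Lambda$, $\infty_i+x$ denotes the copy of $x$ in the $i$th copy of $\Lambda$ (the one starting at $\infty_i$). For positive integers $m,n$ the $m$-fold covering map $\phi^m_n:\Sigma^{(mn)}\to\Sigma^{(n)}$ is given by $\phi^m_n(\infty_i)=\infty_j$ and $\phi^m_n(\infty_i+x)=\infty_j+x$, where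 $j=i \bmod n$. For a sequence $\vec{p}=\langle p_1,p_2,\dots\rangle$ of positive integers, put $k(1)=1$ and $k(n)=p_1p_2\cdots p_{n-1}$ for $n>1$, and let $S(\Lambda,\vec{p})=\varprojlim\{\phi^{p_n}_{k(n)},\Sigma^{(k(n))},n\in\mathbb{N}\}$, the inverse limit with bonding maps $\phi^{p_n}_{k(n)}:\Sigma^{(k(n+1))}\to\Sigma^{(k(n))}$. *)

(* Defs.v *)
From HB Require Import structures.
From mathcomp Require Import all_boot all_order all_algebra.
From mathcomp Require Import all_classical reals topology.

Set Implicit Arguments.
Unset Strict Implicit.
Unset Printing Implicit Defensive.

Import Order.TTheory GRing.Theory Num.Theory.
Local Open Scope classical_set_scope.
Local Open Scope order_scope.
Local Open Scope quotient_scope.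

(** * Ordinals *)

(* An ordinal is represented by a well-ordered type of that order type; the
   points of the type play the role of the smaller ordinals. *)
Record ordnum := OrdNum {
  ord_disp : Order.disp_t;
  ord_car :> orderType ord_disp;
  ord_wf : well_founded (fun x y : ord_car => x < y) }.

Definition ord_iso (V W : ordnum) : Prop :=
  exists2 f : V -> W, bijective f & {mono f : x y / x <= y}.

(* [V <= W] as ordinals: [V] is isomorphic to an initial segment of [W]. *)
Definition ord_le (V W : ordnum) : Prop :=
  exists2 f : V -> W, {mono f : x y / x <= y} &
    forall x w, w <= f x -> range f w.

Definition ord_sup (I : Type) (F : I -> ordnum) (W : ordnum) : Prop :=
  (forall i, ord_le (F i) W) /\
  (forall W', (forall i, ord_le (F i) W') -> ord_le W W').

Lemma homo_wf d d' (S : orderType d) (T : orderType d') (f : S -> T) :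
  {homo f : x y / x < y} -> well_founded (fun x y : T => x < y) ->
  well_founded (fun x y : S => x < y).
Proof.
move=> fh wT x; move: {2}(f x) (erefl (f x)) => t.
elim: (wT t) x => {}t _ IH x fx; constructor => y /fh; rewrite fx => lt.
exact: IH lt y erefl.
Qed.

Lemma ord1_wf : well_founded (fun x y : 'I_1 => x < y).
Proof. by move=> x; constructor=> y; rewrite !ord1 ltxx. Qed.

Lemma nat_wf : well_founded (fun x y : nat => x < y).
Proof.
move=> n; elim: n {-2}n (leqnn n) => [|n IH] m mn; constructor=> k;
  rewrite ltEnat /= => km; first by move: (leq_trans km mn).
by apply: IH; rewrite -ltnS (leq_trans km mn).
Qed.

Lemma lexi_wf d d' (S : orderType d) (T : orderType d') :
  well_founded (fun x y : S => x < y) -> well_founded (fun x y : T => x < y) ->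
  well_founded (fun x y : S *l T => x < y).
Proof.
move=> wS wT [s t]; elim: (wS s) t => {}s _ IHs t.
elim: (wT t) => {}t _ IHt; constructor => -[s' t'].
rewrite ltxi_pair => /andP[]; rewrite le_eqVlt => /predU1P[->|lt _].
  by rewrite lexx => /IHt.
exact: IHs.
Qed.

Definition ord_one : ordnum := OrdNum ord1_wf.
Definition omega : ordnum := OrdNum nat_wf.

(* [V * W] is the order type of [W * V], ordered lexicographically. *)
Definition ord_mul (V W : ordnum) : ordnum :=
  OrdNum (lexi_wf (@ord_wf W) (@ord_wf V)).

Section initial_segment.
Variables (W : ordnum) (w : W).

Definition seg_type : Type := {x : W | x < w}.
HB.instance Definition _ := SubType.on seg_type.
HB.instance Definition _ := [Choice of seg_type by <:].
HB.instance Definition _ :=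
  [SubChoice_isSubOrder of seg_type by <: with ord_disp W].

Lemma seg_wf : well_founded (fun x y : seg_type => x < y).
Proof. by apply: (homo_wf (f := val) _ (@ord_wf W)). Qed.

Definition seg : ordnum := OrdNum seg_wf.
End initial_segment.

(* [is_pow C B W]: [W] has order type [C ^ B], by recursion on [B]. For [b] the
   largest point of [B], [B] is the successor of [seg b]. *)
Inductive is_pow (C : ordnum) : ordnum -> ordnum -> Prop :=
| IsPowZero (B W : ordnum) : (B -> False) -> ord_iso W ord_one -> is_pow C B W
| IsPowSucc (B : ordnum) (b : B) (V W : ordnum) : (forall x, x <= b) -> is_pow C (seg b) V ->
    ord_iso W (ord_mul V C) -> is_pow C B W
| IsPowLim (B : ordnum) (F : B -> ordnum) (W : ordnum) : inhabited B ->
    (forall b : B, exists x, b < x) -> (forall b, is_pow C (seg b) (F b)) ->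
    ord_sup F W -> is_pow C B W.

(* A chosen representative of an order type; [omega] is a junk value. *)
Definition the_ordnum (P : ordnum -> Prop) : ordnum :=
  if pselect (exists W, P W) is left ex then projT1 (cid ex) else omega.

Definition ord_pow (C B : ordnum) : ordnum := the_ordnum (is_pow C B).

Definition is_omega1 (W : ordnum) : Prop :=
  ~ countable [set: W] /\ forall w : W, countable [set x | x < w].

Definition omega1 : ordnum := the_ordnum is_omega1.

Definition is_cardinal (K : ordnum) : Prop :=
  forall k : K, ~ ([set: K] #= [set x | x < k])%card.

Definition infinite_cardinal (K : ordnum) : Prop :=
  is_cardinal K /\ infinite_set [set: K].

Definition uncountable_cardinal (K : ordnum) : Prop :=
  is_cardinal K /\ ~ countable [set: K].

Lemma the_ordnum_inhabited (P : ordnum -> Prop) :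
  (forall W, P W -> inhabited W) -> inhabited (the_ordnum P).
Proof.
move=> PW; rewrite /the_ordnum; case: pselect => [ex|_]; last exact: inhabits 0%N.
by apply: PW; case: cid.
Qed.

Lemma omega1_inhabited : inhabited omega1.
Proof.
apply: the_ordnum_inhabited => W [+ _]; apply: contra_notP => W0.
suff -> : [set: W] = set0 by exact: countable0.
by apply/seteqP; split=> // x _; apply: W0.
Qed.

Lemma ord_pow_inhabited (C B : ordnum) : inhabited C -> inhabited (ord_pow C B).
Proof.
move=> [c]; apply: the_ordnum_inhabited => W.
elim=> {B W} [B W _ [f [g _ _] _]|B b V W _ _ [v] [f [g _ _] _]|B F W [b] _ _ IH [FW _]].
- by constructor; exact: g ord0.
- by constructor; exact: g (c, v).
- by have [[v] [f _ _]] := (IH b, FW b); by constructor; exact: f v.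
Qed.

Lemma ord_least (W : ordnum) : inhabited W -> exists w : W, forall x, w <= x.
Proof.
move=> [w]; elim: (@ord_wf W w) => {}w _ IH.
have [|] := pselect (exists x, x < w); first by case=> x /IH.
by move=> nw; exists w => x; rewrite leNgt; apply/negP => xw; apply: nw; exists x.
Qed.

(** * Long lines *)

Section long_line.
Variables (R : realType) (D : ordnum).

Definition unit_co : Type := {t : R | (0 <= t < 1)%R}.
HB.instance Definition _ := SubType.on unit_co.
HB.instance Definition _ := [Choice of unit_co by <:].
HB.instance Definition _ :=
  [SubChoice_isSubOrder of unit_co by <: with ring_display].

Lemma unit_co0_subproof : (0 <= (0 : R) < 1)%R.
Proof. by rewrite lexx ltr01. Qed.
Definition unit_co0 : unit_co := exist _ 0%R unit_co0_subproof.

(* The pair [(a, 0)] is the ordinal [a], and the [(a, t)] with [0 < t] form the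
   copy of the open unit interval between [a] and [a + 1]. *)
Definition long_line : Type := D *l unit_co.
HB.instance Definition _ := Order.Total.on long_line.

(* [None] is the added last point [D]. *)
Definition closed_long_line : Type := option long_line.
HB.instance Definition _ := Choice.on closed_long_line.

Definition cll_le (x y : closed_long_line) : bool :=
  match x, y with
  | _, None => true
  | None, Some _ => false
  | Some u, Some v => u <= v
  end.

Lemma cll_le_anti : antisymmetric cll_le.
Proof. by move=> [u|] [v|]//= uv; congr Some; exact: le_anti. Qed.

Lemma cll_le_trans : transitive cll_le.
Proof. by move=> [u|] [v|] [w|]//=; exact: le_trans. Qed.

Lemma cll_le_total : total cll_le.
Proof. by move=> [u|] [v|]//=; exact: le_total. Qed.

HB.instance Definition _ := Order.isOrder.Build ring_display closed_long_line
  (fun _ _ => erefl) (fun _ _ => erefl) (fun _ _ => erefl)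
  cll_le_anti cll_le_trans cll_le_total.
End long_line.

(** * The ordered continua Lambda(K, A) *)

(* The order of [T] reversed inside each member of [F]. *)

Section reversal.
Context {d : Order.disp_t} {T : orderType d} (F : set (set T)).

Definition same_block (x y : T) : bool := `[< exists2 J, F J & J x /\ J y >].

Definition rev_le (x y : T) : bool := if same_block x y then y <= x else x <= y.

Lemma same_blockC x y : same_block x y = same_block y x.
Proof. by apply/idP/idP => /asboolP[J FJ [? ?]]; apply/asboolP; exists J. Qed.

Lemma rev_le_anti : antisymmetric rev_le.
Proof.
by move=> x y; rewrite /rev_le same_blockC; case: ifP => _ /le_anti.
Qed.

Lemma rev_le_total : total rev_le.
Proof. by move=> x y; rewrite /rev_le same_blockC; case: ifP => _; exact: le_total. Qed.

Hypothesis Fconvex : forall J x y z, F J -> J x -> J z -> x <= y <= z -> J y.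
Hypothesis Fdisj : forall J J' x, F J -> F J' -> J x -> J' x -> J = J'.

Lemma rev_le_trans : transitive rev_le.
Proof.
have blk J x y : F J -> J x -> J y -> same_block x y.
  by move=> ? ? ?; apply/asboolP; exists J.
move=> y x z; rewrite /rev_le.
have [/asboolP[J FJ [Jx Jy]]|xy] := boolP (same_block x y).
  have [/asboolP[J' FJ' [J'y J'z]]|yz] := boolP (same_block y z).
    have eqJ := Fdisj FJ FJ' Jy J'y; subst J'.
    by rewrite (blk J) // => yx zy; exact: le_trans yx.
  have [/asboolP[J' FJ' [J'x J'z]]|_ yx lyz] := boolP (same_block x z).
    have eqJ := Fdisj FJ FJ' Jx J'x; subst J'.
    by rewrite (blk J) in yz.
  rewrite leNgt; apply: contra yz => zx; apply: (blk J) => //.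
  by apply: Fconvex FJ Jy Jx _; rewrite lyz ltW.
have [/asboolP[J FJ [Jy Jz]]|yz lxy lyz] := boolP (same_block y z).
  have [/asboolP[J' FJ' [J'x J'z]]|_ lxy zy] := boolP (same_block x z).
    have eqJ := Fdisj FJ FJ' Jz J'z; subst J'.
    by rewrite (blk J) in xy.
  rewrite leNgt; apply: contra xy => zx; apply: (blk J) => //.
  by apply: Fconvex FJ Jz Jy _; rewrite lxy ltW.
have [/asboolP[J FJ [Jx Jz]]|_] := boolP (same_block x z).
  case/negP: xy; apply: (blk J) => //.
  by apply: Fconvex FJ Jx Jz _; rewrite lxy.
exact: le_trans lyz.
Qed.
End reversal.

Definition omega1_0 : omega1 := sval (cid (ord_least omega1_inhabited)).

Lemma omega1_0_le (x : omega1) : omega1_0 <= x.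
Proof. by rewrite /omega1_0; case: cid. Qed.

Section Lambda.
Variables (R : realType) (K : ordnum).
Local Notation P := (ord_pow omega K).

Definition Lambda0 : Type := closed_long_line R (ord_mul omega1 P).
HB.instance Definition _ := Order.Total.on Lambda0.

(* In [ord_mul omega1 P] the pair [(w, x)] is the ordinal [omega1 * w + x]. *)
Definition Lambda0_pt (w : P) (x : omega1) : Lambda0 :=
  Some ((w, x), unit_co0 R).

Lemma Lambda0_pt_le w w' x x' :
  (Lambda0_pt w x <= Lambda0_pt w' x') = (((w, x) : P *l omega1) <= (w', x')).
Proof.
change (((((w, x) : P *l omega1), unit_co0 R) : (P *l omega1) *l unit_co R) <=
        ((((w', x') : P *l omega1), unit_co0 R) : (P *l omega1) *l unit_co R)
        = (((w, x) : P *l omega1) <= (w', x'))).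
by rewrite lexi_pair lexx implybT andbT.
Qed.

Definition pow_0 : P :=
  sval (cid (ord_least (@ord_pow_inhabited omega K (inhabits 0%N)))).

Lemma pow_0_le (w : P) : pow_0 <= w.
Proof. by rewrite /pow_0; case: cid. Qed.

Lemma Lambda0_bottom (x : Lambda0) : Lambda0_pt pow_0 omega1_0 <= x.
Proof.
case: x => [[[w a] t]|//].
have tge0 : unit_co0 R <= t by rewrite leEsub /=; case/andP: (valP t).
change (((((pow_0, omega1_0) : P *l omega1), unit_co0 R)
           : (P *l omega1) *l unit_co R) <= ((w, a) : P *l omega1, t)).
rewrite lexi_pair tge0 implybT andbT lexi_pair pow_0_le /=.
by apply/implyP => _; exact: omega1_0_le.
Qed.

(* The open interval of the closed long line from [omega1 * w] to
   [omega1 * w + omega1 = sup_x (omega1 * w + x)]. *)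
Definition inner_block (w : P) : set Lambda0 :=
  [set u | Lambda0_pt w omega1_0 < u /\ exists x, u < Lambda0_pt w x].

Variable A : set K.

(* The open intervals from [a_b = omega1 * omega ^ b] to [a_b + omega1], for [b]
   in [A]; the ordinal [b] is [seg b], and [w] is [omega ^ b] as a point of [P]. *)
Definition reversed_blocks : set (set Lambda0) :=
  [set J | exists b w, [/\ A b,
     ord_iso (seg w) (ord_pow omega (seg b)) & J = inner_block w]].

Lemma reversed_blocks_convex J x y z : reversed_blocks J -> J x -> J z ->
  x <= y <= z -> J y.
Proof.
move=> [b [w [_ _ ->]]] [wx _] [_ [t zt]] /andP[xy yz].
by split; [exact: lt_le_trans xy|exists t; exact: le_lt_trans zt].
Qed.

Lemma inner_block_inj w w' x : inner_block w x -> inner_block w' x -> w = w'.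
Proof.
suff le v v' : inner_block v x -> inner_block v' x -> v <= v'.
  by move=> wx w'x; apply/le_anti; rewrite !le.
move=> [vx _] [_ [t xt]]; have := ltW (lt_trans vx xt).
by rewrite Lambda0_pt_le lexi_pair => /andP[].
Qed.

Lemma reversed_blocks_disjoint J J' x : reversed_blocks J ->
  reversed_blocks J' -> J x -> J' x -> J = J'.
Proof.
move=> [b [w [_ _ ->]]] [b' [w' [_ _ ->]]] wx w'x.
by rewrite (inner_block_inj wx w'x).
Qed.

End Lambda.

(* Replacing [[a_b, a_b + omega1]] by its reverse, whose first (last) point
   takes the place of [a_b] (of [a_b + omega1]), amounts to reversing the open
   interval between these two points. *)
Definition Lambda (R : realType) (K : ordnum) (A : set K) : Type := Lambda0 R K.
Arguments Lambda R {K} A.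

Section Lambda_order.
Variables (R : realType) (K : ordnum) (A : set K).
Local Notation Lambda := (Lambda R A).
Local Notation reversed_blocks := (@reversed_blocks R K A).

HB.instance Definition _ := Choice.on Lambda.
HB.instance Definition _ := Order.isOrder.Build ring_display Lambda
  (fun _ _ => erefl) (fun _ _ => erefl) (fun _ _ => erefl)
  (@rev_le_anti _ _ reversed_blocks)
  (rev_le_trans (@reversed_blocks_convex R K A) (@reversed_blocks_disjoint R K A))
  (@rev_le_total _ _ reversed_blocks).

Lemma Lambda_leE (x y : Lambda) : (x <= y) = rev_le reversed_blocks x y.
Proof. by []. Qed.

Lemma Lambda_bottom (x : Lambda) : (Lambda0_pt R (pow_0 K) omega1_0 : Lambda) <= x.
Proof.
rewrite Lambda_leE /rev_le ifF; first exact: Lambda0_bottom.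
apply/asboolPn => -[_ [b [w [_ _ ->]]] [[+ _] _]].
by rewrite ltNge Lambda0_bottom.
Qed.
HB.instance Definition _ :=
  Order.hasBottom.Build ring_display Lambda Lambda_bottom.

Lemma Lambda_top (x : Lambda) : x <= (None : Lambda).
Proof.
rewrite Lambda_leE /rev_le ifF; first by case: x.
apply/asboolPn => -[_ [b [w [_ _ ->]]]] [_ [_ [t]]].
by rewrite ltNge.
Qed.
HB.instance Definition _ :=
  Order.hasTop.Build ring_display Lambda Lambda_top.
End Lambda_order.

(** * Ordered continua, circles and solenoids *)

(* A nonempty compact linear order has a first and a last point, so that working
   with a [tbOrderType] is no restriction. *)
Record ordered_continuum := OrderedContinuum {
  oc_disp : Order.disp_t;
  oc_car :> tbOrderType oc_disp;
  oc_compact : compact [set: order_topology oc_car];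
  oc_connected : connected [set: order_topology oc_car];
  oc_nondegenerate : exists x y : oc_car, x <> y }.

Definition boundary d (T : orderType d) : {pred T} :=
  fun x => `[< (forall y, x <= y) \/ (forall y, y <= x) >].

Section circle.
Context {d : Order.disp_t} (T : tbOrderType d) (n : nat).

(* The pair [(i, x)] is the copy of [x] in the [i]-th copy of [T]. The last
   point of a copy other than the last one is identified with the first point of
   the next copy, and it is the latter that is retained. *)
Definition wedge : Type :=
  {u : 'I_n *l T | (u.2 != \top) || (u.1.+1 == n :> nat)}.
HB.instance Definition _ := SubType.on wedge.
HB.instance Definition _ := [Choice of wedge by <:].
HB.instance Definition _ :=
  [SubChoice_isSubOrder of wedge by <: with Order.lexi_display ord_display d].

Definition ends_rel : rel (order_topology wedge) :=
  fun u v => (u == v) || ((u \in @boundary _ wedge) && (v \in @boundary _ wedge)).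

Lemma ends_rel_refl : reflexive ends_rel.
Proof. by move=> u; rewrite /ends_rel eqxx. Qed.

Lemma ends_rel_sym : symmetric ends_rel.
Proof. by move=> u v; rewrite /ends_rel eq_sym andbC. Qed.

Lemma ends_rel_trans : transitive ends_rel.
Proof.
move=> v u w; rewrite /ends_rel => /predU1P[->//|/andP[bu bv]].
by case/predU1P => [<-|/andP[_ bw]]; rewrite bu ?bv ?bw orbT.
Qed.

Definition ends_equiv : equiv_rel (order_topology wedge) :=
  EquivRel ends_rel ends_rel_refl ends_rel_sym ends_rel_trans.

Definition circle : topologicalType := quotient_topology {eq_quot ends_equiv}.
End circle.

Section covering.
Context {d : Order.disp_t} (T : tbOrderType d) (m n : nat).

Lemma covering_gt0 (i : 'I_(m * n)) : (0 < n)%N.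
Proof. by case: n i => // -[i]; rewrite muln0. Qed.

Definition covering_idx (i : 'I_(m * n)) : 'I_n :=
  Ordinal (ltn_pmod i (covering_gt0 i)).

Lemma covering_subproof (u : wedge T (m * n)) :
  ((val u).2 != \top) || ((covering_idx (val u).1).+1 == n :> nat).
Proof.
case: u => -[i x] /= /orP[->//|/eqP imn]; apply/orP; right.
have n0 := covering_gt0 i.
have m0 : (0 < m)%N by case: m i imn.
have -> : nat_of_ord i = (m.-1 * n + n.-1)%N.
  apply/eqP; rewrite -eqSS imn -addnS prednK// -mulSnr prednK//.
by rewrite modnMDl modn_small ?prednK.
Qed.

(* Since [infinity_i + x] is the class of [(i, x)], the covering map is induced
   by [(i, x) |-> (i mod n, x)]. *)
Definition covering_wedge (u : wedge T (m * n)) : wedge T n :=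
  exist _ (covering_idx (val u).1, (val u).2) (covering_subproof u).

Definition covering (q : circle T (m * n)) : circle T n :=
  \pi_(circle T n) (covering_wedge (repr q)).
End covering.

(* [p] and [k_ p] are indexed from [0]. *)
Fixpoint k_ (p : nat -> nat) (n : nat) : nat :=
  if n is n'.+1 then (p n' * k_ p n')%N else 1%N.

Definition solenoid d (T : tbOrderType d) (p : nat -> nat) : topologicalType :=
  [set x : prod_topology (fun n => circle T (k_ p n)) |
    forall n, covering (x n.+1 : circle T (p n * k_ p n)) = x n].

(** * Homeomorphisms, homogeneity, weight *)

Definition homeomorphism (X Y : topologicalType) (f : X -> Y) : Prop :=
  exists g : Y -> X,
    [/\ continuous f, continuous g, cancel f g & cancel g f].

Definition homeomorphic (X Y : topologicalType) : Prop :=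
  exists f : X -> Y, homeomorphism f.

Definition homeo_orbit (Y : topologicalType) (x : Y) : set Y :=
  [set y | exists2 f : Y -> Y, homeomorphism f & f x = y].

(* For an initial ordinal [K]: [Y] is 1/[K]-homogeneous. *)
Definition homogeneous (K : ordnum) (Y : topologicalType) : Prop :=
  (range (@homeo_orbit Y) #= [set: K])%card.

Definition has_weight (X : topologicalType) (K : ordnum) : Prop :=
  (exists2 B : set (set X), basis B & (B #= [set: K])%card) /\
  (forall B : set (set X), basis B -> ([set: K] #<= B)%card).

(* Main.v *)
Require Import Defs.
From HB Require Import structures.
From mathcomp Require Import all_boot all_order all_algebra finmap zify ring lra.
From mathcomp Require Import all_classical reals topology wochoice.

(** Fix an infinite cardinal [K] and let Lambda be the continuum of a set [A] of ordinals below [K].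

   Every point of the solenoid is [spt tg z] for a thread [tg], that is, a compatible choice of sheets, and
   a point [z] of Lambda ([spt_surj]). An order automorphism of Lambda acts on all circles at once, and
   rotations of the circles carry any thread to any other; both give homeomorphisms
   ([shift_homeomorphism]). So there are no more orbits in the solenoid than orbits of order automorphisms
   in Lambda. A block, the interval between omega_1 * w and omega_1 * (w + 1), is homogeneous, because a
   countable initial piece of the long ray is isomorphic to a half-line ([short_ray]). Up to two orbits for each
   block, reversed or not, and one for the end point make at most |omega^K| = |K| orbits ([orbit_upper]).

   Conversely, call a point nonreal if it has no separable neighbourhood, where a neighbourhood in the solenoid is
   explored by its connected subsets only. Near a point of Lambda other than an end point, a connected set
   of the solenoid stays in one sheet and is an interval ([connected_tube], [connected_tube_convex]), so this is a
   property of Lambda. Nonreal are the points omega_1 * w for w > 0, apart from those that follow a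
   reversed block immediately, and the end point. Their Cantor-Bendixson ranks can be read off the Cantor normal
   form of w: the rank is the exponent of the last term, and the end point exceeds all ranks. The points
   missing because of reversals are isolated ones, and do not affect the ranks of the others. As omega_1 * omega^b
   has rank b, all b in K occur as ranks, and there are at least |K| orbits ([orbit_lower]).

   The set [A] is found again as follows ([mem_A]). The left side of a nonreal point is never separable. The right
   side is an initial piece of a block, and so it is separable unless the block is reversed. Hence b is in [A] if and
   only if some point of rank exactly b has two non-separable sides.

   The weight of Lambda is [K] when [K] is uncountable, because the points with a rational parameter are dense
   and the blocks are disjoint ([Lambda_weight]). Lambda is a continuum because its cuts are filled and
   its order is dense, and both properties survive the reversal of blocks ([rev_cut], [rev_dense]).

   The ordinal omega^K is realized by Cantor normal forms ([is_pow_cnf]); powers being unique up to isomorphism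
   ([is_pow_uniq]), the properties of these transfer to the chosen representative
   ([pow_structure_exists]). *)

Set Implicit Arguments.
Unset Strict Implicit.
Unset Printing Implicit Defensive.

Import Order.TTheory GRing.Theory Num.Theory.
Local Open Scope card_scope.
Local Open Scope order_scope.
Local Open Scope classical_set_scope.

(** * Ordinals *)

(** A segment of a segment is only isomorphic to a segment, so the induction runs over all orders that
   map strictly monotonically below a point. *)
Lemma ord_ind (Q : ordnum -> Prop) :
  (forall B : ordnum, (forall b : B, Q (seg b)) -> Q B) -> forall B, Q B.
Proof.
move=> step B; suff sub (b : B) (B' : ordnum) (f : B' -> B) :
    {homo f : x y / x < y} -> (forall x, f x < b) -> Q B'.
  by apply: step => b; apply: (sub b (seg b) (fun x : seg_type b => val x)) => // x; exact: (valP (x : seg_type b)).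
elim: (@ord_wf B b) B' f => {}b _ IH B' f fh fb.
apply: step => c; apply: (IH (f c) (fb c) (seg c) (fun x : seg_type c => f (val x))) => [x y xy|x].
  exact: fh.
by apply: fh; exact: (valP (x : seg_type c)).
Qed.

Lemma ord_min (B : ordnum) (S : set B) : S !=set0 ->
  exists2 m, S m & forall x, S x -> m <= x.
Proof.
move=> [x Sx]; elim: (@ord_wf B x) Sx => {}x _ IH Sx.
have [[y Sy yx]|no] := pselect (exists2 y, S y & y < x); first exact: IH Sy.
by exists x => // y Sy; rewrite leNgt; apply/negP => yx; apply: no; exists y.
Qed.

(** Such an embedding sends each point to the least point outside the image of its predecessors, so it
   is determined by recursion. *)
Lemma ord_embed_uniq (V W : ordnum) (f g : V -> W) :
  {mono f : x y / x <= y} -> (forall x w, w <= f x -> range f w) ->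
  {mono g : x y / x <= y} -> (forall x w, w <= g x -> range g w) -> f =1 g.
Proof.
move=> fm fi gm gi x; elim: (@ord_wf V x) => {}x _ IH.
have flt := leW_mono fm; have glt := leW_mono gm.
apply/le_anti; rewrite !leNgt; apply/andP; split; apply/negP.
- move=> gf; have [y _ fy] := fi x _ (ltW gf).
  have yx : y < x by rewrite -flt fy.
  by move: (IH y yx); rewrite fy => /(inc_inj gm) xy; rewrite xy ltxx in yx.
- move=> fg; have [y _ gy] := gi x _ (ltW fg).
  have yx : y < x by rewrite -glt gy.
  by move: (IH y yx); rewrite gy => /(inc_inj fm) xy; rewrite xy ltxx in yx.
Qed.

Lemma ord_iso_le (V W : ordnum) : ord_iso V W -> ord_le V W.
Proof. by move=> [f [g fK gK] fm]; exists f => // x w _; exists (g w). Qed.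

Lemma ord_iso_sym (V W : ordnum) : ord_iso V W -> ord_iso W V.
Proof.
move=> [f [g fK gK] fm]; exists g; first by exists f.
by move=> x y; rewrite -fm !gK.
Qed.

Lemma ord_iso_trans (U V W : ordnum) :
  ord_iso U V -> ord_iso V W -> ord_iso U W.
Proof.
move=> [f fb fm] [g gb gm]; exists (g \o f); first exact: bij_comp.
by move=> x y /=; rewrite gm fm.
Qed.

Lemma ord_le_trans (U V W : ordnum) : ord_le U V -> ord_le V W -> ord_le U W.
Proof.
move=> [f fm fi] [g gm gi]; exists (g \o f) => [x y|x w] /=.
  by rewrite gm fm.
by move=> wy; have [v _ vw] := gi _ _ wy; move: wy; rewrite -vw [_ <= _]gm => /fi[u _ <-]; exists u.
Qed.

Lemma ord_le_anti (V W : ordnum) : ord_le V W -> ord_le W V -> ord_iso V W.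
Proof.
move=> VW WV; have VV := ord_le_trans VW WV; have WW := ord_le_trans WV VW.
move: VW WV => [f fm fi] [g gm gi].
have fgm : {mono (g \o f) : x y / x <= y} by move=> x y /=; rewrite gm fm.
have gfm : {mono (f \o g) : x y / x <= y} by move=> x y /=; rewrite fm gm.
exists f => //; exists g => x.
- apply: (ord_embed_uniq (f := g \o f) (g := id)) => //.
  by move=> y w /= wy; have [v _ vw] := gi _ _ wy; move: wy; rewrite -vw [_ <= _]gm => /fi[u _ <-]; exists u.
- apply: (ord_embed_uniq (f := f \o g) (g := id)) => //.
  by move=> y w /= wy; have [v _ vw] := fi _ _ wy; move: wy; rewrite -vw [_ <= _]fm => /gi[u _ <-]; exists u.
Qed.

(** The inclusion is the only embedding of a segment as an initial segment. *)
Lemma seg_inj (W : ordnum) (v w : W) : ord_iso (seg v) (seg w) -> v = w.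
Proof.
suff le (a b : W) : ord_iso (seg a) (seg b) -> a <= b.
  by move=> vw; apply/le_anti; rewrite !le //; exact: ord_iso_sym.
move=> [f [g fK gK] fm]; rewrite leNgt; apply/negP => ba.
have e : (fun x : seg a => val (f x : seg_type b)) =1 (fun x : seg_type a => val x).
  apply: (@ord_embed_uniq (seg a) W) => [x y|x z vx|//|x z vx].
  - exact: fm.
  - have vb : z < b by exact: le_lt_trans vx (valP (f x : seg_type b)).
    by exists (g (exist _ z vb)) => //=; rewrite gK.
  - by exists (exist _ z (le_lt_trans vx (valP (x : seg_type a))) : seg a).
have := valP (f (exist _ b ba : seg a) : seg_type b).
by rewrite (e (exist _ b ba)) ltxx.
Qed.

(** * Powers of omega *)

Lemma is_pow_inv (C B W : ordnum) : is_pow C B W ->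
  [\/ (B -> False) /\ ord_iso W ord_one,
      exists b V, [/\ forall x : B, x <= b, is_pow C (seg b) V &
                      ord_iso W (ord_mul V C)]
    | exists F : B -> ordnum, [/\ inhabited B, forall b : B, exists x, b < x,
                      forall b, is_pow C (seg b) (F b) & ord_sup F W]].
Proof.
case=> {B W} [B W|B b V W|B F W] ? ? *; first exact: Or31.
- by apply: Or32; exists b, V.
- by apply: Or33; exists F.
Qed.

Lemma ord_iso_mul (V V' C : ordnum) :
  ord_iso V V' -> ord_iso (ord_mul V C) (ord_mul V' C).
Proof.
move=> [f [g fK gK] fm].
exists (fun x : ord_mul V C => (x.1, f x.2) : ord_mul V' C).
  by exists (fun x => (x.1, g x.2)) => -[a b] /=; rewrite ?fK ?gK.
by move=> [a b] [a' b']; rewrite /= !lexi_pair fm.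
Qed.

Lemma ord_sup_iso (I : Type) (F F' : I -> ordnum) (W W' : ordnum) :
  (forall i, ord_iso (F i) (F' i)) -> ord_sup F W -> ord_sup F' W' ->
  ord_iso W W'.
Proof.
move=> FF' [FW Wmin] [FW' W'min]; apply: ord_le_anti.
- by apply: Wmin => i; apply: ord_le_trans (FW' i); exact/ord_iso_le.
- by apply: W'min => i; apply: ord_le_trans (FW i); exact/ord_iso_le/ord_iso_sym.
Qed.

(** The zero, successor and limit clauses exclude each other, and each determines the order type of a
   power from those of lower exponents. *)
Lemma is_pow_uniq (C B W W' : ordnum) :
  is_pow C B W -> is_pow C B W' -> ord_iso W W'.
Proof.
elim/ord_ind: B W W' => B IH W W' /is_pow_inv BW /is_pow_inv BW'.
case: BW BW' => [[B0 Wi]|[b [V [bmax bV Wi]]]|[F [[b0] nomax BF supW]]]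
  [[B0' Wi']|[b' [V' [bmax' bV' Wi']]]|[F' [[b0'] nomax' BF' supW']]].
- exact: ord_iso_trans Wi (ord_iso_sym Wi').
- by case: (B0 b').
- by case: (B0 b0').
- by case: (B0' b).
- have bb' : b' = b by apply/le_anti; rewrite bmax bmax'.
  subst b'; apply: ord_iso_trans Wi (ord_iso_trans _ (ord_iso_sym Wi')).
  exact/ord_iso_mul/(IH b).
- by have [x] := nomax' b; rewrite ltNge bmax.
- by case: (B0' b0).
- by have [x] := nomax b'; rewrite ltNge bmax'.
- by apply: ord_sup_iso supW supW' => b; exact: IH (BF b) (BF' b).
Qed.

(** An ordinal below omega^B is encoded by the coefficients of its Cantor normal form; normal forms are
   compared at the largest exponent where they differ. *)
Definition cnf (B : ordnum) : Type := {fsfun B -> nat with 0%N}.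
HB.instance Definition _ B := Choice.on (cnf B).
Definition cnf_fun B (f : cnf B) : B -> nat := fun x => (f : {fsfun B -> nat with 0%N}) x.
Coercion cnf_fun : cnf >-> Funclass.

Section cnf_order.
Variable B : ordnum.
Implicit Types f g h : cnf B.

Lemma cnfP f g : f =1 g -> f = g.
Proof. by move=> fg; apply/fsfunP => x; exact: fg. Qed.

Lemma cnf_finite f : finite_set [set x | f x != 0%N].
Proof.
apply: (@sub_finite_set _ _ [set` finsupp (f : {fsfun B -> nat with 0%N})]) => [x|].
  by rewrite /= mem_finsupp.
exact: finite_fset.
Qed.

(** Zero when the support of [F] is infinite. *)
Definition mk_cnf (F : B -> nat) : cnf B :=
  [fsfun x in fset_set [set x | F x != 0%N] => F x].

Lemma mk_cnfE (F : B -> nat) : finite_set [set x | F x != 0%N] -> mk_cnf F =1 F.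
Proof.
move=> fin x; rewrite /cnf_fun /mk_cnf fsfunE.
case: ifPn => //; rewrite in_fset_set// => /negP nx.
by apply/eqP; apply: contra_notT nx; rewrite eq_sym => Fx; apply/mem_set.
Qed.

Definition cnf_lt f g : Prop :=
  exists2 b, (f b < g b)%N & forall c, b < c -> f c = g c.

Lemma seq_max (s : seq B) : s != [::] ->
  exists2 m, m \in s & forall x, x \in s -> x <= m.
Proof.
elim: s => // a [_ _|b s IH _].
  by exists a; rewrite ?mem_head// => x; rewrite inE => /eqP ->.
have [m ms mmax] := IH isT; exists (Order.max a m).
  by case: (leP a m) => _; rewrite ?mem_head// inE ms orbT.
move=> x; rewrite inE => /predU1P[->|/mmax xm]; first by rewrite le_max lexx.
by rewrite le_max xm orbT.
Qed.

Lemma finite_max (S : set B) : finite_set S -> S !=set0 ->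
  exists2 m, S m & forall x, S x -> x <= m.
Proof.
move=> /finite_seqP[s ->] [x xs]; apply: seq_max.
by apply: contraTneq xs => ->.
Qed.

Lemma cnf_diff f g : f <> g -> exists2 b, f b <> g b & forall c, b < c -> f c = g c.
Proof.
move=> fg; have [||m fgm mmax] := @finite_max [set x | f x <> g x].
- apply: (@sub_finite_set _ _ ([set x | f x != 0%N] `|` [set x | g x != 0%N])).
    move=> x /=; case: (eqVneq (f x) 0%N) => [->|]; last by left.
    by move=> g0; right; apply/eqP => g0'; apply: g0.
  by rewrite finite_setU; split; exact: cnf_finite.
- apply: contra_notP fg => nfg; apply: cnfP => x; apply: contrapT => fgx.
  by apply: nfg; exists x.
- exists m => // c mc; apply: contrapT => fgc.
  by have := mmax c fgc; rewrite leNgt mc.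
Qed.

Lemma cnf_lt_irr f : ~ cnf_lt f f.
Proof. by move=> [b]; rewrite ltnn. Qed.

Lemma cnf_lt_trans f g h : cnf_lt f g -> cnf_lt g h -> cnf_lt f h.
Proof.
move=> [b fgb fgc] [b' ghb ghc]; case: (ltgtP b b') => bb'.
- exists b' => [|c b'c]; first by rewrite fgc.
  by rewrite fgc ?ghc// (lt_trans bb').
- exists b => [|c b'c]; first by rewrite -ghc.
  by rewrite fgc// ghc// (lt_trans bb').
- subst b'; exists b => [|c bc]; first exact: ltn_trans fgb ghb.
  by rewrite fgc// ghc.
Qed.

Definition cnf_le f g : bool := `[< f = g \/ cnf_lt f g >].

Lemma cnf_le_anti : antisymmetric cnf_le.
Proof.
move=> f g /andP[/asboolP[//|fg] /asboolP[//|gf]].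
by case: (cnf_lt_irr (cnf_lt_trans fg gf)).
Qed.

Lemma cnf_le_trans : transitive cnf_le.
Proof.
move=> g f h /asboolP[->//|fg] /asboolP[<-|gh]; apply/asboolP; right => //.
exact: cnf_lt_trans gh.
Qed.

Lemma cnf_le_total : total cnf_le.
Proof.
move=> f g; have [->|fg] := pselect (f = g).
  by apply/orP; left; apply/asboolP; left.
have [b /eqP + fgc] := cnf_diff fg; rewrite neq_ltn => /orP[] lt.
  by apply/orP; left; apply/asboolP; right; exists b.
by apply/orP; right; apply/asboolP; right; exists b => // c /fgc.
Qed.

HB.instance Definition _ := Order.isOrder.Build ring_display (cnf B)
  (fun _ _ => erefl) (fun _ _ => erefl) (fun _ _ => erefl)
  cnf_le_anti cnf_le_trans cnf_le_total.

Lemma cnf_ltP f g : f < g <-> cnf_lt f g.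
Proof.
rewrite lt_def; split=> [/andP[/eqP gf /asboolP[fg|//]]|fg].
  by case: gf.
apply/andP; split; last by apply/asboolP; right.
by apply/eqP => gf; move: fg; rewrite gf => /cnf_lt_irr.
Qed.

Lemma cnf_le_eq (b : B) f g : (forall c, b < c -> f c = g c) -> f b <> g b ->
  (f <= g) = (f b < g b)%N.
Proof.
move=> fg /eqP; rewrite neq_ltn => /orP[] lt.
  by rewrite lt; apply/ltW/cnf_ltP; exists b.
rewrite [RHS]ltnNge (ltnW lt) /=; apply/negbTE; rewrite -ltNge; apply/cnf_ltP.
by exists b => // c /fg.
Qed.
End cnf_order.


Section cnf_seg.
Variables (B : ordnum) (b : B).

(** The terms of exponent below [b]; they are extended by a coefficient [n] at [b] in [cnf_ext]. *)
Definition cnf_res (f : cnf B) : cnf (seg b) :=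
  mk_cnf (fun x : seg b => f (val (x : seg_type b))).

Lemma cnf_resE (f : cnf B) (x : seg b) : cnf_res f x = f (val (x : seg_type b)).
Proof.
rewrite /cnf_res mk_cnfE//; apply: (@finite_preimage _ _ [set x | f x != 0%N] (fun x : seg b => val (x : seg_type b))).
  by move=> u v _ _; exact: val_inj.
exact: cnf_finite.
Qed.

Definition cnf_ext (n : nat) (g : cnf (seg b)) : cnf B :=
  mk_cnf (fun x => if insub x is Some y then g (y : seg_type b) else if x == b then n else 0%N).

Lemma cnf_ext_finite n (g : cnf (seg b)) : finite_set [set x : B |
  (if insub x is Some y then g (y : seg_type b) else if x == b then n else 0%N) != 0%N].
Proof.
apply: (@sub_finite_set _ _ ([set b] `|` (fun y : seg b => val (y : seg_type b)) @` [set y | g y != 0%N])).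
  move=> x /=; case: insubP => [y _ <- gy|_]; first by right; exists y.
  by case: (eqVneq x b) => [-> _|_]; [left|rewrite eqxx].
rewrite finite_setU; split; first exact: finite_set1.
exact/finite_image/cnf_finite.
Qed.

Lemma cnf_ext_seg n g (y : seg b) : cnf_ext n g (val (y : seg_type b)) = g y.
Proof. by rewrite mk_cnfE ?valK//; exact: cnf_ext_finite. Qed.

Lemma cnf_ext_at n g : cnf_ext n g b = n.
Proof.
rewrite mk_cnfE; last exact: cnf_ext_finite.
by case: insubP => [y|_]; rewrite ?ltxx// eqxx.
Qed.

Lemma cnf_ext_above n g x : b < x -> cnf_ext n g x = 0%N.
Proof.
move=> bx; rewrite mk_cnfE; last exact: cnf_ext_finite.
case: insubP => [y|_]; first by rewrite ltNge (ltW bx).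
by rewrite gt_eqF.
Qed.

Lemma cnf_extK n g : cnf_res (cnf_ext n g) = g.
Proof. by apply: cnfP => y; rewrite cnf_resE cnf_ext_seg. Qed.

Lemma cnf_resK (f : cnf B) : (forall x, b < x -> f x = 0%N) -> cnf_ext (f b) (cnf_res f) = f.
Proof.
move=> f0; apply: cnfP => x; case: (ltgtP x b) => [xb|bx|->].
- by rewrite -[x]/(val (exist _ x xb : seg_type b)) cnf_ext_seg cnf_resE.
- by rewrite cnf_ext_above// f0.
- by rewrite cnf_ext_at.
Qed.

(** Below omega^(b+1), the order is that of the pairs (coefficient at [b], rest). *)
Lemma cnf_ext_le (n n' : nat) (g g' : cnf (seg b)) :
  (cnf_ext n g <= cnf_ext n' g') = (((n, g) : nat *l cnf (seg b)) <= (n', g')).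
Proof.
rewrite lexi_pair; case: (ltgtP n n') => [nn'|nn'|<-] /=.
- rewrite (@cnf_le_eq _ b) ?cnf_ext_at//; last by apply/eqP; rewrite ltn_eqF.
  by move=> c bc; rewrite !cnf_ext_above.
- rewrite (@cnf_le_eq _ b) ?cnf_ext_at; last by apply/eqP; rewrite gtn_eqF.
    by apply/negbTE; rewrite -leqNgt ltnW.
  by move=> c bc; rewrite !cnf_ext_above.
- have [->|gg'] := pselect (g = g'); first by rewrite !lexx.
  have [c gc gab] := cnf_diff gg'.
  rewrite (@cnf_le_eq _ c g)// (@cnf_le_eq _ (val (c : seg_type b))) ?cnf_ext_seg//.
  move=> x cx; case: (ltgtP x b) => [xb|bx|->]; last by rewrite !cnf_ext_at.
    rewrite -[x]/(val (exist _ x xb : seg_type b)) !cnf_ext_seg; exact: gab.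
  by rewrite !cnf_ext_above.
Qed.
End cnf_seg.

(** Below a normal form of leading exponent [b] there are only normal forms below omega^(b+1), which are
   ordered as pairs; so well-foundedness passes from the segments of [B] to [B]. *)
Lemma cnf_wf (B : ordnum) : well_founded (fun f g : cnf B => f < g).
Proof.
elim/ord_ind: B => B IH f.
have [f0|/existsNP[b0 fb0]] := pselect (forall x, f x = 0%N).
  by constructor => g /cnf_ltP[b]; rewrite f0.
have [//||b fb bmax] := @finite_max _ [set x | f x != 0%N]; first exact: cnf_finite.
  by exists b0; apply/eqP.
have {bmax} : forall x, b < x -> f x = 0%N.
  move=> x bx; apply/eqP; apply: contraLR bx => /bmax; by rewrite -leNgt.
have wf := lexi_wf nat_wf (IH b).
move: {2}((f b, cnf_res b f) : nat *l cnf (seg b)) (erefl ((f b, cnf_res b f) : nat *l cnf (seg b))) => t.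
elim: (wf t) f {fb fb0} => {}t _ IHt f ft f0; constructor => g gf.
have g0 x : b < x -> g x = 0%N.
  move=> bx; have /cnf_ltP[c gc cab] := gf.
  case: (ltP c x) => [cx|xc]; first by rewrite cab// f0.
  by move: gc; rewrite f0// (lt_le_trans bx).
apply: (IHt ((g b, cnf_res b g) : nat *l cnf (seg b))) => //.
by rewrite -ft ltNge -cnf_ext_le !cnf_resK// -ltNge.
Qed.

Definition cnf_ord (B : ordnum) : ordnum := OrdNum (@cnf_wf B).

Lemma cnf_ext_init (B : ordnum) (b : B) (g : cnf (seg b)) (f : cnf B) :
  f <= cnf_ext 0 g -> range (cnf_ext 0 : cnf (seg b) -> cnf B) f.
Proof.
have ext0 x : b <= x -> cnf_ext 0 g x = 0%N.
  by rewrite le_eqVlt => /predU1P[<-|/cnf_ext_above->]; rewrite ?cnf_ext_at.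
move=> fg; have f0 x : b <= x -> f x = 0%N.
  move=> bx; move: fg; rewrite le_eqVlt => /predU1P[->|/cnf_ltP[c gc cab]]; first exact: ext0.
  case: (ltP c x) => [cx|xc]; first by rewrite cab// ext0.
  by move: gc; rewrite ext0// (le_trans bx).
exists (cnf_res b f) => //; rewrite -(f0 b)// cnf_resK// => x bx.
by rewrite f0// ltW.
Qed.

Lemma cnf_ext_mono (B : ordnum) (b : B) :
  {mono (cnf_ext 0 : cnf (seg b) -> cnf B) : f g / f <= g}.
Proof. by move=> f g; rewrite cnf_ext_le lexi_pair lexx. Qed.

(** The zero and successor clauses are immediate. At a limit the normal forms with exponents below [b] are
   initial segments that exhaust [cnf B], and by uniqueness their embeddings into an upper bound
   are compatible. *)
Lemma is_pow_cnf (B : ordnum) : is_pow omega B (cnf_ord B).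
Proof.
elim/ord_ind: B => B IH.
have [[b0]|B0] := pselect (inhabited B); last first.
  have B0' : B -> False by move=> x; apply: B0.
  apply: IsPowZero => //; have e (f g : cnf B) : f = g by apply: cnfP => x; case: (B0' x).
  pose z : cnf B := mk_cnf (fun=> 0%N).
  exists (fun=> ord0); first by exists (fun=> z) => x; rewrite ?ord1//; exact: e.
  by move=> x y; rewrite (e x y) !lexx.
have [[b bmax]|nomax] := pselect (exists b : B, forall x, x <= b).
  have f0 (f : cnf B) x : b < x -> f x = 0%N by rewrite ltNge bmax.
  apply: (@IsPowSucc _ _ b (cnf_ord (seg b))) => //.
  exists (fun f : cnf B => (f b, cnf_res b f) : nat *l cnf (seg b)).
    exists (fun t => cnf_ext t.1 t.2) => [f|[n g]] /=; first by rewrite cnf_resK// => x; exact: f0.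
    by rewrite cnf_ext_at cnf_extK.
  by move=> f g; rewrite -cnf_ext_le !cnf_resK// => x; exact: f0.
have up (b : B) : exists x, b < x.
  apply: contrapT => nb; apply: nomax; exists b => x.
  by rewrite leNgt; apply/negP => bx; apply: nb; exists x.
apply: (@IsPowLim _ _ (fun b => cnf_ord (seg b))) => //; split=> [b|W' leW'].
  exists (cnf_ext 0 : cnf (seg b) -> cnf B); first exact: cnf_ext_mono.
  by move=> g f; exact: cnf_ext_init.
pose h b := sval (cid2 (leW' b)) : cnf (seg b) -> W'.
have hm b : {mono h b : f g / f <= g} by rewrite /h; case: cid2.
have hi b f w : w <= h b f -> range (h b) w by rewrite /h; case: cid2 => /= ? _; apply.
have bnd (f : cnf B) : {b | forall x, b <= x -> f x = 0%N}.
  apply: cid; have [f0|/existsNP[a fa]] := pselect (forall x, f x = 0%N); first by exists b0.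
  have [//||b fb bmax] := @finite_max _ [set x | f x != 0%N]; first exact: cnf_finite.
    by exists a; apply/eqP.
  have [b' bb'] := up b; exists b' => x b'x.
  by apply/eqP; apply: contraLR (lt_le_trans bb' b'x) => /bmax; rewrite -leNgt.
have resK b (f : cnf B) : (forall x, b <= x -> f x = 0%N) -> cnf_ext 0 (cnf_res b f) = f.
  by move=> f0; rewrite -(f0 b)// cnf_resK// => x bx; rewrite f0// ltW.
have hcoh b b' (f : cnf B) : b <= b' -> (forall x, b <= x -> f x = 0%N) ->
    h b (cnf_res b f) = h b' (cnf_res b' f).
  move=> bb' f0.
  pose e (g : cnf (seg b)) : cnf (seg b') := cnf_res b' (cnf_ext 0 g).
  have extK (g : cnf (seg b)) : cnf_ext 0 (e g) = cnf_ext 0 g.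
    apply: resK => x b'x; have := le_trans bb' b'x.
    by rewrite le_eqVlt => /predU1P[<-|/cnf_ext_above->]; rewrite ?cnf_ext_at.
  have em : {mono e : x y / x <= y}.
    by move=> x y; rewrite -(@cnf_ext_mono B b') !extK cnf_ext_mono.
  have E : h b =1 h b' \o e.
    apply: (@ord_embed_uniq (cnf_ord (seg b)) W') => //= [f1 w|x y|f1 w].
    - exact: hi.
    - by rewrite hm em.
    - move=> wf1; have [g _ gw] := hi _ _ _ wf1; move: wf1; rewrite -gw hm.
      move=> gf1; have : cnf_ext 0 g <= cnf_ext 0 f1 by rewrite -extK cnf_ext_mono.
      move=> /cnf_ext_init[g' _ g'g]; exists g' => //=; congr (h b' _).
      by rewrite /e g'g cnf_extK.
  by rewrite E /= /e resK.
pose H (f : cnf B) := h (sval (bnd f)) (cnf_res (sval (bnd f)) f).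
have HE b (f : cnf B) : (forall x, b <= x -> f x = 0%N) -> H f = h b (cnf_res b f).
  move=> f0; rewrite /H; case: (bnd f) => /= b' f0'.
  by case: (leP b b') => bb'; [rewrite (hcoh b b')|rewrite (hcoh b' b)// ltW].
have bnd2 (f g : cnf B) : exists2 b, (forall x, b <= x -> f x = 0%N) & (forall x, b <= x -> g x = 0%N).
  have [[b1 f0] [b2 g0]] := (bnd f, bnd g); exists (Order.max b1 b2) => x.
    by rewrite ge_max => /andP[/f0].
  by rewrite ge_max => /andP[_ /g0].
exists H => [f g|f w].
  have [b f0 g0] := bnd2 f g; rewrite !(HE b)// hm.
  by rewrite -[in RHS](resK b f)// -[in RHS](resK b g)// cnf_ext_mono.
have [b f0] := bnd f; rewrite (HE b)// => /hi[g _ <-].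
exists (cnf_ext 0 g) => //; rewrite (HE b) ?cnf_extK// => x.
by rewrite le_eqVlt => /predU1P[<-|/cnf_ext_above->]; rewrite ?cnf_ext_at.
Qed.

(** The last exponent of the normal form [f]; [x0] is the value at zero, which has none. *)
Definition cnf_rank (B : ordnum) (x0 : B) (f : cnf B) : B :=
  xget x0 [set x | f x <> 0%N /\ forall y, y < x -> f y = 0%N].

Section cnf_rank.
Variables (B : ordnum) (x0 : B).
Implicit Types f g u v : cnf B.
Local Notation rk := (cnf_rank x0).

Lemma cnf_rank_uniq f x : f x <> 0%N -> (forall y, y < x -> f y = 0%N) -> rk f = x.
Proof.
move=> fx f0; apply: xget_unique => // y [fy f0y].
by case: (ltgtP y x) => [/f0 fy0|/f0y fx0|//]; [case: (fy fy0)|case: (fx fx0)].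
Qed.

Lemma cnf_rankP f g : g < f -> f (rk f) <> 0%N /\ forall y, y < rk f -> f y = 0%N.
Proof.
move=> /cnf_ltP[b gfb _]; have [|m fm mmin] := @ord_min B [set x | f x <> 0%N].
  by exists b => fb; rewrite fb in gfb.
rewrite (@cnf_rank_uniq f m)//; first split=> //.
all: move=> y ym; apply: contrapT => fy; by have := mmin y fy; rewrite leNgt ym.
Qed.

(** The terms of [v] of exponent at least [b], plus omega^b. *)
Definition cnf_bump (b : B) (v : cnf B) : cnf B :=
  mk_cnf (fun x => if x < b then 0%N else if x == b then (v b).+1 else v x).

Lemma cnf_bumpE b v x :
  cnf_bump b v x = if x < b then 0%N else if x == b then (v b).+1 else v x.
Proof.
rewrite mk_cnfE//; apply: (@sub_finite_set _ _ ([set b] `|` [set x | v x != 0%N])).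
  by move=> {}x /=; case: ltP; rewrite ?eqxx// => _; case: (eqVneq x b) => [->|]; [left|right].
by rewrite finite_setU; split; [exact: finite_set1|exact: cnf_finite].
Qed.

Lemma cnf_bump_gt b v : v < cnf_bump b v.
Proof.
apply/cnf_ltP; exists b; first by rewrite cnf_bumpE ltxx eqxx.
by move=> c bc; rewrite cnf_bumpE ltNge (ltW bc) /= gt_eqF.
Qed.

Lemma cnf_bump_rank b v : rk (cnf_bump b v) = b.
Proof.
apply: cnf_rank_uniq; first by rewrite cnf_bumpE ltxx eqxx.
by move=> y yb; rewrite cnf_bumpE yb.
Qed.

Lemma cnf_bump_lt b v f : v < f -> b < rk f -> cnf_bump b v < f.
Proof.
move=> vf; have [_ f0] := cnf_rankP vf; move=> bf.
have /cnf_ltP[c vfc ac] := vf; have bc : b < c.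
  rewrite (lt_le_trans bf)// leNgt; apply/negP => /f0 fc; by rewrite fc in vfc.
apply/cnf_ltP; exists c; first by rewrite cnf_bumpE ltNge (ltW bc) /= gt_eqF.
move=> d cd; have bd := lt_trans bc cd.
by rewrite cnf_bumpE ltNge (ltW bd) /= gt_eqF// ac.
Qed.

(** For [v], lower the last coefficient of [f] by one: what is added to [v] before [f] is reached has
   only exponents below that of the last term. *)
Lemma cnf_rank_below f g : g < f ->
  exists2 v, v < f & forall u, v < u -> u < f -> rk u < rk f.
Proof.
move=> gf; have [fr f0] := cnf_rankP gf; set b := rk f in fr f0 *.
pose F x := if x == b then (f b).-1 else f x.
have FE : mk_cnf F =1 F.
  apply: mk_cnfE; apply: (@sub_finite_set _ _ ([set b] `|` [set x | f x != 0%N])).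
    by move=> x; rewrite /F /=; case: (eqVneq x b) => [->|]; [left|right].
  by rewrite finite_setU; split; [exact: finite_set1|exact: cnf_finite].
exists (mk_cnf F).
  apply/cnf_ltP; exists b; first by rewrite FE /F eqxx prednK// lt0n; apply/eqP.
  by move=> c bc; rewrite FE /F gt_eqF.
move=> u vu uf; have [ur u0] := cnf_rankP vu; rewrite ltNge; apply/negP => bu.
have {u0 bu} u0 y : y < b -> u y = 0%N by move=> yb; exact/u0/(lt_le_trans yb).
have /cnf_ltP[c ufc ufa] := uf; have /cnf_ltP[d vud vua] := vu.
have bc : b <= c by rewrite leNgt; apply/negP => /f0 fc; rewrite fc in ufc.
have bd : b <= d by rewrite leNgt; apply/negP => /u0 ud; rewrite ud in vud.
move: bc; rewrite le_eqVlt => /predU1P[bc|bc].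
  subst c; move: bd; rewrite le_eqVlt => /predU1P[bd|bd].
    by subst d; move: vud ufc; rewrite FE /F eqxx; case: (f b) => //= n; lia.
  by move: vud; rewrite FE /F gt_eqF// (ufa d bd) ltnn.
case: (ltgtP d c) => [dc|cd|dc].
- by move: ufc; rewrite -(vua c dc) FE /F gt_eqF// ltnn.
- by move: vud; rewrite FE /F gt_eqF ?(lt_trans bc)// (ufa d cd) ltnn.
- by subst d; move: vud ufc; rewrite FE /F gt_eqF//; lia.
Qed.
End cnf_rank.

Lemma ord_powP (C B W : ordnum) : is_pow C B W -> is_pow C B (ord_pow C B).
Proof.
move=> BW; rewrite /ord_pow /the_ordnum; case: pselect => [ex|[]]; last by exists W.
by case: cid.
Qed.

Lemma ord_pow_cnf (B : ordnum) : ord_iso (ord_pow omega B) (cnf_ord B).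
Proof. by apply: is_pow_uniq (is_pow_cnf B); apply: ord_powP (is_pow_cnf B). Qed.

Definition cnf_zero (B : ordnum) : cnf B := mk_cnf (fun=> 0%N).

Lemma cnf_zeroE (B : ordnum) (x : B) : cnf_zero B x = 0%N.
Proof. by rewrite mk_cnfE//= (_ : [set _ | _] = set0) //; apply/seteqP; split=> // y /eqP. Qed.

(** The normal form of omega^b. *)
Definition cnf_pw (B : ordnum) (b : B) : cnf_ord B := cnf_ext 1 (cnf_zero (seg b)).

Lemma seg_cnf_pw (B : ordnum) (b : B) : ord_iso (seg (cnf_pw b)) (cnf_ord (seg b)).
Proof.
apply: ord_iso_sym; have lt (g : cnf (seg b)) : (cnf_ext 0 g : cnf B) < cnf_pw b.
  by rewrite ltNge cnf_ext_le lexi_pair.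
pose f (g : cnf_ord (seg b)) : seg (cnf_pw b) := exist _ (cnf_ext 0 g : cnf B) (lt g).
exists f; last by move=> x y; exact: cnf_ext_mono.
have fr (y : seg_type (cnf_pw b)) : range (cnf_ext 0 : cnf (seg b) -> cnf B) (val y).
  have /cnf_ltP[c yc ya] := valP y; have yb x : b <= x -> (val y : cnf B) x = 0%N.
    have cb : c = b.
      case: (ltgtP c b) => // [cb|bc].
        have e : (cnf_pw b : cnf B) c = 0%N.
          by rewrite -[c]/(val (exist _ c cb : seg_type b)) cnf_ext_seg cnf_zeroE.
        by rewrite e in yc.
      by rewrite [X in (_ < X)%N]cnf_ext_above in yc.
    subst c; rewrite le_eqVlt => /predU1P[<-|bx].
      by move: yc; rewrite [X in (_ < X)%N]cnf_ext_at; case: ((val y : cnf B) b).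
    by rewrite ya// cnf_ext_above.
  exists (cnf_res b (val y : cnf B)) => //; rewrite -(yb b)// cnf_resK// => x bx.
  by rewrite yb// ltW.
exists (fun y : seg_type (cnf_pw b) => cnf_res b (val y : cnf B)) => [g|y]; first exact: cnf_extK.
apply: val_inj => /=; have [g _ <-] := fr y; by rewrite cnf_extK.
Qed.

Lemma cnf_pw_rank (B : ordnum) (x0 b : B) : cnf_rank x0 (cnf_pw b) = b.
Proof.
apply: cnf_rank_uniq; first by rewrite cnf_ext_at.
by move=> y yb; rewrite -[y]/(val (exist _ y yb : seg_type b)) cnf_ext_seg cnf_zeroE.
Qed.

Lemma cnf_zero_le (B : ordnum) (f : cnf B) : cnf_zero B <= f.
Proof.
rewrite leNgt; apply/negP => /cnf_ltP[b]; by rewrite cnf_zeroE.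
Qed.

Lemma cnf_pw_gt0 (B : ordnum) (b : B) : cnf_zero B < cnf_pw b.
Proof.
rewrite lt_neqAle cnf_zero_le andbT; apply/eqP => e.
have : (cnf_zero B : cnf B) b = (cnf_pw b : cnf B) b by rewrite e.
by rewrite cnf_zeroE cnf_ext_at.
Qed.

(** What is used of the ordinal [omega ^ K]: the point [pw b] is [omega ^ b], and
   [rk w] is the exponent of the last term of the Cantor normal form of [w > 0]. *)
Record pow_structure (K : ordnum) (pw : K -> ord_pow omega K) (rk : ord_pow omega K -> K) : Prop :=
  PowStructure {
  pw_iso : forall b, ord_iso (seg (pw b)) (ord_pow omega (seg b));
  pw_gt0 : forall b, pow_0 K < pw b;
  pw_lt : forall b b', b < b' -> pw b < pw b';
  rk_pw : forall b, rk (pw b) = b;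
  rk_below : forall w, pow_0 K < w ->
    exists2 v, v < w & forall u, v < u -> u < w -> rk u < rk w;
  rk_cofinal : forall v w b, v < w -> b < rk w -> exists u, [/\ v < u, u < w & rk u = b];
  rk_unbounded : forall v b, exists2 u, v < u & rk u = b }.

Lemma pow_structure_exists (K : ordnum) : inhabited K ->
  exists pw rk, @pow_structure K pw rk.
Proof.
move=> [x0]; have [f [g fK gK] fm] := ord_pow_cnf K; have flt := leW_mono fm.
have gm : {mono g : x y / x < y} by move=> x y; rewrite -flt !gK.
have f0 : f (pow_0 K) = cnf_zero K.
  by apply/le_anti; rewrite cnf_zero_le andbT -[cnf_zero K]gK fm pow_0_le.
exists (fun b => g (cnf_pw b)), (fun w => cnf_rank x0 (f w)); split=> [b|b|b b' bb'|b|w|v w b|v b].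
- apply: ord_iso_trans (ord_iso_trans (seg_cnf_pw b) (ord_iso_sym (ord_pow_cnf _))).
  have lt1 (x : seg_type (g (cnf_pw b))) : f (val x) < cnf_pw b by rewrite -gm fK (valP x).
  have lt2 (x : seg_type (cnf_pw b)) : g (val x) < g (cnf_pw b) by rewrite gm (valP x).
  exists (fun x => exist _ (f (val (x : seg_type _))) (lt1 x) : seg (cnf_pw b)); last first.
    by move=> x y; exact: fm.
  exists (fun x => exist _ (g (val (x : seg_type _))) (lt2 x)) => x; apply: val_inj => /=.
    by rewrite fK.
  by rewrite gK.
- by rewrite -flt f0 gK cnf_pw_gt0.
- rewrite gm; apply/cnf_ltP; exists b'; first by rewrite cnf_ext_above// cnf_ext_at.
  by move=> c b'c; rewrite !cnf_ext_above// (lt_trans bb').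
- by rewrite gK cnf_pw_rank.
- rewrite -flt => /(cnf_rank_below x0)[v vf vu]; exists (g v); first by rewrite -flt gK.
  by move=> u; rewrite -flt gK => /vu + uw; apply; rewrite flt.
- rewrite -flt => vw bw; exists (g (cnf_bump b (f v))); rewrite -!flt !gK; split.
  + exact: cnf_bump_gt.
  + exact: cnf_bump_lt vw bw.
  + exact: cnf_bump_rank.
- exists (g (cnf_bump b (f v))); first by rewrite -flt gK cnf_bump_gt.
  by rewrite gK cnf_bump_rank.
Qed.

(** * Cardinals *)

Lemma inj_card T U (A : set T) (B : set U) (f : T -> U) :
  (forall x, A x -> B (f x)) ->
  (forall x y, A x -> A y -> f x = f y -> x = y) -> A #<= B.
Proof.
move=> fAB fi; suff [g] : $|{injfun A >-> B}| by exact: inj_card_le g.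
apply/injfunPex; exists f => // x y /set_mem Ax /set_mem Ay; exact: fi.
Qed.

Lemma inj_cardT T U (f : T -> U) : injective f -> [set: T] #<= [set: U].
Proof. by move=> fi; apply: (inj_card (f := f)) => // x y _ _; exact: fi. Qed.

Lemma cardT_inj T U : [set: T] #<= [set: U] -> exists f : T -> U, injective f.
Proof.
move=> /card_leP[f]; exists (fun x => val (f (SigSub (mem_set (I : [set: T] x))))) => x y.
by move=> /val_inj /(@inj _ _ _ f); rewrite !inE => /(_ I I) [].
Qed.

(** The values given to the predecessors of [x] never exhaust [B], so an injection can be chosen by
   recursion along [lt]. *)
Lemma wf_card_le (X : Type) (lt : X -> X -> Prop) (B : Type) :
  well_founded lt -> (forall x y, x <> y -> lt x y \/ lt y x) ->
  (forall x, ~ ([set: B] #<= [set y | lt y x])) -> [set: X] #<= [set: B].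
Proof.
move=> wf tot nB.
have step x (rec : forall y, lt y x -> B) : exists b, forall y h, rec y h <> b.
  apply: contrapT => no; apply: (nB x).
  have pre b : {y : {y | lt y x} | rec (sval y) (svalP y) = b}.
    apply: cid; apply: contrapT => nb; apply: no; exists b => y h e; apply: nb.
    by exists (exist _ y h); rewrite -e; congr (rec y _); exact: Prop_irrelevance.
  apply: (inj_card (f := fun b => sval (sval (pre b)))) => [b _|b b' _ _ e].
    exact: (svalP (sval (pre b))).
  rewrite -(svalP (pre b)) -(svalP (pre b')).
  case: (sval (pre b)) (sval (pre b')) e => [y h] [y' h'] /= e; subst y'.
  by rewrite (Prop_irrelevance h h').
pose F x rec := sval (cid (step x rec)).
pose f := Fix wf (fun=> B) F.
have fE x : f x = F x (fun y _ => f y).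
  apply: Fix_eq => {}x g h gh; congr (F x _); apply: functional_extensionality_dep => y.
  by apply: functional_extensionality_dep => p; exact: gh.
have flt x y : lt y x -> f y <> f x.
  by move=> yx; rewrite [f x]fE /F; case: cid => /= b; apply.
apply: (inj_cardT (f := f)) => x y fxy; apply: contrapT => /tot[xy|yx].
  exact: flt xy fxy.
by case: (flt _ _ yx).
Qed.

Lemma ord_lt_total (B : ordnum) (x y : B) : x <> y -> x < y \/ y < x.
Proof. by case: (ltgtP x y) => //; [left|right]. Qed.

Lemma infinite_nat_inj (T : Type) : infinite_set [set: T] -> exists f : nat -> T, injective f.
Proof. by move=> /infiniteP/cardT_inj. Qed.

Lemma finite_option (T : Type) : finite_set [set: T] -> finite_set [set: option T].
Proof.
move=> fT; apply: (@sub_finite_set _ _ (Some @` setT `|` [set None])).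
  by move=> [x|] _; [left; exists x|right].
by rewrite finite_setU; split; [exact: finite_image|exact: finite_set1].
Qed.

Lemma card_option_sq (T : Type) : infinite_set [set: T] ->
  [set: T * T] #<= [set: T] -> [set: option T * option T] #<= [set: T].
Proof.
move=> /infinite_nat_inj[i ii] /cardT_inj[j ji].
pose o (x : option T) := if x is Some t then j (i 0%N, t) else j (i 1%N, i 0%N).
have oi : injective o by move=> [x|] [y|]//= /ji[] => [->//|/ii//|/ii//].
by apply: (inj_cardT (f := fun x => j (o x.1, o x.2))) => -[x y] [x' y'] /ji[/oi -> /oi ->].
Qed.

(** If [B] is no larger than a proper segment, the claim for that segment applies. Otherwise order the
   pairs by their maximum first: the pairs below a given one lie in the square of a segment, which is smaller
   than [B], so that [wf_card_le] applies. *)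
Lemma card_sq (B : ordnum) : infinite_set [set: B] -> [set: B * B] #<= [set: B].
Proof.
elim/ord_ind: B => B IH infB.
have [[b /cardT_inj[f fi]]|init] := pselect (exists b : B, [set: B] #<= [set: seg b]).
  have infb : infinite_set [set: seg b].
    by apply: contra_not infB; apply: card_le_finite; exact: inj_cardT fi.
  have [j ji] := cardT_inj (IH b infb).
  apply: (inj_cardT (f := fun x => val (j (f x.1, f x.2) : seg_type b))) => -[x y] [x' y'].
  by move=> /val_inj/ji[/fi -> /fi ->].
(* [tr] orders the pairs by their maximum, and lexicographically for equal maxima. *)
pose tr (p : B * B) : B *l (B *l B) := (Order.max p.1 p.2, (p.1, p.2)).
apply: (@wf_card_le _ (fun p q => tr p < tr q)).
- have := lexi_wf (@ord_wf B) (lexi_wf (@ord_wf B) (@ord_wf B)).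
  move=> wf p; move: {2}(tr p) (erefl (tr p)) => t; elim: (wf t) p => {}t _ IHt p pt.
  by constructor => q qp; apply: (IHt (tr q)); rewrite -?pt.
- move=> p q pq; case: (ltgtP (tr p) (tr q)) => [||[_ p1 p2]]; [by left|by right|].
  by case: pq; case: p q p1 p2 => [? ?] [? ?] /= -> ->.
move=> p le; set m := Order.max p.1 p.2.
have sub : [set q | tr q < tr p] #<= [set: option (seg m) * option (seg m)].
  pose o (x : B) : option (seg m) := insub x.
  have oi x y : x <= m -> y <= m -> o x = o y -> x = y.
    rewrite /o; case: insubP => [u xm <-|xm]; case: insubP => [v ym <-|ym]; try by move=> _ _.
      by move=> _ _ [->].
    move: xm ym; rewrite -!leNgt => mx my xm ym _.
    by apply/le_anti; rewrite (le_trans xm my) (le_trans ym mx).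
  apply: (inj_card (f := fun q => (o q.1, o q.2))) => // -[x y] [x' y'].
  have bnd u v : tr (u, v) < tr p -> u <= m /\ v <= m.
    rewrite /tr ltxi_pair => /andP[+ _]; by rewrite ge_max => /andP.
  by move=> /bnd[xm ym] /bnd[xm' ym'] [/oi -> // /oi ->].
have {le sub} le := card_le_trans le sub.
have [finm|infm] := pselect (finite_set [set: seg m]).
  apply: infB; apply: card_le_finite le _; have finO := finite_option finm.
  by rewrite -setXTT; exact: finite_setX.
apply: init; exists m; exact: card_le_trans le (card_option_sq infm (IH m infm)).
Qed.

Lemma option_card_le (T : Type) : infinite_set [set: T] ->
  [set: T * T] #<= [set: T] -> [set: option T] #<= [set: T].
Proof.
move=> infT sq; apply: card_le_trans (card_option_sq infT sq).
by apply: (inj_cardT (f := fun x => (x, None))) => x y [].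
Qed.

Lemma card_seq (T : Type) : infinite_set [set: T] ->
  [set: T * T] #<= [set: T] -> [set: seq T] #<= [set: T].
Proof.
move=> /infinite_nat_inj[i ii] /cardT_inj[j ji].
pose e := foldr (fun x a => j (x, a)) (i 0%N).
have ei s t : size s = size t -> e s = e t -> s = t.
  elim: s t => [|x s IH] [|y t] //= [st] /ji[-> /IH ->//].
by apply: (inj_cardT (f := fun s => j (i (size s), e s))) => s t /ji[/ii/ei /[apply]].
Qed.

(** A normal form is a finite list of pairs (exponent, coefficient). *)
Lemma card_pow (K : ordnum) : infinite_set [set: K] ->
  [set: ord_pow omega K] #<= [set: K].
Proof.
move=> infK; have sq := card_sq infK.
have [f [g fK gK] _] := ord_pow_cnf K.
have [[i ii] [j ji]] := (infinite_nat_inj infK, cardT_inj sq).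
apply: card_le_trans (card_seq infK sq).
pose h (c : cnf K) := [seq j (x, i (c x)) | x <- fset_set [set x | c x != 0%N]].
apply: (inj_cardT (f := h \o (f : _ -> cnf K))) => u v /= huv.
apply: (can_inj fK); move: (f u : cnf K) (f v : cnf K) huv => {u v} c d cd.
have sub (a b : cnf K) x : h a = h b -> a x != 0%N -> b x = a x.
  move=> ab ax; have : j (x, i (a x)) \in h b.
    rewrite -ab; apply: map_f; rewrite in_fset_set; last exact: cnf_finite.
    exact/mem_set.
  by move=> /mapP[y _] /ji[<- /ii].
apply: cnfP => x; case: (eqVneq (c x) 0%N) => [cx|/(sub _ _ _ cd)->//].
by case: (eqVneq (d x) 0%N) => [->//|/(sub _ _ _ (esym cd))].
Qed.

Lemma card_seg (K : ordnum) (k : K) : [set: seg k] #= [set x | x < k].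
Proof.
rewrite -[X in _ #= X](_ : range (fun x : seg k => val (x : seg_type k)) = _).
  by rewrite card_eq_sym; apply: inj_card_eq => x y _ _; exact: val_inj.
apply/seteqP; split=> [_ [x _ <-]|x xk]; first exact: (valP (x : seg_type k)).
by exists (exist _ x xk).
Qed.

(** A largest point could be removed without changing the cardinality. *)
Lemma infinite_cardinal_up (K : ordnum) (k : K) : infinite_cardinal K ->
  exists k', k < k'.
Proof.
move=> [card infK]; apply: contrapT => nk.
have kmax x : x <= k by rewrite leNgt; apply/negP => kx; apply: nk; exists x.
have leo : [set: K] #<= [set: option (seg k)].
  apply: (inj_cardT (f := fun x => insub x : option (seg_type k))) => x y.
  case: insubP => [u xm <-|xm]; case: insubP => [v ym <-|ym]; try by [case|move=> [->]].
  move: xm ym; rewrite -!leNgt => mx my _.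
  by apply/le_anti/andP; split; apply: le_trans (kmax _) _.
have infk : infinite_set [set: seg k].
  apply: contra_not infK => fink; apply: (card_le_finite leo).
  exact: finite_option.
apply: (card k); apply/card_eqPle; split; last exact: subset_card_le.
rewrite -(card_le_eqr (card_seg k)); apply: card_le_trans leo _.
exact: option_card_le infk (card_sq infk).
Qed.

Lemma ord_succ (B : ordnum) (b : B) : (exists x, b < x) ->
  exists2 s, b < s & forall x, b < x -> s <= x.
Proof. by move=> [x bx]; apply: (@ord_min B [set x | b < x]); exists x. Qed.

(** ** The first uncountable ordinal *)

(** Cantor's diagonal argument. *)
Lemma uncountable_set_nat : ~ countable [set: set nat].
Proof.
move=> /cardT_inj[f fi]; pose D := [set n | exists2 A, f A = n & ~ A n].
have DfD : D (f D) <-> ~ D (f D).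
  by split=> [[A /fi->]|nD] //; exists D.
have nD : ~ D (f D) by move=> DD; exact: (DfD.1 DD DD).
by exact: nD (DfD.2 nD).
Qed.

(** A copy of [T] that carries the well-order [r] as its order. *)
Definition wo_type (T : choiceType) (r : rel T) (_ : well_order r) : Type := T.

Section wo_type.
Variables (T : choiceType) (r : rel T) (rwo : well_order r).
HB.instance Definition _ := Choice.on (wo_type rwo).
Implicit Types x y : T.

Let r_min (S : set T) : S !=set0 -> exists2 m, S m & forall x, S x -> r m x.
Proof.
move=> [x Sx]; have [|m [[mS mmin] _]] := rwo (A := mem S).
  by exists x; apply/mem_set.
by exists m => [|y Sy]; [exact/set_mem|apply/mmin/mem_set].
Qed.

Lemma wo_total : total r.
Proof.
move=> x y; have [|m [-> |->] mmin] := @r_min [set x; y]; first by exists x; left.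
  by rewrite mmin//; right.
by rewrite orbC mmin//; left.
Qed.

Lemma wo_anti : antisymmetric r.
Proof.
move=> x y /andP[xy yx]; have rr z : r z z by have := wo_total z z; rewrite orbb.
have [|m [_ mU]] := rwo (A := mem [set x; y]); first by exists x; apply/mem_set; left.
have min z : [set x; y] z -> z = m.
  move=> xyz; apply/esym/mU; split; first exact/mem_set.
  by move=> u /set_mem[->|->]; case: xyz => ->.
by rewrite [LHS](min x (or_introl erefl)) [RHS](min y (or_intror erefl)).
Qed.

Lemma wo_trans : transitive r.
Proof.
move=> y x z xy yz; have [|m [[->|->]|->] mmin] := @r_min [set x; y; z].
- by exists x; left; left.
- by apply: mmin; right.
- have yx : r y x by apply: mmin; left; left.
  by rewrite (@wo_anti x y) ?xy.
- have zy : r z y by apply: mmin; left; right.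
  by rewrite -(@wo_anti y z) ?yz.
Qed.

HB.instance Definition _ := Order.isOrder.Build ring_display (wo_type rwo)
  (fun _ _ => erefl) (fun _ _ => erefl) (fun _ _ => erefl) wo_anti wo_trans wo_total.

Lemma wo_wf : well_founded (fun x y : wo_type rwo => x < y).
Proof.
move=> x; apply: contrapT => nx; have [|m nm mmin] := @r_min [set x | ~ Acc (fun x y : wo_type rwo => x < y) x].
  by exists x.
apply: nm; constructor => y ym; apply: contrapT => /mmin my.
by move: ym; rewrite ltNge [_ <= _]my.
Qed.
End wo_type.

(** Well-order the sets of natural numbers, and take the least uncountable segment, or everything when all
   segments are countable. *)
Lemma omega1P : is_omega1 omega1.
Proof.
suff [W WP] : exists W, is_omega1 W.
  rewrite /omega1 /the_ordnum; case: pselect => [ex|[]]; last by exists W.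
  by case: cid.
have [r rwo] := well_ordering_principle (set nat).
pose W := OrdNum (@wo_wf _ _ rwo).
have ncW : ~ countable [set: W] by exact: uncountable_set_nat.
have [cW|/existsNP[w0 ncw0]] := pselect (forall w : W, countable [set x | x < w]); first by exists W.
have [|w ncw wmin] := @ord_min W [set w | ~ countable [set x | x < w]]; first by exists w0.
exists (seg w); split=> [|x]; first by rewrite (eq_countable (card_seg w)).
have [cx|/wmin] := pselect (countable [set y | y < val (x : seg_type w)]); last first.
  by rewrite leNgt (valP (x : seg_type w)).
apply: sub_countable cx; apply: (inj_card (f := fun y : seg w => val (y : seg_type w))) => //.
by move=> ? ? _ _; exact: val_inj.
Qed.

Lemma omega1_up (a : omega1) : exists b, a < b.
Proof.
apply: contrapT => nb; have [nc cseg] := omega1P; apply: nc.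
apply: (@sub_countable _ _ _ ([set x | x < a] `|` [set a])).
  apply: subset_card_le => x _; case: (ltgtP x a) => [| |->]; [by left| |by right].
  by move=> ax; case: nb; exists x.
rewrite -bigcup2E; apply: bigcup_countable => // -[|[|]] //= _; exact: countable1.
Qed.

Lemma omega1_tail (a : omega1) : ~ countable [set x | a <= x].
Proof.
move=> ca; have [nc cseg] := omega1P; apply: nc.
apply: (@sub_countable _ _ _ ([set x | x < a] `|` [set x | a <= x])).
  by apply: subset_card_le => x _; case: (ltP x a) => ?; [left|right].
rewrite -bigcup2E; apply: bigcup_countable => // -[|[|]] //= _; exact: countable0.
Qed.

Lemma card_omega1 (T : Type) : ~ countable [set: T] -> [set: omega1] #<= [set: T].
Proof.
move=> ncT; apply: (wf_card_le (@ord_wf omega1)) => [x y|x le].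
  exact: ord_lt_total.
by apply: ncT; apply: card_le_trans le _; exact: omega1P.2.
Qed.

(** * Order topologies *)

Lemma connected_open (X : topologicalType) (A : set X) :
  (forall U V, open U -> open V -> A `<=` U `|` V -> A `&` U !=set0 ->
     A `&` V !=set0 -> A `&` (U `&` V) !=set0) -> connected A.
Proof.
move=> h B [b Bb] [C oC BC] [D cD BD]; apply/seteqP; split=> [x|a Aa].
  by rewrite BC => -[].
apply: contrapT => nBa; have [||||x [Ax [Cx]]] := h C (~` D) oC.
- exact: closed_openC.
- move=> x Ax; have [Dx|] := pselect (D x); last by right.
  by left; have : B x by [rewrite BD]; rewrite BC => -[].
- by exists b; move: Bb; rewrite BC.
- by exists a; split=> // Da; apply: nBa; rewrite BD.
- by apply; have : B x by [rewrite BC]; rewrite BD => -[].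
Qed.

Lemma connected_sub_open (X : topologicalType) (A U V : set X) :
  connected A -> open U -> open V -> A `<=` U `|` V -> A `&` (U `&` V) = set0 ->
  A `&` U !=set0 -> A `<=` U.
Proof.
move=> cA oU oV AUV dis AU0.
suff <- : A `&` U = A by move=> x [].
apply: cA => //; first by exists U.
exists (~` V); first exact: open_closedC.
apply/seteqP; split=> x [Ax] h; split=> //.
  by move=> Vx; have : (A `&` (U `&` V)) x by []; rewrite dis.
by have [] := AUV x Ax.
Qed.

Section order_nbhs.
Context {d : Order.disp_t} {T : orderType d}.
Implicit Types (u v x y z : T).
Local Notation oT := (order_topology T).

(** The first and the last point have no room on one side; hence the alternatives. *)
Lemma order_nbhsP z (U : set oT) : nbhs (z : oT) U ->
  exists P Q : set T, [/\ P = setT \/ (exists2 u, u < z & P = [set x | u < x]),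
    Q = setT \/ (exists2 v, z < v & Q = [set x | x < v]) & P `&` Q `<=` U].
Proof.
rewrite order_nbhs_itv => -[[i j] [/= io zi] iU].
pose P : set T := if i is BSide _ u then [set x | u < x] else setT.
pose Q : set T := if j is BSide _ v then [set x | x < v] else setT.
exists P, Q; split.
- rewrite /P; case: i zi io {iU P} => [b u|b] zi io; last by left.
  right; exists u => //; move: io zi; rewrite /itv_open_ends /=.
  by case: b j {Q} => [] [[] ?|[]] // _; rewrite in_itv => /andP[].
- rewrite /Q; case: j zi io {iU Q} => [b v|b] zi io; last by left.
  right; exists v => //; move: io zi; rewrite /itv_open_ends /=.
  by case: b i {P} => [] [[] ?|[]] // _; rewrite in_itv => /andP[].
- move=> x [Px Qx]; apply: iU; move: Px Qx io; rewrite /P /Q /itv_open_ends /=.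
  by case: i {zi P Q} => [[] ?|[]]; case: j => [[] ?|[]] //= Px Qx _; rewrite in_itv /= ?Px ?Qx.
Qed.

Lemma order_nbhs_left u0 z (U : set oT) : nbhs (z : oT) U -> u0 < z ->
  exists u, [/\ u0 <= u, u < z & forall x, u < x -> x <= z -> U x].
Proof.
move=> /order_nbhsP[P [Q [Pe Qe PQ]]] u0z.
have Qz x : x <= z -> Q x.
  by move=> xz; case: Qe => [->//|[v zv ->]]; exact: le_lt_trans zv.
case: Pe => [Pe|[u uz Pe]].
  by exists u0; split=> // x _ xz; apply: PQ; split; [rewrite Pe|exact: Qz].
exists (Order.max u0 u); rewrite le_max lexx gt_max u0z; split=> // x.
by rewrite gt_max => /andP[_ ux] xz; apply: PQ; split; [rewrite Pe|exact: Qz].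
Qed.

Lemma order_nbhs_right v0 z (U : set oT) : nbhs (z : oT) U -> z < v0 ->
  exists v, [/\ z < v, v <= v0 & forall x, z <= x -> x < v -> U x].
Proof.
move=> /order_nbhsP[P [Q [Pe Qe PQ]]] u0z.
have Qz x : z <= x -> P x.
  by move=> xz; case: Pe => [->//|[v zv ->]]; exact: lt_le_trans xz.
case: Qe => [Qe|[v vz Qe]].
  by exists v0; split=> // x zx _; apply: PQ; split; [exact: Qz|rewrite Qe].
exists (Order.min v0 v); rewrite ge_min lexx lt_min u0z; split=> // x zx.
by rewrite lt_min => /andP[_ ux]; apply: PQ; split; [exact: Qz|rewrite Qe].
Qed.

Lemma order_nbhs_between u0 v0 z (U : set oT) : nbhs (z : oT) U -> u0 < z -> z < v0 ->
  exists u v, [/\ u0 <= u, u < z, z < v, v <= v0 & forall x, u < x -> x < v -> U x].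
Proof.
move=> zU u0z zv0; have [u [u0u uz Uu]] := order_nbhs_left zU u0z.
have [v [zv vv0 Uv]] := order_nbhs_right zU zv0.
exists u, v; split=> // x ux xv; case: (leP x z) => [|/ltW]; [exact: Uu|].
by move=> zx; exact: Uv.
Qed.

Lemma open_rray u : open ([set x | u < x] : set oT).
Proof. by rewrite (_ : [set _ | _] = `]u, +oo[); [exact: rray_open|rewrite set_itvE]. Qed.

Lemma open_lray u : open ([set x | x < u] : set oT).
Proof. by rewrite (_ : [set _ | _] = `]-oo, u[); [exact: lray_open|rewrite set_itvE]. Qed.

Lemma open_between u v : open ([set x | u < x /\ x < v] : set oT).
Proof. exact: openI (open_rray u) (open_lray v). Qed.

End order_nbhs.

(** A ray whose end point is in the range pulls back to a ray, and one whose end point is outside the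
   convex range pulls back to everything or to nothing. *)
Lemma order_embedding_continuous d d' (S : orderType d) (T : orderType d') (f : S -> T) :
  {mono f : x y / x <= y} ->
  (forall x y t, f x <= t -> t <= f y -> range f t) ->
  continuous (f : order_topology S -> order_topology T).
Proof.
move=> fm conv x; have flt := leW_mono fm.
have ray (P : set S) : open (P : set (order_topology S)) -> P x -> nbhs (x : order_topology S) P.
  by move=> oP Px; apply: open_nbhs_nbhs.
move=> U /= /order_nbhsP[P [Q [Pe Qe PQ]]].
suff : nbhs (x : order_topology S) (f @^-1` P `&` f @^-1` Q).
  by apply: filterS => y [Py Qy]; exact: PQ.
apply: filterI.
- case: Pe => [->|[u ux ->]]; first by apply: filterS filterT => ? _.
  have [[s _ su]|nu] := pselect (range f u).
    apply: (ray (f @^-1` [set t | u < t])) => //; rewrite (_ : _ @^-1` _ = [set y | s < y]).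
      exact: open_rray.
    by apply/seteqP; split=> y /=; rewrite -su flt.
  apply: filterS filterT => y _ /=; rewrite ltNge; apply/negP => yu; apply: nu.
  exact: conv yu (ltW ux).
- case: Qe => [->|[u ux ->]]; first by apply: filterS filterT => ? _.
  have [[s _ su]|nu] := pselect (range f u).
    apply: (ray (f @^-1` [set t | t < u])) => //; rewrite (_ : _ @^-1` _ = [set y | y < s]).
      exact: open_lray.
    by apply/seteqP; split=> y /=; rewrite -su flt.
  apply: filterS filterT => y _ /=; rewrite ltNge; apply/negP => yu; apply: nu.
  exact: conv (ltW ux) yu.
Qed.

Definition order_dense d (T : orderType d) := forall x y : T, x < y -> exists z, x < z /\ z < y.

(** Order completeness, in terms of cuts. *)
Definition cuts_filled d (T : tbOrderType d) := forall L : set T,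
  (forall x y, x <= y -> L y -> L x) -> L \bot -> ~ L \top ->
  exists c, (forall x, x < c -> L x) /\ (forall x, c < x -> ~ L x).

Section continuum.
Context {d : Order.disp_t} {T : tbOrderType d}.
Hypothesis dense : order_dense T.
Hypothesis filled : cuts_filled T.
Local Notation oT := (order_topology T).

(** An ultrafilter converges to the point that fills the cut between the lower bounds of its members and
   the other points. *)
Lemma continuum_compact : compact [set: oT].
Proof.
rewrite compact_ultra => F UF _.
pose L : set T := [set x | F [set y | x <= y]].
have Ldown x y : x <= y -> L y -> L x.
  by move=> xy; apply: filterS => z /=; exact: le_trans.
have [Ltop|nLtop] := pselect (L \top).
  exists \top; split=> // U Utop; apply: filterS Ltop => y /=; rewrite le1x => /eqP ->.
  exact: (nbhs_singleton Utop).
have Lbot : L \bot by apply: filterS filterT => z _ /=; exact: le0x.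
have [c [cL cnL]] := filled Ldown Lbot nLtop.
exists c; split=> // U /order_nbhsP[P [Q [Pe Qe PQ]]].
apply: filterS PQ _; apply: filterI.
- case: Pe => [->|[u uc ->]]; first exact: filterT.
  have [z [uz zc]] := dense uc.
  by apply: filterS (cL z zc) => y /=; exact: lt_le_trans.
- case: Qe => [->|[v cv ->]]; first exact: filterT.
  have [//|] := in_ultra_setVsetC [set y | v <= y] UF.
    by move=> /(cnL v cv).
  by apply: filterS => y /= /negP; rewrite ltNge.
Qed.

Definition convex (A : set T) := forall x y z, A x -> A z -> x <= y -> y <= z -> A y.

(** The points up to which the interval from [a] stays in [U] form a cut, and the point that fills it
   cannot be interior to either of two disjoint open sets that cover the interval. *)
Lemma convex_connected (A : set oT) : convex A -> connected A.
Proof.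
move=> cA; apply: connected_open.
suff main (U V : set oT) a b : open U -> open V -> A `<=` U `|` V -> A a -> U a ->
    A b -> V b -> a < b -> A `&` (U `&` V) !=set0.
  move=> U V oU oV AUV [a [Aa Ua]] [b [Ab Vb]].
  case: (ltgtP (a : T) b) => ab; first exact: (main U V a b).
  - rewrite [U `&` V]setIC; apply: (main V U b a) => //.
    by move=> x /AUV[]; [right|left].
  - by exists a; split=> //; split=> //; rewrite ab.
move=> oU oV AUV Aa Ua Ab Vb ab; apply: contrapT => dis.
have UV x : A x -> U x -> V x -> False by move=> Ax Ux Vx; apply: dis; exists x.
pose L : set T := [set z | z <= a \/ (z <= b /\ forall z', a <= z' -> z' <= z -> U z')].
have [x y xy| | |c [cL cnL]] := @filled L.
- case=> [ya|[yb yU]]; first by left; exact: le_trans ya.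
  by right; split=> [|z az zx]; [exact: le_trans yb|apply: yU => //; exact: le_trans xy].
- by left; exact: le0x.
- case=> [|[tb /(_ b (ltW ab) (lex1 _)) Ub]]; last exact: UV Ub Vb.
  by move=> ta; have := lt_le_trans ab (le_trans (lex1 b) ta); rewrite ltxx.
have ac : a <= c by rewrite leNgt; apply/negP => /cnL; apply; left.
have cb : c <= b.
  rewrite leNgt; apply/negP => /cL[|[_ /(_ b (ltW ab) (lexx _)) Ub]].
    by rewrite leNgt ab.
  exact: UV Ub Vb.
have Ac : A c by exact: cA Aa Ab ac cb.
have nb (W : set oT) : open W -> W c -> nbhs (c : oT) W by move=> *; exact: open_nbhs_nbhs.
have [Uc|Vc] := AUV c Ac.
- have {}cb : c < b.
    by rewrite lt_neqAle cb andbT; apply/eqP => e; apply: (UV c) => //; rewrite e.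
  have [v [cv vb vU]] := order_nbhs_right (nb _ oU Uc) cb.
  have [x [cx xv]] := dense cv; apply: (cnL x cx); right; split.
    exact: le_trans (ltW xv) vb.
  move=> z az zx; case: (leP c z) => [cz|zc]; first by apply: vU => //; exact: le_lt_trans xv.
  have [za|[_ zU]] := cL z zc; last exact: zU.
  by have -> : z = a by apply/le_anti; rewrite za.
- have {}ac : a < c.
    by rewrite lt_neqAle ac andbT; apply/eqP => e; apply: (UV c) => //; rewrite -e.
  have [u [au uc uV]] := order_nbhs_left (nb _ oV Vc) ac.
  have [x [ux xc]] := dense uc; have ax := le_lt_trans au ux.
  have [|[_ xU]] := cL x xc; first by rewrite leNgt ax.
  apply: (UV x); [|apply: xU => //; exact: ltW|exact: uV ux (ltW xc)].
  exact: cA Aa Ac (ltW ax) (ltW xc).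
Qed.

Lemma continuum_connected : connected [set: oT].
Proof. exact: convex_connected. Qed.

End continuum.

(** * Circles *)

Local Open Scope quotient_scope.

Lemma finite_closed_cover (X : topologicalType) (I : eqType) (s : seq I) (F : I -> set X) :
  (forall i, closed (F i)) -> closed [set x | exists2 i, i \in s & F i x].
Proof.
move=> cF; elim: s => [|i s IH].
  by rewrite (_ : [set _ | _] = set0); [exact: closed0|apply/seteqP; split=> // x []].
rewrite (_ : [set _ | _] = F i `|` [set x | exists2 i, i \in s & F i x]); first exact: closedU.
apply/seteqP; split=> x /=.
  by move=> [j]; rewrite inE => /predU1P[->|js] Fx; [left|right; exists j].
by move=> [Fx|[j js Fx]]; [exists i; rewrite ?mem_head|exists j; rewrite // inE js orbT].
Qed.

Section circle_points.
Context {d : Order.disp_t} {T : tbOrderType d}.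
Hypothesis bot_top : (\bot : T) <> \top.

Section fixed_n.
Variable n : nat.
Implicit Types (i j : 'I_n) (x y z : T).

Definition wpt_pair i z : 'I_n *l T :=
  if (z == \top) && (i.+1 != n) then (ordS i, \bot) else (i, z).

Lemma wpt_subproof i z :
  ((wpt_pair i z).2 != \top) || ((wpt_pair i z).1.+1 == n :> nat).
Proof.
rewrite /wpt_pair; case: ifP => [_|] /=; first by apply/orP; left; apply/eqP.
by move/negbT; rewrite negb_and negbK.
Qed.

(** The point of the wedge at [z] in the [i]-th copy of [T]; a last point is represented by the first point
   of the next copy. *)
Definition wpt i z : wedge T n := exist _ (wpt_pair i z) (wpt_subproof i z).

Lemma ordS_val i : (i.+1 != n)%N -> ordS i = i.+1 :> nat.
Proof.
by move=> iN; rewrite /= modn_small// ltn_neqAle iN ltn_ord.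
Qed.

Lemma wpt_mono i : {mono wpt i : x y / x <= y}.
Proof.
move=> x y; rewrite leEsub /= /wpt_pair.
have [->|xt] := eqVneq x \top; have [->|yt] := eqVneq y \top; rewrite /= ?lexx //.
- have [iN|iN] := eqVneq i.+1 n; rewrite /= lexi_pair ?lexx //.
  by rewrite leEord ordS_val// ltnn; apply/esym/negbTE; rewrite le1x.
- have [iN|iN] := eqVneq i.+1 n; rewrite /= lexi_pair ?lexx //.
  by rewrite !leEord ordS_val// leqnSn ltnn lex1.
- by rewrite lexi_pair !lexx.
Qed.

Lemma wptE (u : wedge T n) : u = wpt (val u).1 (val u).2.
Proof.
apply: val_inj => /=; case: u => -[i z] /= h; rewrite /wpt_pair.
by case: ifP => // /andP[/eqP ez iN]; move: h; rewrite ez eqxx (negbTE iN).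
Qed.

Lemma wpt_convex i x y (u : wedge T n) : wpt i x <= u -> u <= wpt i y -> range (wpt i) u.
Proof.
move=> ixu uiy; rewrite (wptE u); case: u ixu uiy => -[j z] /= h ixu uiy.
have {ixu} : wpt i \bot <= (exist _ (j, z) h : wedge T n).
  by apply: le_trans ixu; rewrite wpt_mono le0x.
have {uiy} : (exist _ (j, z) h : wedge T n) <= wpt i \top.
  by apply: le_trans uiy _; rewrite wpt_mono lex1.
rewrite !leEsub /= /wpt_pair eqxx.
have /eqP/negbTE -> := bot_top; rewrite /= lexi_pair => /andP[+ +].
have [iN|iN] := eqVneq i.+1 n; rewrite /= !leEord => ji jit /andP[ij ijt].
  have e : j = i by apply/val_inj/eqP; rewrite eqn_leq ji ij.
  by exists z => //; rewrite e.
move: ji jit; rewrite ordS_val// => ji jit.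
have [e|ne] := eqVneq i j; first by subst j; exists z.
have e : j = ordS i.
  apply/ord_inj; rewrite ordS_val//; apply/eqP; rewrite eqn_leq ji ltn_neqAle ij andbT.
  exact: ne.
move: jit; rewrite e ordS_val// leqnn /= lex0 => /eqP ->.
exists \top => //; apply: val_inj => /=; rewrite /wpt_pair eqxx iN /=.
by have /eqP/negbTE -> := bot_top.
Qed.

Lemma wpt_continuous i : continuous (wpt i : order_topology T -> order_topology (wedge T n)).
Proof.
apply: order_embedding_continuous => [|x y u]; first exact: wpt_mono.
exact: wpt_convex.
Qed.

Definition cpt i z : circle T n := \pi_(circle T n) (wpt i z : order_topology (wedge T n)).

Lemma cpt_continuous i : continuous (cpt i : order_topology T -> circle T n).
Proof.
move=> x; apply: (@continuous_comp (order_topology T) (order_topology (wedge T n)) (circle T n) (wpt i) (\pi_(circle T n))).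
  exact: wpt_continuous.
exact: pi_continuous.
Qed.

Lemma cpt_eqP (u v : wedge T n) :
  reflect (\pi_(circle T n) (u : order_topology (wedge T n)) = \pi_(circle T n) (v : order_topology (wedge T n)))
    (ends_equiv T n u v).
Proof. exact: (@eqquotP _ (ends_equiv T n) _ u v). Qed.

(** Among the chosen representatives, only the last point of the last copy is an end of the wedge. *)
Lemma boundary_wpt i z : z <> \bot -> (wpt i z : wedge T n) \in @boundary _ (wedge T n) ->
  i.+1 = n /\ z = \top.
Proof.
move=> z0 /asboolP[/(_ (wpt (Ordinal (leq_ltn_trans (leq0n i) (ltn_ord i))) \bot))|].
  have /eqP/negbTE bt := bot_top.
  rewrite leEsub /= /wpt_pair bt /=; case: ifP => [/andP[zt iN]|_].
    by rewrite lexi_pair leEord ordS_val.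
  rewrite lexi_pair => /andP[_ /implyP]; rewrite leEord => /(_ (leq0n _)).
  by rewrite lex0 => /eqP.
have lt : (n.-1 < n)%N by rewrite ltn_predL (leq_ltn_trans (leq0n i) (ltn_ord i)).
have n0 : n.-1.+1 = n by exact: (ltn_predK lt).
move=> /(_ (wpt (Ordinal lt) \top)); rewrite leEsub /= /wpt_pair eqxx /= n0 eqxx /=.
case: ifP => [/andP[zt iN]|_].
  rewrite lexi_pair !leEord ordS_val//= => /andP[ni /implyP].
  have ni' : (i.+1 <= n.-1)%N by rewrite -ltnS n0 ltn_neqAle iN /=.
  by move=> /(_ ni'); rewrite lex0 eq_sym => /eqP/bot_top.
rewrite lexi_pair !leEord /= => /andP[ni /implyP].
have ni' : (i <= n.-1)%N by rewrite -ltnS n0.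
move=> /(_ ni'); rewrite le1x => /eqP ->; split=> //.
by apply: etrans n0; congr S; apply/eqP; rewrite eqn_leq ni ni'.
Qed.

(** Leaving out the first point of each copy leaves exactly one name for every point of the circle. *)
Lemma cpt_inj i j z z' : z <> \bot -> z' <> \bot -> cpt i z = cpt j z' -> i = j /\ z = z'.
Proof.
move=> z0 z'0 /cpt_eqP/orP[/eqP/(congr1 val)|/andP[bz bz']]; last first.
  have [iN ->] := boundary_wpt z0 bz; have [jN ->] := boundary_wpt z'0 bz'.
  by split=> //; apply: val_inj; apply: succn_inj; rewrite iN.
rewrite /= /wpt_pair; case: ifP => [/andP[/eqP -> _]|_]; case: ifP => [/andP[/eqP -> _]|_].
- by move=> [e]; split=> //; apply: (@ordS_inj n); exact: val_inj.
- by move=> [_ /esym].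
- by move=> [_].
- by move=> [-> ->].
Qed.

Lemma wpt_least i : i = 0%N :> nat -> forall u, wpt i \bot <= u.
Proof.
move=> i0 u; rewrite leEsub /= /wpt_pair.
have /eqP/negbTE -> := bot_top; case: (val u) => j z /=.
by rewrite lexi_pair leEord i0 leq0n le0x implybT.
Qed.

Lemma wpt_greatest i : i.+1 = n -> forall u, u <= wpt i \top.
Proof.
move=> iN u; rewrite leEsub /= /wpt_pair eqxx iN eqxx /=.
by case: (val u) => j z /=; rewrite lexi_pair leEord lex1 implybT andbT -ltnS iN.
Qed.

Lemma boundary_min i : i = 0%N :> nat -> (wpt i \bot : wedge T n) \in @boundary _ (wedge T n).
Proof. by move=> i0; apply/asboolP; left; exact: wpt_least. Qed.

Lemma boundary_max i : i.+1 = n -> (wpt i \top : wedge T n) \in @boundary _ (wedge T n).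
Proof. by move=> iN; apply/asboolP; right; exact: wpt_greatest. Qed.

Lemma cpt_top i : cpt i \top = cpt (ordS i) \bot.
Proof.
have [iN|iN] := eqVneq i.+1 n; last first.
  congr (\pi_(circle T n) _); apply: val_inj; rewrite /= /wpt_pair eqxx iN /=.
  by have /eqP/negbTE -> := bot_top.
apply/cpt_eqP/orP; right; apply/andP; split; first exact: boundary_max.
by apply: boundary_min; rewrite /= iN modnn.
Qed.

Lemma cpt_surj (q : circle T n) : exists i z, z <> \bot /\ q = cpt i z.
Proof.
rewrite -[q]reprK; have -> := wptE (repr q : wedge T n).
move: (val _) => [j z] /=; have [->|/eqP z0] := eqVneq z \bot; last by exists j, z.
by exists (ord_pred j), \top; split; [exact/nesym|rewrite cpt_top ord_predK].
Qed.

(** The identification concerns only the ends of the wedge, which such an interval avoids. *)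
Lemma cpt_open i u v : v <> \top ->
  open (cpt i @` [set z | u < z /\ z < v] : set (circle T n)).
Proof.
move=> vt; suff : open (\pi_(circle T n) @^-1` (cpt i @` [set z | u < z /\ z < v]) : set (order_topology (wedge T n))).
  by [].
rewrite (_ : _ @^-1` _ = [set w : wedge T n | wpt i u < w /\ w < wpt i v]); first exact: open_between.
apply/seteqP; split=> w /= => [[z [uz zv]]|[uw wv]].
  have z0 : z <> \bot by move=> z0; move: uz; rewrite z0 ltx0.
  have zt : z <> \top by move=> z1; move: zv; rewrite z1 lt1x.
  move=> /cpt_eqP/orP[/eqP <-|/andP[/(boundary_wpt z0)[]//]].
  by rewrite !(leW_mono (@wpt_mono i)).
have [z _ zw] := wpt_convex (ltW uw) (ltW wv).
by exists z; rewrite ?/cpt ?zw //; move: uw wv; rewrite -zw !(leW_mono (@wpt_mono i)).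
Qed.

(** The circle is a quotient of the disjoint union of the copies of [T]: a set whose traces on the copies
   are closed is a finite union of compact sets in the wedge. *)
Lemma circle_continuous (Y : topologicalType) (f : circle T n -> Y) :
  compact [set: order_topology T] ->
  (forall i, continuous (f \o cpt i : order_topology T -> Y)) -> continuous f.
Proof.
move=> cT fc; apply/quotient_continuous/continuous_closedP => A cA.
set g := f \o _; rewrite (_ : g @^-1` A = [set w | exists2 i, i \in enum 'I_n &
   (wpt i @` ((f \o cpt i) @^-1` A)) w]); last first.
  apply/seteqP; split=> w /=; last by move=> [i _ [z Az <-]].
  move=> Aw; exists (val (w : wedge T n)).1; first by rewrite mem_enum.
  exists (val (w : wedge T n)).2; last by rewrite -wptE.
  by rewrite /= /cpt -wptE.
apply: finite_closed_cover => i; apply: compact_closed; first exact: order_hausdorff.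
apply: (@continuous_compact (order_topology T) (order_topology (wedge T n)) (wpt i)).
  exact/continuous_subspaceT/wpt_continuous.
apply: subclosed_compact cT _ => //.
by move/continuous_closedP: (fc i) => fic; exact: fic.
Qed.

Lemma circle_lift (Y : Type) (phi : 'I_n -> T -> Y) :
  (forall i, phi i \top = phi (ordS i) \bot) ->
  exists f : circle T n -> Y, forall i z, f (cpt i z) = phi i z.
Proof.
move=> glue.
pose f (q : circle T n) := let u := val (repr q : wedge T n) in phi u.1 u.2.
(* The name of a point in terms of [z <> \bot]. *)
pose nf (i : 'I_n) (z : T) := if z == \bot then (ord_pred i, \top) else (i, z).
have nf0 i z : (nf i z).2 <> \bot.
  by rewrite /nf; case: eqP => //= _; exact/nesym.
have cnf i z : cpt (nf i z).1 (nf i z).2 = cpt i z.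
  by rewrite /nf; case: eqP => //= ->; rewrite cpt_top ord_predK.
have pnf i z : phi (nf i z).1 (nf i z).2 = phi i z.
  by rewrite /nf; case: eqP => //= ->; rewrite glue ord_predK.
exists f => i z; pose w := repr (cpt i z) : wedge T n.
have : cpt (val w).1 (val w).2 = cpt i z by rewrite /cpt -wptE reprK.
rewrite -cnf -[RHS]cnf => /(cpt_inj (@nf0 _ _) (@nf0 _ _))[e1 e2].
by rewrite /f -[LHS]pnf -[RHS]pnf -/w e1 e2.
Qed.
End fixed_n.

Lemma covering_cpt m n (i : 'I_(m * n)) z :
  covering (cpt i z) = cpt (covering_idx i) z :> circle T n.
Proof.
have n0 := covering_gt0 i.
have mn0 : (0 < m * n)%N := leq_ltn_trans (leq0n i) (ltn_ord i).
have cw (j : 'I_(m * n)) x : \pi_(circle T n) (covering_wedge (wpt j x) : order_topology (wedge T n)) =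
    cpt (covering_idx j) x.
  rewrite /cpt; have [/andP[/eqP -> jN]|h] := boolP ((x == \top) && (j.+1 != m * n)%N).
    rewrite -/(cpt _ _) cpt_top; congr (\pi_(circle T n) _); apply: val_inj => /=.
    rewrite /wpt_pair eqxx jN; have /eqP/negbTE bt := bot_top; rewrite bt /=.
    congr pair; apply: val_inj => /=.
    have e : (j.+1 %% (m * n) = j.+1)%N by rewrite modn_small// ltn_neqAle jN ltn_ord.
    by rewrite /= e -[in LHS]addn1 -modnDml addn1.
  congr (\pi_(circle T n) _); apply: val_inj; rewrite /= /wpt_pair (negbTE h) /=.
  case: ifP => // /andP[xt jN]; have := covering_subproof (wpt j x).
  by rewrite /= /wpt_pair (negbTE h) /= xt (negbTE jN).
rewrite -cw /covering; set u : wedge T (m * n) := repr _.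
have /cpt_eqP/orP[/eqP <-//|/andP[bu bw]] : \pi_(circle T (m * n)) (wpt i z : order_topology _) =
    \pi_(circle T (m * n)) (u : order_topology (wedge T (m * n))) by rewrite /u reprK.
have cb (w : wedge T (m * n)) : w \in @boundary _ (wedge T (m * n)) ->
    covering_wedge w \in @boundary _ (wedge T n).
  move=> /asboolP[wmin|wmax].
    have e : w = wpt (Ordinal mn0) \bot by apply/le_anti; rewrite wmin wpt_least.
    have /eqP/negbTE bt := bot_top.
    rewrite [covering_wedge w]wptE /= e /= /wpt_pair bt /=.
    by apply: boundary_min; rewrite /= mod0n.
  have lt : ((m * n).-1 < m * n)%N by rewrite ltn_predL.
  have e : w = wpt (Ordinal lt) \top.
    by apply/le_anti; rewrite wmax wpt_greatest//= prednK.
  have e2 : (val w).2 = \top by rewrite e /= /wpt_pair eqxx /= prednK// eqxx.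
  have := covering_subproof w; rewrite e2 eqxx /= => /eqP iN.
  by rewrite [covering_wedge w]wptE /= e2; apply: boundary_max.
by apply/cpt_eqP/orP; right; rewrite !cb.
Qed.
End circle_points.

(** * Solenoids *)

Lemma prod_continuous (X : topologicalType) (I : Type) (K : I -> topologicalType)
    (f : X -> prod_topology K) :
  (forall i, continuous (fun x => f x i)) -> continuous f.
Proof.
move=> cf x; apply/cvg_sup => i.
exact: (@continuous_comp_initial (forall i, K i) X (K i) (fun h => h i) f (cf i)).
Qed.

Section solenoid_points.
Context {d : Order.disp_t} {T : tbOrderType d}.
Hypothesis bot_top : (\bot : T) <> \top.
Hypothesis cT : compact [set: order_topology T].
Variable p : nat -> nat.
Hypothesis p_gt0 : forall n, (0 < p n)%N.
Local Notation k n := (k_ p n).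
Local Notation S := (solenoid T p).
Implicit Types (x y : S) (z : T).

Lemma k_gt0 n : (0 < k n)%N.
Proof. by elim: n => //= n IH; rewrite muln_gt0 p_gt0. Qed.

Definition stage n (x : S) : circle T (k n) := (set_val x : prod_topology _) n.

Lemma stage_continuous n : continuous (stage n).
Proof.
move=> x; apply: (@continuous_comp S _ _ set_val (fun f : prod_topology (fun n => circle T (k n)) => f n)).
  exact: initial_continuous.
exact: proj_continuous.
Qed.

Lemma stage_covering n x : covering (stage n.+1 x : circle T (p n * k n)) = stage n x.
Proof. by have := set_valP x; apply. Qed.

Lemma stage_inj x y : (forall n, stage n x = stage n y) -> x = y.
Proof. by move=> xy; apply: val_inj; apply: functional_extensionality_dep => n; exact: xy. Qed.

Lemma solenoid_point (f : forall n, circle T (k n)) :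
  (forall n, covering (f n.+1 : circle T (p n * k n)) = f n) ->
  exists x, forall n, stage n x = f n.
Proof. by move=> fc; exists (SigSub (mem_set (fc : _ f))). Qed.

Lemma solenoid_continuous (X : topologicalType) (f : X -> S) :
  (forall n, continuous (stage n \o f)) -> continuous f.
Proof.
move=> cf; apply: continuous_comp_initial; apply: prod_continuous => n; exact: cf.
Qed.

Lemma open_stage n (U : set (circle T (k n))) : open U -> open (stage n @^-1` U).
Proof. by move=> oU; apply: open_comp => // x _; exact: stage_continuous. Qed.

(** A compatible choice of a copy of [T] in every circle: these are the points of a fibre. *)
Definition thread (g : forall n, 'I_(k n)) :=
  forall n, covering_idx (g n.+1 : 'I_(p n * k n)) = g n.

Definition spt_exists (g : forall n, 'I_(k n)) (tg : thread g) z :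
  {x : S | forall n, stage n x = cpt bot_top (g n) z}.
Proof.
apply: cid; apply: solenoid_point => n; rewrite covering_cpt; by rewrite tg.
Qed.

Local Notation cpt := (cpt bot_top).

(** The points at [z] along a thread form a copy of [T] in the solenoid. *)
Definition spt g (tg : thread g) z : S := sval (spt_exists tg z).

Lemma stage_spt g (tg : thread g) z n : stage n (spt tg z) = cpt (g n) z.
Proof. by rewrite /spt; case: spt_exists. Qed.

Lemma spt_continuous g (tg : thread g) : continuous (spt tg : order_topology T -> S).
Proof.
apply: solenoid_continuous => n; rewrite (_ : _ \o _ = cpt (g n)); first exact: cpt_continuous.
by apply/funext => z; exact: stage_spt.
Qed.

(** The coverings keep the position in [T], so the coordinates of a point have one position in common. *)
Lemma spt_surj x : exists g (tg : thread g) z, z <> \bot /\ x = spt tg z.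
Proof.
have ex n : {gz : 'I_(k n) * T | gz.2 <> \bot /\ stage n x = cpt gz.1 gz.2}.
  by apply: cid; have [i [z [z0 e]]] := cpt_surj bot_top (stage n x); exists (i, z).
pose g n := (sval (ex n)).1; pose z n := (sval (ex n)).2.
have z0 n : z n <> \bot by rewrite /z; case: (ex n) => gz [].
have xE n : stage n x = cpt (g n) (z n) by rewrite /g /z; case: (ex n) => gz [].
have step n : covering_idx (g n.+1 : 'I_(p n * k n)) = g n /\ z n.+1 = z n.
  apply: (cpt_inj (z0 n.+1) (z0 n)); rewrite -(xE n) -(stage_covering n x) (xE n.+1).
  exact/esym/(@covering_cpt _ _ _ (p n) (k n)).
have tg : thread g by move=> n; case: (step n).
have zE n : z n = z 0%N by elim: n => // n <-; case: (step n).
by exists g, tg, (z 0%N); split=> //; apply: stage_inj => n; rewrite stage_spt xE zE.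
Qed.

Lemma spt_inj g g' (tg : thread g) (tg' : thread g') z z' : z <> \bot -> z' <> \bot ->
  spt tg z = spt tg' z' -> (forall n, g n = g' n) /\ z = z'.
Proof.
move=> z0 z'0 e; have h n : g n = g' n /\ z = z'.
  by apply: (cpt_inj z0 z'0); rewrite -!stage_spt e.
by split=> [n|]; [case: (h n)|case: (h 0%N)].
Qed.

Lemma spt_ext g g' (tg : thread g) (tg' : thread g') z :
  (forall n, g n = g' n) -> spt tg z = spt tg' z.
Proof. by move=> gg'; apply: stage_inj => n; rewrite !stage_spt gg'. Qed.

Lemma thread0_proof : thread (fun n => Ordinal (k_gt0 n)).
Proof. by move=> n; apply: val_inj; rewrite /= mod0n. Qed.

(** ** Lifting automorphisms of [T] *)

Definition rot n (a : nat) (i : 'I_(k n)) : 'I_(k n) :=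
  Ordinal (ltn_pmod (i + a) (k_gt0 n)).

Lemma rot_ordS n a (i : 'I_(k n)) : ordS (rot a i) = rot a (ordS i).
Proof. by apply: ord_inj; rewrite /= -addn1 modnDml modnDml addnAC addn1. Qed.

(** Rotate the [n]-th circle by [a n] copies and apply [h] in each copy; the congruences make these maps
   commute with the coverings. *)
Lemma shift_map (a : nat -> nat) (h : T -> T) :
  (forall n, (a n.+1 = a n %[mod k n])%N) ->
  continuous (h : order_topology T -> order_topology T) -> h \bot = \bot -> h \top = \top ->
  exists2 F : S -> S, continuous F &
    forall x n i z, stage n x = cpt i z -> stage n (F x) = cpt (rot (a n) i) (h z).
Proof.
move=> ac ch h0 h1.
have ex n : {f : circle T (k n) -> circle T (k n) | forall i z, f (cpt i z) = cpt (rot (a n) i) (h z)}.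
  apply: cid; apply: (@circle_lift _ _ bot_top (k n) _ (fun i z => cpt (rot (a n) i) (h z))) => i.
  by rewrite h1 h0 cpt_top rot_ordS.
pose f n := sval (ex n).
have fE n i z : f n (cpt i z) = cpt (rot (a n) i) (h z) by rewrite /f; case: (ex n).
have fc n : continuous (f n).
  apply: (circle_continuous (bot_top := bot_top)) => // i; rewrite (_ : _ \o _ = cpt (rot (a n) i) \o h).
    move=> z; apply: (@continuous_comp (order_topology T) (order_topology T) _ h (cpt (rot (a n) i))).
      exact: ch.
    exact: cpt_continuous.
  by apply/funext => z; exact: fE.
have Fx x : {y : S | forall n, stage n y = f n (stage n x)}.
  apply: cid; apply: solenoid_point => n.
  have [i [z [_ e]]] := cpt_surj bot_top (stage n.+1 x).
  rewrite -[in RHS]stage_covering e fE [in RHS](@covering_cpt _ _ _ (p n) (k n)).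
  rewrite fE (@covering_cpt _ _ _ (p n) (k n)); congr (cpt _ _); apply: val_inj => /=.
  rewrite modn_dvdm ?dvdn_mull// modnDml; apply/eqP.
  by rewrite eqn_modDl; apply/eqP; exact: ac.
exists (fun x => sval (Fx x)).
  apply: solenoid_continuous => n; rewrite (_ : _ \o _ = f n \o stage n).
    by move=> x; apply: continuous_comp; [exact: stage_continuous|exact: fc].
  apply/funext => x; exact: (svalP (Fx x) n).
by move=> x n i z e; rewrite (svalP (Fx x) n) e fE.
Qed.

(** The differences of two threads are compatible rotations; the opposite rotations with the inverse of [h]
   give the inverse. *)
Lemma shift_homeomorphism g g' (tg : thread g) (tg' : thread g') (h h' : T -> T) :
  {mono h : x y / x <= y} -> cancel h h' -> cancel h' h ->
  exists2 F : S -> S, homeomorphism F & forall z, F (spt tg z) = spt tg' (h z).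
Proof.
move=> hm hK h'K.
have h'm : {mono h' : x y / x <= y} by move=> x y; rewrite -hm !h'K.
have hc (f f' : T -> T) : {mono f : x y / x <= y} -> cancel f' f ->
    [/\ continuous (f : order_topology T -> order_topology T), f \bot = \bot & f \top = \top].
  move=> fm fK; split.
  - by apply: order_embedding_continuous => // x y t _ _; exists (f' t).
  - by apply/eqP; rewrite -lex0 -[X in _ <= X]fK fm le0x.
  - by apply/eqP; rewrite -le1x -[X in X <= _]fK fm lex1.
(* Adding [k n] keeps the difference from being truncated. *)
pose a (g g' : forall n, 'I_(k n)) n := (g' n + k n - g n)%N.
have ak (u v : forall n, 'I_(k n)) n : (u n + a u v n = v n + k n)%N.
  by rewrite /a subnKC// (leq_trans (ltnW (ltn_ord _)))// leq_addl.
have ac u v : thread u -> thread v -> forall n, (a u v n.+1 = a u v n %[mod k n])%N.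
  move=> tu tv n; apply/eqP; rewrite -(eqn_modDl (u n)) ak.
  have -> : (u n + a u v n.+1 = u n.+1 + a u v n.+1 %[mod k n])%N.
    by rewrite -(tu n) /= modnDml.
  have kk : (k n.+1 %% k n = 0)%N by rewrite /= modnMl.
  by rewrite ak -modnDmr kk addn0 modnDr -(tv n) /= modn_mod.
have [F Fc FE] := let: And3 c b t := hc h h' hm h'K in shift_map (ac _ _ tg tg') c b t.
have [G Gc GE] := let: And3 c b t := hc h' h h'm hK in shift_map (ac _ _ tg' tg) c b t.
have rotK (u v : forall n, 'I_(k n)) n (i : 'I_(k n)) : rot (a v u n) (rot (a u v n) i) = i.
  apply: ord_inj; rewrite /= modnDml -addnA /a.
  have -> : (v n + k n - u n + (u n + k n - v n) = k n + k n)%N by have := ltn_ord (u n); have := ltn_ord (v n); lia.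
  by rewrite addnA !modnDr modn_small.
exists F.
  exists G; split=> // x; apply: stage_inj => n; have [i [z [_ e]]] := cpt_surj bot_top (stage n x).
    by rewrite (GE _ _ _ _ (FE _ _ _ _ e)) rotK hK.
  by rewrite (FE _ _ _ _ (GE _ _ _ _ e)) rotK h'K.
move=> z; apply: stage_inj => n; rewrite (FE _ _ _ _ (stage_spt tg z n)) stage_spt.
by congr (cpt _ _); apply: ord_inj; rewrite /= ak modnDr modn_small.
Qed.
End solenoid_points.

(** * Topological invariants of points *)

Section invariants.
Variable X : topologicalType.
Implicit Types (C U : set X) (x y : X).

(** Separability made hereditary: the dense set need not lie in [C]. *)
Definition small C := exists2 D : set X, countable D & C `<=` closure D.

Lemma small_sub C C' : C `<=` C' -> small C' -> small C.
Proof. by move=> CC' [D cD C'D]; exists D => // x /CC'; exact: C'D. Qed.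

Lemma smallU C C' : small C -> small C' -> small (C `|` C').
Proof.
move=> [D cD CD] [D' cD' CD']; exists (D `|` D').
  by rewrite -bigcup2E; apply: bigcup_countable => // -[|[|]] //= _; exact: countable0.
by move=> x [/CD|/CD']; apply: closureS => y; [left|right].
Qed.

(** In an ordered continuum: no neighbourhood of [x] is separable. Connected sets stand for intervals, since
   in a solenoid a neighbourhood of a point is only the product of an interval with a set of sheets. *)
Definition nonreal x := forall U, nbhs x U ->
  exists C, [/\ connected C, C `<=` U, C x & ~ small C].

(** In an ordered continuum: neither side of [x] is separable near [x]. *)
Definition two_sided x := forall U, nbhs x U -> exists C1 C2,
  [/\ connected C1, connected C2, C1 `|` C2 `<=` U, C1 `&` C2 = [set x] &
      ~ small C1 /\ ~ small C2].

(** The Cantor-Bendixson rank of [x] among the nonreal points is at least [b]. The accumulation is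
   required along connected sets, because along the fibres every point is a limit of points that look
   the same. *)
Inductive has_rank (K : ordnum) : K -> X -> Prop :=
| HasRank b x : nonreal x ->
    (forall b', b' < b -> forall U, nbhs x U -> exists C y,
      [/\ connected C, C `<=` U, C x, C y & y <> x /\ has_rank b' y]) ->
    has_rank b x.

Lemma has_rank_inv (K : ordnum) (b : K) x : has_rank b x -> nonreal x /\
  (forall b', b' < b -> forall U, nbhs x U -> exists C y,
      [/\ connected C, C `<=` U, C x, C y & y <> x /\ has_rank b' y]).
Proof. by case. Qed.

Definition exact_rank (K : ordnum) (b : K) x :=
  has_rank b x /\ forall b', b < b' -> ~ has_rank b' x.
End invariants.

Section homeomorphism_invariance.
Variables (X Y : topologicalType) (f : X -> Y) (g : Y -> X).
Hypotheses (fc : continuous f) (gc : continuous g) (fK : cancel f g).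
Implicit Types (C : set X) (x : X).

Lemma nbhs_homeo x (U : set Y) : nbhs (f x) U -> nbhs x (f @^-1` U).
Proof. exact: fc. Qed.

Lemma small_homeo C : small (f @` C) -> small C.
Proof.
move=> [D cD CD]; exists (g @` D); first exact: card_le_trans (card_image_le _ _) cD.
move=> x Cx B Bx; have [|y [Dy By]] := CD (f x) (imageP _ Cx) (g @^-1` B).
  by apply: gc; rewrite fK.
by exists (g y).
Qed.

Lemma connected_homeo C : connected C -> connected (f @` C).
Proof. by move=> cC; apply: connected_continuous_connected => //; exact: continuous_subspaceT. Qed.

Lemma nonreal_homeo x : nonreal x -> nonreal (f x).
Proof.
move=> nx U /nbhs_homeo/nx[C [cC CU Cx nC]]; exists (f @` C); split.
- exact: connected_homeo.
- by move=> _ [y Cy <-]; exact: CU.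
- exact: imageP.
- by move=> /small_homeo.
Qed.

Lemma two_sided_homeo x : two_sided x -> two_sided (f x).
Proof.
move=> nx U /nbhs_homeo/nx[C1 [C2 [cC1 cC2 CU CC [nC1 nC2]]]].
exists (f @` C1), (f @` C2); split; [exact: connected_homeo|exact: connected_homeo| | |].
- by move=> _ [[y Cy <-]|[y Cy <-]]; apply: CU; [left|right].
- apply/seteqP; split=> [_ [[y C1y <-] [z C2z /(can_inj fK) zy]]|_ ->].
    have : (C1 `&` C2) y by split=> //; rewrite -zy.
    by rewrite CC => ->.
  by have : (C1 `&` C2) x by [rewrite CC]; move=> [? ?]; split; exact: imageP.
- by split=> /small_homeo.
Qed.

Lemma has_rank_homeo (K : ordnum) (b : K) x : has_rank b x -> has_rank b (f x).
Proof.
elim: (@ord_wf K b) x => {}b _ IH x /has_rank_inv[nx xb].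
constructor; first exact: nonreal_homeo.
move=> b' b'b U /nbhs_homeo/(xb b' b'b)[C [y [cC CU Cx Cy [yx yb']]]].
exists (f @` C), (f y); split; [exact: connected_homeo| |exact: imageP|exact: imageP|].
  by move=> _ [z Cz <-]; exact: CU.
by split; [move=> /(can_inj fK)|exact: IH].
Qed.
End homeomorphism_invariance.

Lemma exact_rank_homeo (X Y : topologicalType) (f : X -> Y) (K : ordnum) (b : K) (x : X) :
  homeomorphism f -> exact_rank b x -> exact_rank b (f x).
Proof.
move=> [g [fc gc fK gK]] [xb xnb]; split.
  exact: (has_rank_homeo fc gc fK xb).
move=> b' bb' fxb'; apply: (xnb b' bb').
by have := has_rank_homeo gc fc gK fxb'; rewrite fK.
Qed.

Section solenoid_invariants.
Context {d : Order.disp_t} {T : tbOrderType d}.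
Hypothesis bot_top : (\bot : T) <> \top.
Hypothesis dense : order_dense T.
Hypothesis filled : cuts_filled T.
Variable p : nat -> nat.
Local Notation k n := (k_ p n).
Local Notation S := (solenoid T p).
Local Notation oT := (order_topology T).
Local Notation spt := (spt bot_top).
Local Notation cpt := (cpt bot_top).
Implicit Types (x y : S) (u v z : T) (g : forall n, 'I_(k n)).

Definition left_bad z := forall u, u < z -> ~ small ([set x | u <= x /\ x <= z] : set oT).
Definition right_bad z := forall v, z < v -> ~ small ([set x | z <= x /\ x <= v] : set oT).

(** The part of the solenoid above an open interval of [T]: the product of the interval with a fibre. *)
Definition tube u v : set S := stage 0 @^-1` (cpt ord0 @` [set z | u < z /\ z < v]).

Lemma tube_open u v : v <> \top -> open (tube u v).
Proof. by move=> vt; apply: open_stage; exact: cpt_open. Qed.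

Lemma tube_spt u v g (tg : thread g) z : z <> \bot ->
  tube u v (spt tg z) <-> u < z /\ z < v.
Proof.
move=> z0; split=> [[z' [uz' z'v]]|uzv]; last first.
  by exists z => //; rewrite stage_spt; congr (cpt _ _); rewrite [RHS]ord1.
rewrite stage_spt => e.
have z'0 : z' <> \bot by move=> e'; move: uz'; rewrite e' ltx0.
by have [_ <-] := cpt_inj z'0 z0 e.
Qed.

Lemma gt_bot u z : u < z -> z <> \bot.
Proof. by move=> uz z0; move: uz; rewrite z0 ltx0. Qed.
Lemma lt_top z v : z < v -> z <> \top.
Proof. by move=> uz z0; move: uz; rewrite z0 lt1x. Qed.

(** The copy of [T] to which a point of the tube belongs is locally constant at every stage, hence constant
   on connected sets. *)
Lemma connected_tube u v g (tg : thread g) z (C : set S) : v <> \top -> z <> \bot ->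
  connected C -> C `<=` tube u v -> C (spt tg z) ->
  forall y, C y -> exists2 z', u < z' /\ z' < v & y = spt tg z'.
Proof.
move=> vt z0 cC CU Cz y Cy; have [g' [tg' [z' [z'0 yE]]]] := spt_surj bot_top y.
have uzv : u < z' /\ z' < v by rewrite -(tube_spt _ _ tg')// -yE; exact: CU.
exists z' => //; rewrite yE; apply: spt_ext => n.
have inj (i j : 'I_(k n)) a b : u < a /\ a < v -> u < b /\ b < v -> cpt i a = cpt j b -> i = j.
  by move=> [/gt_bot a0 _] [/gt_bot b0 _] /(cpt_inj a0 b0)[].
pose I : set T := [set z | u < z /\ z < v].
pose V1 : set S := stage n @^-1` (cpt (g n) @` I).
pose V2 : set S := stage n @^-1` (\bigcup_(j in [set j | j <> g n]) (cpt j @` I)).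
have : C `<=` V1.
  apply: (@connected_sub_open _ C V1 V2) => //.
  - by apply: open_stage; exact: cpt_open.
  - by apply: open_stage; apply: bigcup_open => j _; exact: cpt_open.
  - move=> t Ct; have [g1 [tg1 [z1 [z10 tE]]]] := spt_surj bot_top t.
    have uz1 : u < z1 /\ z1 < v by rewrite -(tube_spt _ _ tg1)// -tE; exact: CU.
    have [e|ne] := pselect (g1 n = g n); [left|right].
      by exists z1 => //; rewrite tE stage_spt e.
    by exists (g1 n) => //; exists z1 => //; rewrite tE stage_spt.
  - apply/seteqP; split=> // t [_ [[a Ia ea] [j jn [b Ib eb]]]].
    by apply: jn; apply: (inj _ _ b a) => //; rewrite eb ea.
  - exists (spt tg z); split=> //; exists z; last by rewrite stage_spt.
    by rewrite /I /= -(tube_spt _ _ tg)//; exact: CU.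
move=> /(_ y Cy)[a Ia]; rewrite yE stage_spt => e.
by apply/esym; exact: (inj _ _ a z').
Qed.

(** The tubes below and above a missing point would separate [C]. *)
Lemma connected_tube_convex u v g (tg : thread g) (C : set S) : v <> \top ->
  connected C -> C `<=` tube u v -> convex [set z | u < z /\ z < v /\ C (spt tg z)].
Proof.
move=> vt cC CU a b c [ua [av Ca]] [uc [cv Cc]] ab bc.
split; first exact: lt_le_trans ab.
split; first exact: le_lt_trans cv.
apply: contrapT => nCb.
have {}ab : a < b by rewrite lt_neqAle ab andbT; apply/eqP => e; apply: nCb; rewrite -e.
have {}bc : b < c by rewrite lt_neqAle bc andbT; apply/eqP => e; apply: nCb; rewrite e.
have a0 := gt_bot ua; have c0 := gt_bot uc.
have : C `<=` tube u b.
  apply: (@connected_sub_open _ C (tube u b) (tube b v)) => //.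
  - by apply: tube_open; exact: lt_top bc.
  - exact: tube_open.
  - move=> y Cy; have [z [uz zv] e] := connected_tube vt a0 cC CU Ca Cy.
    have z0 := gt_bot uz; rewrite e; case: (ltgtP z b) => [zb|bz|zb].
    + by left; apply/tube_spt.
    + by right; apply/tube_spt.
    + by case: nCb; rewrite -zb -e.
  - apply/seteqP; split=> // y [Cy []].
    have [z [uz zv] e] := connected_tube vt a0 cC CU Ca Cy.
    rewrite e => /(tube_spt _ _ _ (gt_bot uz))[_ zb] /(tube_spt _ _ _ (gt_bot uz))[bz _].
    by move: (lt_trans zb bz); rewrite ltxx.
  - by exists (spt tg a); split=> //; apply/tube_spt.
move=> /(_ _ Cc)/(tube_spt _ _ _ c0)[_]; by rewrite ltNge (ltW bc).
Qed.

(** A countable set of the solenoid is projected to [T]. Density survives at interior points of [T], above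
   which tubes are neighbourhoods, and the two end points are added. *)
Lemma small_spt g (tg : thread g) (J : set oT) : small (spt tg @` J) <-> small J.
Proof.
split=> [[D cD JD]|[D cD JD]]; last first.
  exists (spt tg @` D); first exact: card_le_trans (card_image_le _ _) cD.
  move=> _ [z Jz <-] B; have := @spt_continuous _ _ bot_top p g tg z B.
  by move=> /[apply] /(JD z Jz)[y [Dy By]]; exists (spt tg y); split=> //; exact: imageP.
have zeta y : {z : T | z <> \bot /\ stage 0 y = cpt ord0 z}.
  apply: cid; have [i [z [z0 e]]] := cpt_surj bot_top (stage 0 y).
  by exists z; split=> //; rewrite e; congr (cpt _ _); exact: ord1.
pose ze y := sval (zeta y).
exists ((ze @` D) `|` [set \bot; \top]).
  rewrite -bigcup2E; apply: bigcup_countable => // -[|[|]] //= _.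
  - exact: card_le_trans (card_image_le _ _) cD.
  - by apply: finite_set_countable; exact: finite_set2.
move=> z Jz B Bz.
have [z0|z0] := eqVneq z \bot; first by exists z; split; [right; left|exact: nbhs_singleton].
have [zt|zt] := eqVneq z \top; first by exists z; split; [right; right|exact: nbhs_singleton].
have bz : \bot < z by rewrite lt0x.
have zb : z < \top by rewrite ltx1.
have [u [v [_ uz zv _ uvB]]] := order_nbhs_between Bz bz zb.
have [v' [zv' v'v]] := dense zv; have v't := lt_top v'v.
have [|y [Dy Uy]] := JD (spt tg z) (imageP _ Jz) (tube u v').
  apply: open_nbhs_nbhs; split; first exact: tube_open.
  by apply/tube_spt => //; exact/eqP.
exists (ze y); split; first by left; exact: imageP.
move: Uy => [a [ua av']]; rewrite /ze; case: (zeta y) => /= b [b0 ->].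
move=> /(cpt_inj (gt_bot ua) b0)[_ <-]; apply: uvB => //; exact: lt_trans v'v.
Qed.

Lemma closed_itv_convex u v : convex [set x | u <= x /\ x <= v].
Proof.
by move=> a b c [ua _] [_ cv] ab bc; split; [exact: le_trans ab|exact: le_trans cv].
Qed.

Lemma connected_spt g (tg : thread g) (J : set T) : convex J ->
  connected (spt tg @` (J : set oT)).
Proof.
move=> cJ; apply: connected_continuous_connected; first exact: convex_connected.
by apply: continuous_subspaceT; exact: spt_continuous.
Qed.

Lemma left_nbhs g (tg : thread g) z U : z <> \bot -> nbhs (spt tg z) U ->
  exists u, [/\ \bot < u, u < z & spt tg @` [set x | u <= x /\ x <= z] `<=` U].
Proof.
move=> z0 /(@spt_continuous _ _ bot_top p g tg z) Uz.
have bz : \bot < z by rewrite lt0x; exact/eqP.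
have [u [_ uz uU]] := order_nbhs_left Uz bz; have [u' [uu' u'z]] := dense uz.
exists u'; split=> //; first exact: le_lt_trans uu'.
by move=> _ [x [u'x xz] <-]; apply: uU => //; exact: lt_le_trans u'x.
Qed.

Lemma right_nbhs g (tg : thread g) z U : z <> \top -> nbhs (spt tg z) U ->
  exists2 v, z < v & spt tg @` [set x | z <= x /\ x <= v] `<=` U.
Proof.
move=> z0 /(@spt_continuous _ _ bot_top p g tg z) Uz.
have bz : z < \top by rewrite ltx1; exact/eqP.
have [v [zv _ vU]] := order_nbhs_right Uz bz; have [v' [zv' v'v]] := dense zv.
exists v' => // _ [x [zx xv'] <-]; apply: vU => //; exact: le_lt_trans v'v.
Qed.

Lemma left_bad_nonreal g (tg : thread g) z : z <> \bot -> left_bad z -> nonreal (spt tg z).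
Proof.
move=> z0 lz U /(left_nbhs z0)[u [_ uz uU]].
exists (spt tg @` [set x | u <= x /\ x <= z]); split=> //.
- exact/connected_spt/closed_itv_convex.
- by exists z; rewrite //= lexx ltW.
- by move=> /small_spt; exact: lz.
Qed.

(** If both sides of [z] were separable near [z], so would be every connected set in a thin tube. *)
Lemma nonreal_bad g (tg : thread g) z : z <> \bot -> z <> \top -> nonreal (spt tg z) ->
  left_bad z \/ right_bad z.
Proof.
move=> z0 zt nz; apply: contrapT => /not_orP[/existsNP[u /not_implyP[uz /contrapT lz]]].
move=> /existsNP[v /not_implyP[zv /contrapT rz]].
have [v' [zv' v'v]] := dense zv; have v't := lt_top v'v.
have [|C [cC CU Cz]] := nz (tube u v').
  by apply: open_nbhs_nbhs; split; [exact: tube_open|apply/tube_spt].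
apply; apply: small_sub (iffRL (small_spt tg _) (smallU lz rz)) => y Cy.
have [a [ua av'] ->] := connected_tube v't z0 cC CU Cz Cy; apply: imageP.
by case: (leP a z) => [az|/ltW za]; [left|right]; split=> //; apply/ltW => //; exact: lt_trans v'v.
Qed.

(** Two connected sets that meet only at the point cannot both go beyond [z] on the same side, so that when
   one side is separable one of the two sets is small. *)
Lemma two_sidedP g (tg : thread g) z : z <> \bot -> z <> \top ->
  two_sided (spt tg z) <-> left_bad z /\ right_bad z.
Proof.
move=> z0 zt; split=> [tz|[lz rz] U Uz]; last first.
  have [u [bu uz uU]] := left_nbhs z0 Uz; have [v zv vU] := right_nbhs zt Uz.
  exists (spt tg @` [set x | u <= x /\ x <= z]), (spt tg @` [set x | z <= x /\ x <= v]); split.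
  - exact/connected_spt/closed_itv_convex.
  - exact/connected_spt/closed_itv_convex.
  - by move=> y [/uU|/vU].
  - apply/seteqP; split=> [_ [[a [ua az] <-] [b [zb bv]]]|_ ->].
      move=> /(spt_inj _ _)[||_ ba]; [exact: gt_bot (lt_le_trans uz zb)|exact: gt_bot (lt_le_trans bu ua)|].
      by congr (spt tg _); apply/le_anti; rewrite az -ba.
    by split; exists z; rewrite //= lexx ltW.
  - by split=> /small_spt; [exact: lz|exact: rz].
have zb : z < \top by rewrite ltx1; exact/eqP.
have bz : \bot < z by rewrite lt0x; exact/eqP.
split.
- move=> u uz sm; have [v' [zv' v't]] := dense zb; have {}v't := lt_top v't.
  have [|C1 [C2 [cC1 cC2 CU CC [n1 n2]]]] := tz (tube u v').
    by apply: open_nbhs_nbhs; split; [exact: tube_open|apply/tube_spt].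
  have Cz : (C1 `&` C2) (spt tg z) by rewrite CC.
  have far (C : set S) : connected C -> C `<=` tube u v' -> C (spt tg z) -> ~ small C ->
      exists2 a, z < a & u < a /\ a < v' /\ C (spt tg a).
    move=> cC CU' Cz' nC; apply: contrapT => no; apply: nC.
    apply: small_sub (iffRL (small_spt tg _) sm) => y Cy.
    have [a [ua av'] ya] := connected_tube v't z0 cC CU' Cz' Cy.
    rewrite ya; apply: imageP; split; first exact: ltW.
    by rewrite leNgt; apply/negP => za; apply: no; exists a => //; rewrite -ya.
  have CU1 : C1 `<=` tube u v' by move=> y ?; apply: CU; left.
  have CU2 : C2 `<=` tube u v' by move=> y ?; apply: CU; right.
  have [a1 za1 J1] := far C1 cC1 CU1 Cz.1 n1; have [a2 za2 J2] := far C2 cC2 CU2 Cz.2 n2.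
  have J1z : [set x | u < x /\ x < v' /\ C1 (spt tg x)] z by split=> //; split=> //; exact: Cz.1.
  have J2z : [set x | u < x /\ x < v' /\ C2 (spt tg x)] z by split=> //; split=> //; exact: Cz.2.
  have za : z < Order.min a1 a2 by rewrite lt_min za1.
  have [_ [_ m1]] : [set x | u < x /\ x < v' /\ C1 (spt tg x)] (Order.min a1 a2).
    apply: connected_tube_convex (v't) cC1 CU1 _ _ _ J1z J1 (ltW za) _; by rewrite ge_min lexx.
  have [_ [_ m2]] : [set x | u < x /\ x < v' /\ C2 (spt tg x)] (Order.min a1 a2).
    apply: connected_tube_convex (v't) cC2 CU2 _ _ _ J2z J2 (ltW za) _; by rewrite ge_min lexx orbT.
  have : (C1 `&` C2) (spt tg (Order.min a1 a2)) by [].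
  rewrite CC => /(spt_inj _ z0)[|_ e]; first exact: gt_bot za.
  by move: za; rewrite e ltxx.
- move=> v zv sm; have [v' [zv' v'v]] := dense zv; have v't := lt_top v'v.
  have [|C1 [C2 [cC1 cC2 CU CC [n1 n2]]]] := tz (tube \bot v').
    by apply: open_nbhs_nbhs; split; [exact: tube_open|apply/tube_spt].
  have Cz : (C1 `&` C2) (spt tg z) by rewrite CC.
  have far (C : set S) : connected C -> C `<=` tube \bot v' -> C (spt tg z) -> ~ small C ->
      exists2 a, a < z & \bot < a /\ a < v' /\ C (spt tg a).
    move=> cC CU' Cz' nC; apply: contrapT => no; apply: nC.
    apply: small_sub (iffRL (small_spt tg _) sm) => y Cy.
    have [a [ua av'] ya] := connected_tube v't z0 cC CU' Cz' Cy.
    rewrite ya; apply: imageP; split; last exact/ltW/(lt_trans av').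
    by rewrite leNgt; apply/negP => za; apply: no; exists a => //; rewrite -ya.
  have CU1 : C1 `<=` tube \bot v' by move=> y ?; apply: CU; left.
  have CU2 : C2 `<=` tube \bot v' by move=> y ?; apply: CU; right.
  have [a1 za1 J1] := far C1 cC1 CU1 Cz.1 n1; have [a2 za2 J2] := far C2 cC2 CU2 Cz.2 n2.
  have J1z : [set x | \bot < x /\ x < v' /\ C1 (spt tg x)] z by split=> //; split=> //; exact: Cz.1.
  have J2z : [set x | \bot < x /\ x < v' /\ C2 (spt tg x)] z by split=> //; split=> //; exact: Cz.2.
  have za : Order.max a1 a2 < z by rewrite gt_max za1.
  have [b0 [_ m1]] : [set x | \bot < x /\ x < v' /\ C1 (spt tg x)] (Order.max a1 a2).
    apply: connected_tube_convex (v't) cC1 CU1 _ _ _ J1 J1z _ (ltW za); by rewrite le_max lexx.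
  have [_ [_ m2]] : [set x | \bot < x /\ x < v' /\ C2 (spt tg x)] (Order.max a1 a2).
    apply: connected_tube_convex (v't) cC2 CU2 _ _ _ J2 J2z _ (ltW za); by rewrite le_max lexx orbT.
  have : (C1 `&` C2) (spt tg (Order.max a1 a2)) by [].
  rewrite CC => /(spt_inj _ z0)[|_ e]; first exact: gt_bot b0.
  by move: za; rewrite e ltxx.
Qed.

(** A relation [N] on [T] is the rank if it obeys the recursion that defines it: lower ranks accumulate from
   the left at points where [N] holds, some lower rank does not occur around interior points where it fails, and the last point has
   every rank. *)
Lemma has_rank_spt (K : ordnum) (N : T -> K -> Prop) :
  (forall z b, N z b -> left_bad z) ->
  (forall z b b' u, N z b -> b' < b -> u < z -> exists y : T, [/\ u < y, y < z & N y b']) ->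
  (forall b, N \top b) ->
  (forall z b, z <> \bot -> z <> \top -> left_bad z \/ right_bad z -> ~ N z b ->
     exists b' u v, [/\ b' < b, u < z, z < v &
       forall y : T, u < y -> y < v -> y <> z -> ~ N y b']) ->
  forall g (tg : thread g) z b, z <> \bot -> has_rank b (spt tg z) <-> N z b.
Proof.
move=> Nbad Nlim Ntop Nisol g tg z b.
elim: (@ord_wf K b) z => {}b _ IH z z0; split=> [/has_rank_inv[nz zb]|Nz].
  apply: contrapT => nN.
  have zt : z <> \top by move=> e; apply: nN; rewrite e.
  have [b' [u [v [b'b uz zv iso]]]] := Nisol z b z0 zt (nonreal_bad z0 zt nz) nN.
  have [v' [zv' v'v]] := dense zv; have v't := lt_top v'v.
  have [|C [y [cC CU Cz Cy [yz yb']]]] := zb b' b'b (tube u v').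
    by apply: open_nbhs_nbhs; split; [exact: tube_open|apply/tube_spt].
  have [a [ua av'] ya] := connected_tube v't z0 cC CU Cz Cy.
  have av := lt_trans av' v'v; apply: (iso a ua av).
    by move=> e; apply: yz; rewrite ya e.
  by apply/(IH b' b'b a (gt_bot ua)); rewrite -ya.
constructor; first exact: left_bad_nonreal (Nbad z b Nz).
move=> b' b'b U /(left_nbhs z0)[u [_ uz uU]].
have [y [uy yz Ny]] := Nlim z b b' u Nz b'b uz; have y0 := gt_bot uy.
exists (spt tg @` [set x | y <= x /\ x <= z]), (spt tg y); split.
- exact/connected_spt/closed_itv_convex.
- move=> _ [x [yx xz] <-]; apply: uU; exists x => //; split=> //; exact: le_trans (ltW uy) yx.
- by exists z; rewrite //= lexx ltW.
- by exists y; rewrite //= lexx ltW.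
- split; last exact/IH.
  by move=> /(spt_inj y0 z0)[_ e]; move: yz; rewrite e ltxx.
Qed.
End solenoid_invariants.

(** * The continua *)

(** ** Reversing the order inside blocks *)

Definition cut_property d (T : orderType d) := forall L : set T,
  (forall x y, x <= y -> L y -> L x) -> L !=set0 -> (exists x, ~ L x) ->
  exists c, (forall x, x < c -> L x) /\ (forall x, c < x -> ~ L x).

Definition order_dense_set d (T : orderType d) (D : set T) :=
  forall x y, x < y -> exists z, [/\ D z, x < z & z < y].

Section reversal.
Context {d : Order.disp_t} {T : orderType d} (F : set (set T)).
Hypothesis Fconvex : forall J x y z, F J -> J x -> J z -> x <= y <= z -> J y.
Hypothesis Fdisj : forall J J' x, F J -> F J' -> J x -> J' x -> J = J'.
Hypothesis Fmin : forall J x, F J -> J x -> exists2 y, J y & y < x.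
Hypothesis Fmax : forall J x, F J -> J x -> exists2 y, J y & x < y.
Local Notation blk := (same_block F).

Definition rev_lt x y := if blk x y then y < x else x < y.

Lemma blkP x y : reflect (exists J, [/\ F J, J x & J y]) (blk x y).
Proof.
by apply: (iffP idP) => [/asboolP[J FJ [Jx Jy]]|[J [FJ Jx Jy]]]; [exists J|apply/asboolP; exists J].
Qed.

Lemma blk_in J x y : F J -> J x -> blk x y -> J y.
Proof. by move=> FJ Jx /blkP[J' [FJ' J'x J'y]]; rewrite (Fdisj FJ FJ' Jx J'x). Qed.

Lemma rev_lt_in J x y : F J -> J x -> J y -> rev_lt x y = (y < x).
Proof. by move=> FJ Jx Jy; rewrite /rev_lt; have -> : blk x y by apply/blkP; exists J. Qed.

Lemma rev_lt_out x y : ~~ blk x y -> rev_lt x y = (x < y).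
Proof. by rewrite /rev_lt => /negbTE ->. Qed.

Lemma blk_not_l J x y : F J -> J x -> ~ J y -> ~~ blk x y.
Proof. by move=> FJ Jx nJy; apply/negP => /(blk_in FJ Jx). Qed.

Lemma blk_not_r J x y : F J -> J y -> ~ J x -> ~~ blk x y.
Proof. by move=> FJ Jx nJy; rewrite same_blockC; exact: blk_not_l Jx nJy. Qed.

(** Inside a block the betweenness relation is unchanged. From a point in a block one can move
   towards any point outside it within the block, since blocks have no first or last point. *)
Lemma rev_dense (D : set T) : order_dense_set D ->
  forall x y, rev_lt x y -> exists z, [/\ D z, rev_lt x z & rev_lt z y].
Proof.
move=> dD x y; have [/blkP[J [FJ Jx Jy]]|nb] := boolP (blk x y).
  rewrite (rev_lt_in FJ)// => /dD[z [Dz yz zx]]; exists z.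
  have Jz : J z by apply: Fconvex FJ Jy Jx _; rewrite !ltW.
  by rewrite !(rev_lt_in FJ).
rewrite rev_lt_out// => xy.
have [[J [FJ Jx]]|nx] := pselect (exists J, F J /\ J x).
  have nJy : ~ J y by move=> Jy; move/negP: nb; apply; apply/blkP; exists J.
  have [x' Jx' x'x] := Fmin FJ Jx; have [z [Dz x'z zx]] := dD _ _ x'x; exists z.
  have Jz : J z by apply: Fconvex FJ Jx' Jx _; rewrite !ltW.
  split=> //; first by rewrite (rev_lt_in FJ).
  rewrite rev_lt_out; [exact: lt_trans zx xy|exact: (blk_not_l FJ Jz)].
have [[J [FJ Jy]]|ny] := pselect (exists J, F J /\ J y).
  have nJx : ~ J x by move=> Jx; move/negP: nb; apply; apply/blkP; exists J.
  have [y' Jy' yy'] := Fmax FJ Jy; have [z [Dz yz zy']] := dD _ _ yy'; exists z.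
  have Jz : J z by apply: Fconvex FJ Jy Jy' _; rewrite !ltW.
  split=> //; last by rewrite (rev_lt_in FJ).
  rewrite rev_lt_out; [exact: lt_trans xy yz|exact: (blk_not_r FJ Jz)].
have [z [Dz xz zy]] := dD _ _ xy; exists z; split=> //; rewrite rev_lt_out//.
  by apply/blkP => -[J [FJ Jx _]]; apply: nx; exists J.
by apply/blkP => -[J [FJ _ Jy]]; apply: ny; exists J.
Qed.

Lemma rev_leNlt x y : rev_le F x y = ~~ rev_lt y x.
Proof. by rewrite /rev_le /rev_lt same_blockC; case: ifP; rewrite leNgt. Qed.

(** A cut of the reversed order splits at most one block. If it splits none, it is a cut of the original
   order; otherwise the cut of that block, reversed, is filled in the original order. *)
Lemma rev_cut : cut_property T -> forall L : set T,
  (forall x y, rev_lt x y -> L y -> L x) -> L !=set0 -> (exists x, ~ L x) ->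
  exists c, (forall x, rev_lt x c -> L x) /\ (forall x, rev_lt c x -> ~ L x).
Proof.
move=> cut L Ldown L0 nL0.
have [down|] := pselect (forall x y, x <= y -> L y -> L x).
  have [c [cL cnL]] := cut L down L0 nL0.
  have nF J : F J -> ~ J c.
    move=> FJ Jc; have [x Jx xc] := Fmin FJ Jc; have [y Jy cy] := Fmax FJ Jc.
    apply: (cnL y cy); apply: (Ldown _ x); last exact: cL.
    by rewrite (rev_lt_in FJ)// (lt_trans xc).
  have nb x : ~~ blk x c by apply/blkP => -[J [FJ _]]; exact: nF.
  exists c; split=> x; first by rewrite rev_lt_out//; exact: cL.
  by rewrite rev_lt_out 1?same_blockC//; exact: cnL.
move=> /existsNP[x /existsNP[y /not_implyP[xy /not_implyP[Ly nLx]]]].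
have {}xy : x < y by rewrite lt_neqAle xy andbT; apply/eqP => e; apply: nLx; rewrite e.
have [/blkP[J [FJ Jx Jy]]|nb] := boolP (blk x y); last first.
  by case: nLx; apply: (Ldown _ y) => //; rewrite rev_lt_out.
pose L' : set T := [set z | exists u, [/\ J u, ~ L u & z <= u]].
have [|||c [cL cnL]] := cut L'.
- by move=> a b ab [u [Ju nLu bu]]; exists u; split=> //; exact: le_trans bu.
- by exists x, x.
- exists y => -[u [Ju nLu]]; rewrite le_eqVlt => /predU1P[e|yu]; first by apply: nLu; rewrite -e.
  by apply: nLu; apply: (Ldown _ y) => //; rewrite (rev_lt_in FJ).
have xc : x <= c.
  by rewrite leNgt; apply/negP => /cnL; apply; exists x.
have cy : c <= y.
  rewrite leNgt; apply/negP => /cL[u [Ju nLu]]; rewrite le_eqVlt => /predU1P[e|yu].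
    by apply: nLu; rewrite -e.
  by apply: nLu; apply: (Ldown _ y) => //; rewrite (rev_lt_in FJ).
have Jc : J c by apply: Fconvex FJ Jx Jy _; rewrite xc.
exists c; split=> z.
- have [Jz|nJz] := pselect (J z).
    rewrite (rev_lt_in FJ)// => cz; apply: contrapT => nLz; apply: (cnL z cz); by exists z.
  rewrite rev_lt_out; last exact: (blk_not_r FJ Jc).
  move=> zc; apply: (Ldown _ y) => //; rewrite rev_lt_out; last exact: (blk_not_r FJ Jy).
  exact: lt_le_trans zc cy.
- have [Jz|nJz] := pselect (J z).
    rewrite (rev_lt_in FJ)// => /cL[u [Ju nLu]]; rewrite le_eqVlt => /predU1P[->//|zu] Lz.
    by apply: nLu; apply: (Ldown _ z) => //; rewrite (rev_lt_in FJ).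
  rewrite rev_lt_out; last exact: (blk_not_l FJ Jc).
  move=> cz Lz; apply: nLx; apply: (Ldown _ z) => //; rewrite rev_lt_out; last exact: (blk_not_l FJ Jx).
  exact: le_lt_trans xc cz.
Qed.
End reversal.

(** ** Long lines *)

Section closed_long_line.
Variables (R : realType) (D : ordnum).
Local Notation line := (closed_long_line R D).
Implicit Types (a b : D) (s t : unit_co R).

Definition lpt a t : line := Some ((a, t) : long_line R D).

Lemma lpt_le a b s t : (lpt a s <= lpt b t) = (((a, s) : D *l unit_co R) <= (b, t)).
Proof. by []. Qed.

Lemma lpt_lt a b s t : (lpt a s < lpt b t) = (((a, s) : D *l unit_co R) < (b, t)).
Proof. by rewrite !ltNge lpt_le. Qed.

Lemma lpt_lt_none a t : lpt a t < None :> line.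
Proof. by rewrite ltNge. Qed.

Lemma none_max (x : line) : x <= None.
Proof. by case: x. Qed.

Definition mk_unit (x : R) (h : (0 <= x < 1)%R) : unit_co R := exist _ x h.

Lemma unit_ge0 t : (0 <= val t)%R. Proof. by case/andP: (valP t). Qed.
Lemma unit_lt1 t : (val t < 1)%R. Proof. by case/andP: (valP t). Qed.

Definition rational_pts : set line := [set x | exists a t q, x = lpt a t /\ val t = ratr q].

Lemma rational_right (x y : line) : x < y -> exists a s t q,
  [/\ x = lpt a s, lpt a t < y, s < t & val t = ratr q].
Proof.
case: x => [[a s]|]; last by rewrite ltNge none_max.
move=> xy; suff [m [sm m1 my]] : exists m : R, [/\ (val s < m)%R, (m <= 1)%R &
    forall t : unit_co R, (val t < m)%R -> lpt a t < y].
  have [q] := rat_in_itvoo sm; rewrite in_itv /= => /andP[sq qm].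
  have h : (0 <= (ratr q : R) < 1)%R by rewrite (le_trans (unit_ge0 s) (ltW sq)) (lt_le_trans qm).
  by exists a, s, (mk_unit h), q; split=> //; exact: my.
case: y xy => [[b t]|] xy; last first.
  by exists 1%R; split=> [|//|t _]; [exact: unit_lt1|exact: lpt_lt_none].
have := xy; rewrite -/(lpt a s) -/(lpt b t) lpt_lt ltxi_pair => /andP[].
rewrite le_eqVlt => /predU1P[e|ab].
  subst b; rewrite lexx /= => st; exists (val t); split=> [|| t' t't].
  - exact: st.
  - exact/ltW/unit_lt1.
  - by rewrite -/(lpt a t) lpt_lt ltxi_pair lexx.
move=> _; exists 1%R; split=> // [|t' _]; first exact: unit_lt1.
by rewrite -/(lpt b t) lpt_lt ltxi_pair (ltW ab) leNgt ab.
Qed.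

Lemma rational_dense : order_dense_set rational_pts.
Proof.
move=> x y /rational_right[a [s [t [q [-> ty st e]]]]]; exists (lpt a t); split=> //.
  by exists a, t, q.
by rewrite lpt_lt ltxi_pair lexx.
Qed.

(** The filling point lies in the first unit interval that is not contained in [L], at the supremum of the
   parameters that belong to [L]. *)
Lemma long_line_cut : cut_property line.
Proof.
move=> L down [x0 Lx0] [y0 nLy0].
have [allS|] := pselect (forall a t, L (lpt a t)).
  exists None; split=> [[[a t]|]|x].
  - by move=> _; exact: allS.
  - by rewrite ltxx.
  - by rewrite ltNge none_max.
move=> /existsNP[a0 /existsNP[t0 nLt0]].
have [|a [t nLt] amin] := @ord_min D [set a | exists t, ~ L (lpt a t)]; first by exists a0, t0.
have below b s : b < a -> L (lpt b s).
  by move=> ba; apply: contrapT => nL; have := amin b (ex_intro _ s nL); rewrite leNgt ba.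
pose X : set R := [set r | exists2 s, r = val s & L (lpt a s)].
have Xub r : X r -> (r <= val t)%R.
  move=> [s -> Ls]; rewrite leNgt; apply/negP => ts; apply: nLt; apply: down Ls.
  by rewrite lpt_le lexi_pair lexx /=; exact: ltW.
have [X0|/set0P/negP/negPn/eqP X0] := pselect (X !=set0).
- have hX : has_sup X by split=> //; exists (val t).
  have h : (0 <= sup X < 1)%R.
    apply/andP; split; last by rewrite (le_lt_trans _ (unit_lt1 t))// ge_sup.
    by have [r Xr] := X0; rewrite (le_trans _ (ub_le_sup hX.2 Xr))//; case: Xr => s -> _; exact: unit_ge0.
  exists (lpt a (mk_unit h)); split=> [[[b s]|]|[[b s]|]]; rewrite -?/(lpt b s).
  + rewrite lpt_lt ltxi_pair => /andP[]; rewrite le_eqVlt => /predU1P[-> /=|/below//].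
    rewrite lexx /= => sX; have [r [s' -> Ls'] ss'] := sup_gt X0 sX.
    by apply: down Ls'; rewrite lpt_le lexi_pair lexx; exact: ltW.
  + by rewrite ltNge none_max.
  + rewrite lpt_lt ltxi_pair => /andP[ab].
    rewrite le_eqVlt in ab; case/predU1P: ab => [<- /=|ab _ Lb].
      rewrite lexx /= => Xs Ls; have : (val s <= sup X)%R by apply: ub_le_sup; [exact: hX.2|exists s].
      by rewrite leNgt [X in ~~ X]Xs.
    by apply: nLt; apply: down Lb; rewrite lpt_le lexi_pair (ltW ab) /= leNgt ab.
  + by move=> _ Ln; apply: nLy0; apply: down Ln; exact: none_max.
- exists (lpt a (unit_co0 R)); split=> [[[b s]|]|[[b s]|]]; rewrite -?/(lpt b s).
  + rewrite lpt_lt ltxi_pair => /andP[]; rewrite le_eqVlt => /predU1P[-> /=|/below//].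
    by rewrite lexx /= ltNge [_ <= _]unit_ge0.
  + by rewrite ltNge none_max.
  + rewrite lpt_lt ltxi_pair => /andP[ab].
    rewrite le_eqVlt in ab; case/predU1P: ab => [<- /= _ Ls|ab _ Lb].
      have : X (val s) by exists s.
      by rewrite X0.
    by apply: nLt; apply: down Lb; rewrite lpt_le lexi_pair (ltW ab) /= leNgt ab.
  + by move=> _ Ln; apply: nLy0; apply: down Ln; exact: none_max.
Qed.
End closed_long_line.

(** ** Separability in ordered sets *)

Section separability_criteria.
Context {d : Order.disp_t} {T : orderType d}.
Local Notation oT := (order_topology T).

Lemma small_itv (D : set T) u v : order_dense_set D ->
  countable (D `&` [set x | u < x /\ x < v]) ->
  small ([set x | u <= x /\ x <= v] : set oT).
Proof.
move=> dD cD; exists ((D `&` [set x | u < x /\ x < v]) `|` [set u; v]).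
  rewrite -bigcup2E; apply: bigcup_countable => // -[|[|]] //= _.
  by apply: finite_set_countable; exact: finite_set2.
move=> z [uz zv] B Bz; have zB : B z by exact: nbhs_singleton.
move: uz zv; rewrite le_eqVlt => /predU1P[e _|uz]; first by exists z; split=> //; right; left.
rewrite le_eqVlt => /predU1P[e|zv]; first by exists z; split=> //; right; right.
have [u' [v' [uu' u'z zv' v'v B']]] := order_nbhs_between Bz uz zv.
have [x [Dx ux xz]] := dD _ _ u'z; exists x; split; last by apply: B' => //; exact: lt_trans zv'.
left; split=> //; split; first exact: le_lt_trans ux.
exact: lt_trans zv.
Qed.

(** A dense set would have a point in each of uncountably many disjoint open sets. *)
Lemma not_small (I : Type) (S : set I) (O : I -> set oT) (J : set oT) :
  ~ countable S -> (forall i, S i -> open (O i) /\ O i !=set0) ->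
  (forall i j x, S i -> S j -> O i x -> O j x -> i = j) ->
  (forall i, S i -> O i `<=` J) -> ~ small J.
Proof.
move=> ncS oO dis OJ [D cD JD].
have [i0 Si0] : S !=set0.
  by apply: contrapT => nS; apply: ncS; rewrite (_ : S = set0) //; apply/seteqP; split=> // i Si; case: nS; exists i.
have [x0 _] := (oO i0 Si0).2.
have ch i : {x | S i -> D x /\ O i x}.
  apply: cid; have [Si|] := pselect (S i); last by exists x0.
  have [oi [x Ox]] := oO i Si; have [||y [Dy Oy]] := JD x _ (O i); first exact: OJ Ox.
    by apply: open_nbhs_nbhs; split.
  by exists y.
apply: ncS; apply: card_le_trans cD; apply: (inj_card (f := fun i => sval (ch i))) => [i|i j] /=.
  by case: (ch i) => x /= h /h[].
case: (ch i) (ch j) => x /= hx [y /= hy] Si Sj e; subst y.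
by apply: (dis i j x) => //; [case: (hx Si)|case: (hy Sj)].
Qed.
End separability_criteria.

(** ** The order of Lambda(K, A) *)

Section Lambda_points.
Variables (R : realType) (K : ordnum) (A : set K).
Local Notation P := (ord_pow omega K).
Variables (pw : K -> P) (rk : P -> K).
Hypothesis PS : pow_structure pw rk.
Hypothesis Kup : forall b : K, exists b', b < b'.
Local Notation L0 := (Lambda0 R K).
Local Notation L := (Lambda R A).
Local Notation F := (@reversed_blocks R K A).
Implicit Types (w v : P) (a : omega1) (s t : unit_co R).

(** The point at parameter [s] after the ordinal [omega1 * w + a]. *)
Definition lp w a s : L0 := lpt ((w, a) : ord_mul omega1 P) s.
Definition start w : L0 := Lambda0_pt R w omega1_0.

Lemma lp_cases (x : L0) : x = None \/ exists w a s, x = lp w a s.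
Proof. by case: x => [[[w a] s]|]; [right; exists w, a, s|left]. Qed.

Lemma startE w : start w = lp w omega1_0 (unit_co0 R). Proof. by []. Qed.

Lemma lp_lt w w' a a' s s' : (lp w a s < lp w' a' s') =
  (w < w') || ((w == w') && (((a, s) : omega1 *l unit_co R) < (a', s'))).
Proof.
rewrite /lp lpt_lt !ltxi_pair !lexi_pair.
by case: (ltgtP w w') => //= ->; case: (ltgtP a a').
Qed.

Lemma lp_lt_w w w' a a' s s' : w < w' -> lp w a s < lp w' a' s'.
Proof. by rewrite lp_lt => ->. Qed.

Lemma lp_lt_same w a a' s s' : (lp w a s < lp w a' s') = (((a, s) : omega1 *l unit_co R) < (a', s')).
Proof. by rewrite lp_lt ltxx eqxx. Qed.

Lemma lp_lt_a w a a' s s' : a < a' -> lp w a s < lp w a' s'.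
Proof. by move=> aa'; rewrite lp_lt_same ltxi_pair (ltW aa') leNgt aa'. Qed.

Lemma lp_lt_none w a s : lp w a s < None :> L0.
Proof. exact: lpt_lt_none. Qed.

Lemma lp_lt_wle w w' a a' s s' : lp w a s < lp w' a' s' -> w <= w'.
Proof. by rewrite lp_lt => /orP[/ltW//|/andP[/eqP -> _]]. Qed.

Lemma lp_lt_ale w a a' s s' : lp w a s < lp w a' s' -> a <= a'.
Proof. by rewrite lp_lt_same ltxi_pair => /andP[]. Qed.

Lemma start_le w a s : start w <= lp w a s.
Proof.
rewrite startE leNgt lp_lt_same ltxi_pair negb_and -ltNge.
case: (ltgtP omega1_0 a) => [//|a0|_] /=.
  by have := omega1_0_le a; rewrite leNgt a0.
by rewrite -leNgt; exact: unit_ge0.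
Qed.

Lemma lt_start v w a s : lp v a s < start w -> v < w.
Proof.
move=> h; rewrite lt_neqAle (lp_lt_wle h) andbT; apply/eqP => e; subst v.
by move: h; rewrite ltNge start_le.
Qed.

Lemma inner_lp w w' a s : inner_block w (lp w' a s) <-> w' = w /\ start w < lp w a s.
Proof.
split=> [[h1 [x h2]]|[-> h]].
  have e : w' = w by apply/le_anti; rewrite (lp_lt_wle h1) (lp_lt_wle h2).
  by subst w'.
split=> //; have [b ab] := omega1_up a; exists b; exact: lp_lt_a.
Qed.

Lemma inner_none w : ~ inner_block w (None : L0).
Proof. by move=> [_ [x]]; rewrite ltNge none_max. Qed.

Lemma inner_start w w' : ~ inner_block w (start w').
Proof. by rewrite startE inner_lp => -[_]; rewrite -startE ltxx. Qed.

Lemma inner_lp_gt w a s : omega1_0 < a -> inner_block w (lp w a s).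
Proof. by move=> a0; apply/inner_lp; split=> //; rewrite startE; exact: lp_lt_a. Qed.

Definition is_reversed w := exists2 b, A b & w = pw b.

Lemma reversed_blocksP J : F J <-> exists2 w, is_reversed w & J = inner_block w.
Proof.
split=> [[b [w [Ab wb ->]]]|[w [b Ab ->] ->]]; last by exists b, (pw b); split=> //; exact: pw_iso PS b.
exists w => //; exists b => //; apply: seg_inj.
exact: ord_iso_trans wb (ord_iso_sym (pw_iso PS b)).
Qed.

Lemma Fmin J x : F J -> J x -> exists2 y, J y & y < x.
Proof.
move=> /reversed_blocksP[w _ ->] [wx [a xa]].
have [y [_ wy yx]] := rational_dense wx; exists y => //; split=> //.
by exists a; exact: lt_trans xa.
Qed.

Lemma Fmax J x : F J -> J x -> exists2 y, J y & x < y.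
Proof.
move=> /reversed_blocksP[w _ ->] [wx [a xa]].
have [y [_ xy ya]] := rational_dense xa; exists y => //; split; last by exists a.
exact: lt_trans xy.
Qed.

Local Notation Fconvex := (@reversed_blocks_convex R K A).
Local Notation Fdisj := (@reversed_blocks_disjoint R K A).

Lemma L_ltE (x y : L) : (x < y) = rev_lt F x y.
Proof. by rewrite ltNge Lambda_leE rev_leNlt negbK. Qed.

Lemma L_dense_set : order_dense_set (@rational_pts R (ord_mul omega1 P) : set L).
Proof.
move=> x y; rewrite L_ltE => xy.
have [z [Dz xz zy]] := rev_dense Fconvex Fdisj Fmin Fmax (@rational_dense R _) xy.
by exists z; rewrite !L_ltE.
Qed.

Lemma L_dense : order_dense L.
Proof. by move=> x y /L_dense_set[z [_ xz zy]]; exists z. Qed.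

Lemma L_filled : cuts_filled L.
Proof.
move=> C down C0 nC1.
have [|||c [cC cnC]] := rev_cut Fconvex Fdisj Fmin Fmax (@long_line_cut R _) (L := C).
- by move=> x y; rewrite -L_ltE => /ltW; exact: down.
- by exists (\bot : L).
- by exists (\top : L).
by exists c; split=> x; rewrite L_ltE; [exact: cC|exact: cnC].
Qed.

Lemma L_lt_in w (x y : L) : is_reversed w -> inner_block w (x : L0) -> inner_block w (y : L0) -> (x < y) = ((y : L0) < x).
Proof.
move=> rw xw yw; rewrite L_ltE; apply: (rev_lt_in (J := inner_block w)) => //.
by apply/reversed_blocksP; exists w.
Qed.

Lemma L_lt_out (x y : L) : (forall w, is_reversed w -> inner_block w (x : L0) -> ~ inner_block w (y : L0)) ->
  (x < y) = ((x : L0) < y).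
Proof.
move=> h; rewrite L_ltE rev_lt_out//; apply/blkP => -[J [/reversed_blocksP[w rw ->]]].
exact: h.
Qed.

Lemma L_lt_w w w' a a' s s' : w < w' -> (lp w a s : L) < (lp w' a' s' : L).
Proof.
move=> ww'; rewrite L_lt_out; first exact: lp_lt_w.
move=> v _ /inner_lp[e _] /inner_lp[e' _]; by move: ww'; rewrite e e' ltxx.
Qed.

Lemma L_lt_start_l w (x : L) : ((start w : L) < x) = (start w < x).
Proof. by rewrite L_lt_out// => v _ /inner_start. Qed.

Lemma L_lt_start_r w (x : L) : (x < (start w : L)) = ((x : L0) < start w).
Proof. by rewrite L_lt_out// => v _ _ /inner_start. Qed.

Lemma L_lt_nrv w (x : L) a s : ~ is_reversed w -> ((lp w a s : L) < x) = (lp w a s < x).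
Proof. by move=> nw; rewrite L_lt_out// => v revw /inner_lp[e]; case: nw; rewrite e. Qed.

Lemma L_lt_nrv_r w (x : L) a s : ~ is_reversed w -> (x < (lp w a s : L)) = ((x : L0) < lp w a s).
Proof. by move=> nw; rewrite L_lt_out// => v revw _ /inner_lp[e]; case: nw; rewrite e. Qed.

(** Reversal of one block moves no other point into it. *)
Lemma L_between_rv w (x y z : L) : is_reversed w -> inner_block w (x : L0) -> inner_block w (y : L0) ->
  x < z -> z < y -> (y : L0) < z /\ (z : L0) < x.
Proof.
move=> rw xw yw xz zy; have [zw|nzw] := pselect (inner_block w (z : L0)).
  by rewrite -(L_lt_in rw zw yw) -(L_lt_in rw xw zw).
have only v (u : L0) : inner_block w u -> inner_block v u -> v = w.
  by move=> wu vu; exact: inner_block_inj vu wu.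
move: (lt_trans xz zy); rewrite (L_lt_in rw xw yw) => yx.
move: xz zy; rewrite !L_lt_out => [xz zy||].
- by move: (lt_trans yx (lt_trans xz zy)); rewrite ltxx.
- by move=> v _ vz vy; apply: nzw; rewrite -(only _ _ yw vy).
- by move=> v _ vx; rewrite (only _ _ xw vx).
Qed.

Lemma lp_between w a a' s s' (z : L0) : lp w a s < z -> z < lp w a' s' ->
  exists a'' s'', z = lp w a'' s'' /\ a'' <= a'.
Proof.
have [->|[v [b [t ->]]]] := lp_cases z; first by move=> _; rewrite ltNge none_max.
move=> h h'; have e : v = w by apply/le_anti; rewrite (lp_lt_wle h) (lp_lt_wle h').
by subst v; exists b, t; split=> //; exact: lp_lt_ale h'.
Qed.

(** ** Separability in Lambda(K, A) *)

(** Only countably many rational points of the block lie between [u] and [v]. *)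
Lemma small_block w a0 (u v : L) :
  (forall z : L, u < z -> z < v -> exists a s, z = lp w a s /\ a <= a0) ->
  small ([set x | u <= x /\ x <= v] : set (order_topology L)).
Proof.
move=> uvw; apply: (small_itv L_dense_set).
pose f (x : omega1 * rat) : L := lp w x.1 (insubd (unit_co0 R) (ratr x.2)).
apply: (@sub_countable _ _ _ (f @` ([set a | a <= a0] `*` setT))); last first.
  apply: card_le_trans (card_image_le _ _) _; apply: countableX => //.
  apply: (@sub_countable _ _ _ ([set a | a < a0] `|` [set a0])).
    by apply: subset_card_le => a /=; rewrite le_eqVlt => /predU1P[->|]; [right|left].
  rewrite -bigcup2E; apply: bigcup_countable => // i _.
  by case: i => [|[|i]] /=; [exact: (omega1P.2 a0)|exact: countable1|exact: countable0].
apply: subset_card_le => z [[[w' a'] [t [q [-> tq]]]] [uz zv]].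
have [a [s [[e1 e2 _] aa0]]] := uvw _ uz zv.
exists (a, q) => //; rewrite /f /= -tq -e1 -e2.
by rewrite /insubd valK.
Qed.

(** The open interval from [omega1 * w + a] to its successor. For [a > 0] both ends are inner points of the
   block, so this is an interval of the reversed order as well. *)
Lemma cell w a : omega1_0 < a -> exists O : set (order_topology L),
  [/\ open O, O !=set0 & forall z, O z -> exists s, z = lp w a s].
Proof.
move=> a0; have [a' aa' amin] := @ord_succ omega1 a (omega1_up a).
have a'0 := lt_trans a0 aa'.
have key (z : L0) : lp w a (unit_co0 R) < z -> z < lp w a' (unit_co0 R) -> exists s, z = lp w a s.
  move=> h h'; have [b [t [e _]]] := lp_between h h'; subst z; exists t.
  suff -> : b = a by [].
  apply/le_anti; rewrite (lp_lt_ale h) andbT leNgt; apply/negP => /amin.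
  rewrite le_eqVlt => /predU1P[e|a'b]; last by have := lp_lt_ale h'; rewrite leNgt a'b.
  move: h'; rewrite e lp_lt_same ltxi_pair lexx /=; apply/negP; rewrite -leNgt; exact: unit_ge0.
have [rw|nrw] := pselect (is_reversed w).
  have i1 := inner_lp_gt w (unit_co0 R) a0; have i2 := inner_lp_gt w (unit_co0 R) a'0.
  exists [set z : L | (lp w a' (unit_co0 R) : L) < z /\ z < (lp w a (unit_co0 R) : L)]; split.
  - exact: open_between.
  - have [|z [h h']] := @L_dense (lp w a' (unit_co0 R)) (lp w a (unit_co0 R)); last by exists z.
    by rewrite (L_lt_in rw)//; exact: lp_lt_a.
  - by move=> z [h h']; have [? ?] := L_between_rv rw i2 i1 h h'; exact: key.
exists [set z : L | (lp w a (unit_co0 R) : L) < z /\ z < (lp w a' (unit_co0 R) : L)]; split.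
- exact: open_between.
- have [|z [h h']] := @L_dense (lp w a (unit_co0 R)) (lp w a' (unit_co0 R)); last by exists z.
  by rewrite L_lt_nrv//; exact: lp_lt_a.
- by move=> z []; rewrite L_lt_nrv// L_lt_nrv_r//; exact: key.
Qed.

(** [J] contains uncountably many disjoint cells. *)
Lemma big_block w a0 (J : set (order_topology L)) :
  (forall a s, a0 < a -> J (lp w a s)) -> ~ small J.
Proof.
move=> wJ; have [a1 a01] := omega1_up a0.
have O a : {O : set (order_topology L) | omega1_0 < a -> [/\ open O, O !=set0 & forall z, O z -> exists s, z = lp w a s]}.
  by apply: cid; have [/(cell w)[O h]|na] := boolP (omega1_0 < a); [exists O|exists set0].
have gt a : a1 <= a -> omega1_0 < a.
  by move=> a1a; apply: lt_le_trans a1a; apply: le_lt_trans a01; exact: omega1_0_le.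
apply: (@not_small _ _ _ [set a | a1 <= a] (fun a => sval (O a))); first exact: omega1_tail.
- by move=> a /gt a0'; case: (O a) => /= ? /(_ a0')[].
- move=> a b x /gt a0' /gt b0; case: (O a) => /= ? /(_ a0')[_ _ h].
  by case: (O b) => /= ? /(_ b0)[_ _ h'] /h[s ->] /h'[t []].
- move=> a /= a1a; case: (O a) => /= ? /(_ (gt a a1a))[_ _ h] x /h[s ->].
  by apply: wJ; exact: lt_le_trans a1a.
Qed.

(** ** Bad points of Lambda(K, A) *)

Local Notation left_bad := (@left_bad _ L).
Local Notation right_bad := (@right_bad _ L).

Lemma lp_block w a s : lp w a s = start w \/ inner_block w (lp w a s).
Proof.
have := start_le w a s; rewrite le_eqVlt => /predU1P[<-|h]; first by left.
by right; apply/inner_lp.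
Qed.

(** An inner point lies in an interval of its block that meets only countably many cells. *)
Lemma inner_not_bad w (z : L) : inner_block w (z : L0) -> ~ left_bad z /\ ~ right_bad z.
Proof.
move=> zw; have zw' := zw; move: zw' => [sz [a za]].
have [u0 [_ su uz]] := rational_dense sz.
have uw : inner_block w u0 by split=> //; exists a; exact: lt_trans uz za.
have vw : inner_block w (Lambda0_pt R w a : L0).
  by split; [exact: lt_trans sz za|have [b ab] := omega1_up a; exists b; exact: lp_lt_a].
have fin (x : L0) : u0 < x -> x < Lambda0_pt R w a -> exists b s, x = lp w b s /\ b <= a.
  by move=> ux; apply: (lp_between (a := omega1_0) (s := unit_co0 R)); exact: lt_trans su ux.
have [rw|nrw] := pselect (is_reversed w).
  split.
  - move=> /(_ (Lambda0_pt R w a : L)); apply; first by rewrite (L_lt_in rw).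
    apply: (small_block (w := w) (a0 := a)) => x vx xz.
    have [zx xv] := L_between_rv rw vw zw vx xz.
    by apply: fin => //; exact: lt_trans uz zx.
  - move=> /(_ (u0 : L)); apply; first by rewrite (L_lt_in rw).
    apply: (small_block (w := w) (a0 := a)) => x zx xu.
    have [ux xz] := L_between_rv rw zw uw zx xu.
    by apply: fin => //; exact: lt_trans xz za.
have lt x (y : L) : inner_block w (x : L0) -> ((x : L) < y) = ((x : L0) < y).
  by move=> xw; rewrite L_lt_out// => v revw vx; case: nrw; rewrite (inner_block_inj xw vx).
have gt x (y : L) : inner_block w (x : L0) -> (y < (x : L)) = ((y : L0) < x).
  by move=> xw; rewrite L_lt_out// => v revw _ vx; case: nrw; rewrite (inner_block_inj xw vx).
split.
- move=> /(_ (u0 : L)); apply; first by rewrite lt.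
  apply: (small_block (w := w) (a0 := a)) => x; rewrite lt// gt// => ux xz.
  by apply: fin => //; exact: lt_trans xz za.
- move=> /(_ (Lambda0_pt R w a : L)); apply; first by rewrite lt.
  apply: (small_block (w := w) (a0 := a)) => x; rewrite lt// gt// => zx xv.
  by apply: fin => //; exact: lt_trans uz zx.
Qed.

(** A reversed block begins with what was its uncountable end; any other block begins with countable
   pieces. *)
Lemma right_bad_start w : right_bad (start w) <-> is_reversed w.
Proof.
split=> [rb|rw].
  apply: contrapT => nrw; have [a a0] := omega1_up omega1_0.
  apply: (rb (lp w a (unit_co0 R))); first by rewrite L_lt_start_l; exact: lp_lt_a.
  apply: (small_block (w := w) (a0 := a)) => x; rewrite L_lt_start_l L_lt_nrv_r//.
  exact: lp_between.
move=> v sv; suff [a0 h] : exists a0, forall a s, a0 < a -> (lp w a s : L) < v.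
  apply: (big_block (w := w) (a0 := a0)) => a s aa0; split; last exact/ltW/h.
  apply/ltW; rewrite L_lt_start_l startE; apply: lp_lt_a; exact: le_lt_trans (omega1_0_le a0) aa0.
move: sv; rewrite L_lt_start_l; have [->|[w' [a [s ->]]]] := lp_cases v => sv.
  exists omega1_0 => b t _; rewrite L_lt_out; first exact: lp_lt_none.
  by move=> ? _ _ /inner_none.
have := lp_lt_wle sv; rewrite le_eqVlt => /predU1P[e|ww']; last first.
  by exists a => b t _; exact: L_lt_w.
subst w'; exists a => b t ab; rewrite (L_lt_in rw); first exact: lp_lt_a.
  by apply: inner_lp_gt; exact: le_lt_trans (omega1_0_le a) ab.
by apply/inner_lp.
Qed.

(** An interval that contains the end of some block is not separable. *)
Lemma left_bad_big (z : L) :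
  (forall w a s, (lp w a s : L) < z -> exists v a0, forall b t, a0 < b ->
     (lp w a s : L) <= (lp v b t : L) /\ (lp v b t : L) <= z) -> left_bad z.
Proof.
move=> h u uz; have [e|[w [a [s e]]]] := lp_cases u.
  by move: uz; rewrite e ltNge lex1.
subst u; have [v [a0 va0]] := h w a s uz.
by apply: (big_block (w := v) (a0 := a0)) => b t ab; apply: va0.
Qed.

Lemma left_bad_limit w : (forall v, v < w -> exists2 v', v < v' & v' < w) ->
  left_bad (start w).
Proof.
move=> lim; apply: left_bad_big => v a s; rewrite L_lt_start_r => /lt_start/lim[v' vv' v'w].
exists v', omega1_0 => b t _; split; apply/ltW; first exact: L_lt_w.
exact: L_lt_w.
Qed.

Lemma left_bad_top : left_bad (\top : L).
Proof.
apply: left_bad_big => v a s _; have [v' vv' _] := rk_unbounded PS v (rk v).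
by exists v', omega1_0 => b t _; split; [exact/ltW/L_lt_w|exact: lex1].
Qed.

Definition is_succ v w := v < w /\ forall u, v < u -> w <= u.

Lemma left_bad_succ v w : is_succ v w -> ~ is_reversed v -> left_bad (start w).
Proof.
move=> [vw vmin] nrv; apply: left_bad_big => u a s; rewrite L_lt_start_r => /lt_start uw.
have uv : u <= v by rewrite leNgt; apply/negP => /vmin; rewrite leNgt uw.
move: uv; rewrite le_eqVlt => /predU1P[->|uv].
  exists v, a => b t ab; split; apply/ltW; last exact: L_lt_w.
  by rewrite L_lt_nrv//; exact: lp_lt_a.
by exists v, omega1_0 => b t _; split; apply/ltW; exact: L_lt_w.
Qed.

Lemma succ_or_limit w : (exists v, is_succ v w) \/ (forall v, v < w -> exists2 v', v < v' & v' < w).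
Proof.
have [|ns] := pselect (exists v, is_succ v w); [by left|right => v vw].
apply: contrapT => nv'; apply: ns; exists v; split=> // u vu.
by rewrite leNgt; apply/negP => uw; apply: nv'; exists u.
Qed.

Lemma succ_rank v w b : is_succ v w -> rk w <= b.
Proof.
move=> [vw vmin]; rewrite leNgt; apply/negP => bw.
have [u [vu uw _]] := rk_cofinal PS vw bw.
by have := vmin u vu; rewrite leNgt uw.
Qed.

(** omega^b is a limit or 1, and 0 is no power of omega: a block that immediately precedes the one
   at omega^b is not reversed. *)
Lemma left_bad_pw b : left_bad (start (pw b)).
Proof.
have [[v sv]|lim] := succ_or_limit (pw b); last exact: left_bad_limit.
apply: (left_bad_succ sv) => -[b' _ vb'].
have := succ_rank b' sv; rewrite (rk_pw PS) le_eqVlt => /predU1P[e|lt].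
  by have := sv.1; rewrite vb' -e ltxx.
by have := lt_trans sv.1 (pw_lt PS lt); rewrite vb' ltxx.
Qed.

(** A right side that is not separable occurs only at the start of a reversed block, where the left side
   is not separable either. *)
Lemma bad_start (z : L) : z <> \bot -> z <> \top -> left_bad z \/ right_bad z ->
  exists w, [/\ pow_0 K < w, z = start w & left_bad z].
Proof.
move=> z0 zt bad; have [e|[w [a [s e]]]] := lp_cases z; first by case: zt.
subst z; have [e|iw] := lp_block w a s; last first.
  by have [nl nr] := inner_not_bad iw; case: bad.
rewrite e in z0 zt bad *; exists w.
have w0 : pow_0 K < w.
  rewrite lt_neqAle pow_0_le andbT; apply/eqP => ew; apply: z0; by rewrite -ew.
split=> //; case: bad => // /right_bad_start[b _ ->]; exact: left_bad_pw.
Qed.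

(** A point of rank [b] supplied by ordinal arithmetic may follow a reversed block immediately, and then its
   left side is separable. This happens only for the least [b]; the next point has the same rank, and follows a
   block that is not reversed. *)
Lemma rank_below v w b : v < w -> b < rk w ->
  exists u, [/\ v < u, u < w, rk u = b & left_bad (start u)].
Proof.
move=> vw bw; have [u [vu uw ub]] := rk_cofinal PS vw bw.
have [lb|nlb] := pselect (left_bad (start u)); first by exists u.
have [[t su]|/left_bad_limit//] := succ_or_limit u.
have rt : is_reversed t by apply: contrapT => /(left_bad_succ su).
have [x [ux xw xb]] := rk_cofinal PS uw bw.
have [u' uu' umin] := @ord_succ P u (ex_intro _ x ux).
have su' : is_succ u u' by [].
have bmin c : b <= c by rewrite -ub; exact: succ_rank su.
have u'b : rk u' = b by apply/le_anti; rewrite bmin (succ_rank _ su').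
exists u'; split=> //; first exact: lt_trans uu'.
  exact: le_lt_trans (umin x ux) xw.
apply: (left_bad_succ su') => -[c _ uc]; have cb : c = b by rewrite -ub uc (rk_pw PS).
have [c' _ tc'] := rt; have := su.1; rewrite tc' uc ltNge cb.
by have := bmin c'; rewrite le_eqVlt => /predU1P[->|/(pw_lt PS)/ltW->]; rewrite ?lexx.
Qed.

(** The reversal of a block deprives at most one isolated point, the one after the block, of its
   non-separable side; the ranks of the other points do not change, and the last point exceeds all ranks. *)
Definition rank_ge (z : L) (b : K) : Prop := z = \top \/
  (left_bad z /\ exists w, [/\ z = start w, pow_0 K < w & b <= rk w]).

Lemma start_lt v w : ((start v : L) < (start w : L)) = (v < w).
Proof.
rewrite L_lt_start_l !startE lp_lt ltxx andbF orbF//.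
Qed.

Lemma start_inj v w : start v = start w -> v = w.
Proof. by move=> [e]. Qed.

Lemma rank_ge_lim (z : L) b b' (u : L) : rank_ge z b -> b' < b -> u < z ->
  exists y : L, [/\ u < y, y < z & rank_ge y b'].
Proof.
move=> zb b'b uz; have [e|[v [a [s e]]]] := lp_cases u.
  by move: uz; rewrite e ltNge lex1.
have [x vx [xr [xb xz]]] : exists2 x, v < x & left_bad (start x) /\ rk x = b' /\ (start x : L) < z.
  case: zb => [->|[_ [w [zw w0 bw]]]].
    have [w vw wb] := rk_unbounded PS v b.
    have b'w : b' < rk w by rewrite wb.
    have [x [vx xw xb lb]] := rank_below vw b'w; exists x => //; split=> //; split=> //.
    by rewrite L_lt_start_l; exact: lp_lt_none.
  have vw : v < w by move: uz; rewrite e zw L_lt_start_r => /lt_start.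
  have [x [vx xw xb lb]] := rank_below vw (lt_le_trans b'b bw); exists x => //; split=> //; split=> //.
  by rewrite zw start_lt.
exists (start x : L); split=> //.
  by rewrite e startE; exact: L_lt_w.
right; split=> //; exists x; split=> //; last by rewrite xb.
exact: le_lt_trans (pow_0_le v) vx.
Qed.

Lemma rank_ge_isolated (z : L) b : z <> \bot -> z <> \top -> left_bad z \/ right_bad z ->
  ~ rank_ge z b -> exists b' (u v : L), [/\ b' < b, u < z, z < v &
    forall y : L, u < y -> y < v -> y <> z -> ~ rank_ge y b'].
Proof.
move=> z0 zt bad; have [w [w0 e lb]] := bad_start z0 zt bad; subst z => nr.
have wb : rk w < b.
  by rewrite ltNge; apply/negP => bw; apply: nr; right; split=> //; exists w.
have [v vw vlt] := rk_below PS w0; have [a a0] := omega1_up omega1_0.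
exists (rk w), (start v : L), (lp w a (unit_co0 R) : L); split=> //.
- by rewrite start_lt.
- by rewrite L_lt_start_l; exact: lp_lt_a.
move=> y vy yw yz [yt|[_ [x [ex x0 wx]]]]; first by move: yw; rewrite yt lt1x.
subst y; rewrite start_lt in vy; move: yw; rewrite L_lt_start_l => /lp_lt_wle.
rewrite le_eqVlt => /predU1P[e|xw]; first by apply: yz; rewrite e.
by have := vlt x vy xw; rewrite ltNge wx.
Qed.

(** ** The invariants of the solenoid of Lambda(K, A) *)

Variable p : nat -> nat.
Hypothesis p_gt0 : forall n, (0 < p n)%N.
Local Notation S := (solenoid L p).

Lemma L_bot_top : (\bot : L) <> \top. Proof. by []. Qed.

Lemma start_neq_bot w : pow_0 K < w -> (start w : L) <> \bot.
Proof. by move=> w0 /start_inj e; move: w0; rewrite e ltxx. Qed.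

Lemma has_rankP g (tg : thread g) (z : L) b : z <> \bot ->
  has_rank b (spt L_bot_top tg z : S) <-> rank_ge z b.
Proof.
apply: (has_rank_spt L_bot_top L_dense L_filled (N := rank_ge)) => //.
- by move=> {}z {}b [->|[]//]; exact: left_bad_top.
- exact: rank_ge_lim.
- by left.
- exact: rank_ge_isolated.
Qed.

Definition pw_point b : S := spt L_bot_top (thread0_proof p_gt0) (start (pw b) : L).

Lemma pw_point_rank b : exact_rank b (pw_point b).
Proof.
have n0 := start_neq_bot (pw_gt0 PS b); split.
  apply/(has_rankP _ _ n0); right; split; first exact: left_bad_pw.
  by exists (pw b); rewrite (rk_pw PS) (pw_gt0 PS).
move=> b' bb' /(has_rankP _ _ n0)[//|[_ [w [/start_inj <- _]]]].
by rewrite (rk_pw PS) leNgt bb'.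
Qed.

(** The set [A] can be recovered from the solenoid: the right side of [omega1 * omega^b] is not separable if
   its block is reversed, and no other point of rank [b] has two sides that are not separable. *)
Lemma mem_A b : A b <-> exists x : S, two_sided x /\ exact_rank b x.
Proof.
split=> [Ab|[x [ts [xb xnb]]]].
  exists (pw_point b); split; last exact: pw_point_rank.
  apply/(two_sidedP L_bot_top L_dense L_filled) => //.
    exact/start_neq_bot/(pw_gt0 PS).
  by split; [exact: left_bad_pw|apply/right_bad_start; exists b].
have [g [tg [z [z0 e]]]] := spt_surj L_bot_top x; subst x.
have [b' bb'] := Kup b.
have zt : z <> \top.
  by move=> zt; apply: (xnb b' bb'); apply/has_rankP => //; left.
have [lb rb] := (two_sidedP L_bot_top L_dense L_filled tg z0 zt).1 ts.
move/(has_rankP tg _ z0): xb => [//|[_ [w [zw w0 bw]]]].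
subst z; have [c Ac wc] := (right_bad_start w).1 rb.
suff bc : b = c by rewrite bc.
rewrite wc (rk_pw PS) in bw; apply/le_anti; rewrite bw leNgt; apply/negP => bc.
apply: (xnb c bc); apply/(has_rankP tg _ z0); right; split=> //.
by exists w; split=> //; rewrite wc (rk_pw PS).
Qed.
End Lambda_points.

(** * Homogeneity of the long ray *)

Lemma sum_uniq_le (R : realType) (I : eqType) (s t : seq I) (h : I -> R) :
  (forall i, 0 <= h i)%R -> uniq s -> uniq t -> {subset s <= t} ->
  (\sum_(i <- s) h i <= \sum_(i <- t) h i)%R.
Proof.
move=> h0 us ut st; rewrite [leRHS](bigID (mem s)) /=.
have -> : (\sum_(i <- t | i \in s) h i = \sum_(i <- s) h i)%R.
  rewrite -big_filter; apply: perm_big; apply: uniq_perm => //; first exact: filter_uniq.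
  by move=> i; rewrite mem_filter; case: (boolP (i \in s)) => // /st ->.
by rewrite lerDl; apply: sumr_ge0.
Qed.

Lemma sum_half_le (R : realType) (s : seq nat) : uniq s ->
  (\sum_(n <- s) 2%:R ^- n <= 2%:R :> R)%R.
Proof.
move=> us; have h0 n : (0 <= 2%:R ^- n :> R)%R by rewrite invr_ge0 exprn_ge0.
have [N sN] : exists N, {subset s <= iota 0 N}.
  exists (\max_(i <- s) i).+1 => n ns; rewrite mem_iota /= add0n ltnS.
  by rewrite (big_rem n)//= leq_maxl.
apply: le_trans (sum_uniq_le h0 us (iota_uniq 0 N) sN) _.
suff -> : (\sum_(n <- iota 0 N) 2%:R ^- n = 2%:R - 2%:R * 2%:R ^- N :> R)%R.
  by rewrite gerBl mulr_ge0.
elim: N {sN} => [|N IH]; first by rewrite big_nil expr0 invr1 mulr1 subrr.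
rewrite -[N.+1]addn1 iotaD big_cat /= IH big_seq1 add0n addn1 exprS invfM.
rewrite mulrA divff ?pnatr_eq0 // mul1r; move: (2%:R ^- N)%R => r; lra.
Qed.

Section long_ray.
Variables (R : realType) (xi : omega1).
Hypothesis xi0 : omega1_0 < xi.
Local Notation point := (omega1 *l unit_co R).

Lemma short_weights : exists h : omega1 -> R, (forall a, 0 < h a)%R /\
  forall s : seq omega1, uniq s -> (forall a, a \in s -> a < xi) -> (\sum_(a <- s) h a <= 2%:R)%R.
Proof.
have /countable_injP[e ei] : countable [set a | a < xi] by exact: omega1P.2.
exists (fun a => (2%:R ^- e a)%R); split=> [a|s us sxi]; first by rewrite invr_gt0 exprn_gt0.
rewrite -(big_map e xpredT (fun n => (2%:R ^- n)%R)); apply: sum_half_le.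
by rewrite map_inj_in_uniq// => a b /sxi axi /sxi bxi; apply: ei; exact/mem_set.
Qed.

(** A countable initial piece of the long ray is isomorphic to [0, +oo): give the unit interval after [a] a
   positive length such that the lengths have a finite sum. *)
Lemma short_ray : exists O : point -> R,
  [/\ forall q q' : point, q.1 < xi -> q'.1 < xi -> q < q' -> (O q < O q')%R,
      forall q : point, q.1 < xi -> (0 <= O q)%R &
      forall y : R, (0 <= y)%R -> exists2 q : point, q.1 < xi & O q = y].
Proof.
have [h [h0 hb]] := short_weights.
pose X a : set R := [set r | exists s : seq omega1, [/\ uniq s, forall b, b \in s -> b < a & r = (\sum_(b <- s) h b)%R]].
(* The total length of the unit intervals before [a]. *)
pose g a := sup (X a).
have X0 a : X a !=set0 by exists 0%R, [::]; split=> //; rewrite big_nil.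
have hX a : a <= xi -> has_sup (X a).
  move=> axi; split=> //; exists (2%:R)%R => _ [s [us sa ->]]; apply: hb => // b /sa ba.
  exact: lt_le_trans axi.
have sum_le a s : a <= xi -> uniq s -> (forall b, b \in s -> b < a) -> (\sum_(b <- s) h b <= g a)%R.
  by move=> axi us sa; apply: ub_le_sup; [exact: (hX a axi).2|exists s].
have g_ge0 a : a <= xi -> (0 <= g a)%R.
  by move=> axi; have := sum_le a [::] axi isT; rewrite big_nil; apply.
have g_step a b : a < b -> b <= xi -> (g a + h a <= g b)%R.
  move=> ab bxi; rewrite -lerBrDr; apply: ge_sup => // _ [s [us sa ->]].
  have e : (\sum_(c <- a :: s) h c = \sum_(c <- s) h c + h a)%R by rewrite big_cons addrC.
  rewrite lerBrDr -e; apply: sum_le => //.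
    by rewrite /= us andbT; apply/negP => /sa; rewrite ltxx.
  by move=> c; rewrite inE => /predU1P[->//|/sa ca]; exact: lt_trans ab.
have g_gt a r : (0 <= r)%R -> (r < g a)%R -> a <= xi -> exists2 m, m < a & (r < g m + h m)%R.
  move=> r0 ra axi; have [_ [s [us sa ->]] rs] := sup_gt (X0 a) ra.
  have s0 : s != [::] by apply: contraTneq rs => ->; rewrite big_nil -leNgt.
  have [m ms mmax] := seq_max s0; exists m; first exact: sa.
  rewrite (lt_le_trans rs)// (big_rem m)//= addrC lerD2r; apply: sum_le.
  - exact/ltW/(lt_le_trans (sa m ms)).
  - exact: rem_uniq.
  - move=> b; rewrite mem_rem_uniq// inE => /andP[bm /mmax]; by rewrite lt_neqAle bm.
pose G (q : point) : R := (g q.1 + val q.2 * h q.1)%R.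
pose c := g xi.
have G_lt (q q' : point) : q.1 < xi -> q'.1 < xi -> q < q' -> (G q < G q')%R.
  case: q q' => [a s] [b t] /= axi bxi; rewrite ltxi_pair => /andP[].
  rewrite le_eqVlt => /predU1P[->|ab].
    by rewrite lexx /= => st; rewrite /G /= ltrD2l ltr_pM2r.
  move=> _; have lt : (G (a, s) < g a + h a)%R.
    by rewrite /G /= ltrD2l -[ltRHS]mul1r ltr_pM2r//; exact: unit_lt1.
  apply: (lt_le_trans lt); apply: (le_trans (g_step _ _ ab (ltW bxi))).
  by rewrite /G /= lerDl mulr_ge0//; [exact: unit_ge0|exact/ltW].
have G_ge0 (q : point) : q.1 < xi -> (0 <= G q)%R.
  move=> qxi; apply: addr_ge0; first exact/g_ge0/ltW.
  by apply: mulr_ge0; [exact: unit_ge0|exact/ltW].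
have G_ltc (q : point) : q.1 < xi -> (G q < c)%R.
  move=> qxi; apply: lt_le_trans (g_step _ _ qxi (lexx _)).
  by rewrite /G ltrD2l -[ltRHS]mul1r ltr_pM2r//; exact: unit_lt1.
have G_onto r : (0 <= r)%R -> (r < c)%R -> exists2 q : point, q.1 < xi & G q = r.
  move=> r0 rc; have [m0 m0xi rm0] := g_gt xi r r0 rc (lexx _).
  have [|m [mxi rm] mmin] := @ord_min omega1 [set m | m < xi /\ (r < g m + h m)%R]; first by exists m0.
  have gr : (g m <= r)%R.
    rewrite leNgt; apply/negP => rg; have [n nm rn] := g_gt m r r0 rg (ltW mxi).
    by have := mmin n (conj (lt_trans nm mxi) rn); rewrite leNgt nm.
  have h1 : (0 <= (r - g m) / h m < 1)%R.
    rewrite divr_ge0 ?subr_ge0// ?(ltW (h0 m))//= ltr_pdivrMr// mul1r ltrBlDr addrC.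
    by [].
  exists (m, mk_unit h1 : unit_co R) => //; rewrite /G /= divfK ?gt_eqF//.
  by rewrite addrC subrK.
pose q0 : point := (omega1_0, unit_co0 R).
have c0 : (0 < c)%R by exact: le_lt_trans (G_ge0 q0 xi0) (G_ltc q0 xi0).
(* [G] maps onto [0, c); compose it with an increasing map onto [0, +oo). *)
exists (fun q => G q / (c - G q))%R; split=> [q q' qxi q'xi qq'|q qxi|y y0].
- have := G_lt q q' qxi q'xi qq'; have := G_ltc q qxi; have := G_ltc q' q'xi; have := G_ge0 q qxi.
  move: (G q) (G q') => r r' r0 r'c rc rr'.
  rewrite ltr_pdivrMr ?subr_gt0// mulrAC ltr_pdivlMr ?subr_gt0//; nra.
- by rewrite divr_ge0 ?G_ge0// subr_ge0 ltW// G_ltc.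
- have y1 : (0 < 1 + y)%R by rewrite ltr_pwDl.
  have [||q qxi e] := G_onto (c * y / (1 + y))%R.
  + by rewrite divr_ge0 ?mulr_ge0// ltW.
  + by rewrite ltr_pdivrMr// mulrDr mulr1 ltrDr.
  exists q => //; rewrite e; field; rewrite gt_eqF//=.
  by rewrite (_ : _ - _ = c)%R ?gt_eqF//; ring.
Qed.
End long_ray.

Section automorphisms.
Variables (R : realType) (K : ordnum) (A : set K).
Local Notation P := (ord_pow omega K).
Variables (pw : K -> P) (rk : P -> K).
Hypothesis PS : pow_structure pw rk.
Local Notation L0 := (Lambda0 R K).
Local Notation L := (Lambda R A).
Local Notation lp := (@lp R K).
Local Notation start := (@start R K).
Local Notation point := (omega1 *l unit_co R).
Implicit Types (w : P) (q : point).

Section stretch.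
Variables (w0 : P) (xi : omega1) (O : point -> R).
Hypothesis xi0 : omega1_0 < xi.
Hypothesis O_lt : forall q q', q.1 < xi -> q'.1 < xi -> q < q' -> (O q < O q')%R.
Hypothesis O_ge0 : forall q, q.1 < xi -> (0 <= O q)%R.
Hypothesis O_onto : forall y : R, (0 <= y)%R -> exists2 q, q.1 < xi & O q = y.

Let O_lt_inv q q' : q.1 < xi -> q'.1 < xi -> (O q < O q')%R -> q < q'.
Proof.
move=> qx q'x; apply: contraTT; rewrite -!leNgt le_eqVlt => /predU1P[->//|/(O_lt q'x qx)/ltW//].
Qed.

Let O_inj q q' : q.1 < xi -> q'.1 < xi -> O q = O q' -> q = q'.
Proof.
move=> qx q'x e; case: (ltgtP q q') => // lt.
  by have := O_lt qx q'x lt; rewrite e ltxx.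
by have := O_lt q'x qx lt; rewrite e ltxx.
Qed.

Let scale_ex (k : R) q : {q' | (0 < k)%R -> q.1 < xi -> q'.1 < xi /\ O q' = (k * O q)%R}.
Proof.
apply: cid; have [k0|] := pselect (0 < k)%R; last by exists q.
have [qx|] := pselect (q.1 < xi); last by exists q.
by have [q' q'x e] := O_onto (mulr_ge0 (ltW k0) (O_ge0 qx)); exists q'.
Qed.

Definition scale (k : R) q : point := sval (scale_ex k q).

Let scale_xi k q : (0 < k)%R -> q.1 < xi -> (scale k q).1 < xi.
Proof. by move=> k0 qx; rewrite /scale; case: scale_ex => q' /= /(_ k0 qx)[]. Qed.

Let scaleE k q : (0 < k)%R -> q.1 < xi -> O (scale k q) = (k * O q)%R.
Proof. by move=> k0 qx; rewrite /scale; case: scale_ex => q' /= /(_ k0 qx)[]. Qed.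

(** Multiplication by [k] in the coordinate [O] of an initial piece of one block, and the identity
   elsewhere. *)
Definition stretch (k : R) (u : L0) : L0 :=
  if u is Some ((w, a), t) then
    if (w == w0) && (a < xi) then lp w (scale k (a, t)).1 (scale k (a, t)).2 else u
  else None.

Let stretch_in k q : q.1 < xi -> stretch k (lp w0 q.1 q.2) = lp w0 (scale k q).1 (scale k q).2.
Proof. by case: q => a t /= ax; rewrite eqxx ax. Qed.

Let stretch_out k w a t : ~ (w = w0 /\ a < xi) -> stretch k (lp w a t) = lp w a t.
Proof. by move=> h /=; case: ifP => // /andP[/eqP ? ?]; case: h. Qed.

Let in_or_out w a (t : unit_co R) : (w = w0 /\ a < xi) \/ ~ (w = w0 /\ a < xi).
Proof. exact: EM. Qed.

Lemma stretch_eq k q q' : (0 < k)%R -> q.1 < xi -> q'.1 < xi -> O q' = (k * O q)%R ->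
  stretch k (lp w0 q.1 q.2) = lp w0 q'.1 q'.2.
Proof.
move=> k0 qx q'x e; rewrite stretch_in//.
by have -> : scale k q = q' by apply: O_inj; rewrite ?scale_xi// scaleE.
Qed.

Lemma stretch_index k w a t : exists a' t', stretch k (lp w a t) = lp w a' t'.
Proof. by rewrite /=; case: ifP => _; [eexists; eexists|exists a, t]. Qed.

Lemma stretch_lt k : (0 < k)%R -> {homo stretch k : u v / u < v}.
Proof.
move=> k0 u v; have [->|[w [a [t ->]]]] := lp_cases u.
  by rewrite ltNge none_max.
have [->|[w' [a' [t' ->]]]] := lp_cases v.
  by have [b [s ->]] := stretch_index k w a t; move=> _; exact: lp_lt_none.
have [[-> ax]|out] := in_or_out w a t; have [[-> a'x]|out'] := in_or_out w' a' t'.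
- rewrite lp_lt_same => lt.
  rewrite (@stretch_in k (a, t))// (@stretch_in k (a', t'))// lp_lt_same.
  rewrite -[X in X < _]surjective_pairing -[X in _ < X]surjective_pairing.
  apply: O_lt_inv; rewrite ?scale_xi ?scaleE// ltr_pM2l//; exact: O_lt.
- rewrite (@stretch_in k (a, t))// (stretch_out k t' out').
  rewrite lp_lt => /orP[ww'|/andP[/eqP e _]]; first exact: lp_lt_w.
  subst w'; apply: lp_lt_a; apply: lt_le_trans (scale_xi _ _) _ => //.
  by rewrite leNgt; apply/negP => ?; apply: out'.
- rewrite (@stretch_in k (a', t'))// (stretch_out k t out).
  rewrite lp_lt => /orP[ww'|/andP[/eqP e lt]]; first exact: lp_lt_w.
  subst w; case: out; split=> //; move: lt; rewrite ltxi_pair => /andP[aa' _].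
  exact: le_lt_trans a'x.
- by rewrite (stretch_out k t out) (stretch_out k t' out').
Qed.

Lemma stretch_mono k : (0 < k)%R -> {mono stretch k : u v / u <= v}.
Proof. by move=> k0; apply: le_mono; exact: stretch_lt. Qed.

Lemma stretchK k k' : (0 < k)%R -> (0 < k')%R -> (k' * k = 1)%R -> cancel (stretch k) (stretch k').
Proof.
move=> k0 k'0 kk u; have [->//|[w [a [t ->]]]] := lp_cases u.
have [[-> ax]|out] := in_or_out w a t; last by rewrite !(stretch_out _ t out).
have sx := @scale_xi k (a, t) k0 ax.
rewrite (@stretch_in k (a, t))// (@stretch_in k' (scale k (a, t)))//.
suff -> : scale k' (scale k (a, t)) = (a, t) by [].
by apply: O_inj; rewrite ?scale_xi// !scaleE// mulrA kk mul1r.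
Qed.

Lemma stretch_start k w : (0 < k)%R -> stretch k (start w) = start w.
Proof.
move=> k0; rewrite startE; have [[-> ax]|out] := in_or_out w omega1_0 (unit_co0 R); last first.
  exact: stretch_out.
rewrite (@stretch_in k (omega1_0, unit_co0 R))//.
suff -> : scale k (omega1_0, unit_co0 R) = (omega1_0, unit_co0 R) by [].
have O0 : O (omega1_0, unit_co0 R) = 0%R.
  have [q qx q0] := O_onto (lexx 0%R); apply/eqP; rewrite eq_le O_ge0// andbT -q0 leNgt.
  apply/negP => /(@O_lt_inv q ((omega1_0, unit_co0 R) : point) qx xi0); case: q {qx q0} => a t; rewrite ltxi_pair omega1_0_le.
  by move=> /andP[a0 /=]; rewrite ltNge [_ <= _]unit_ge0.
by apply: O_inj; rewrite ?scale_xi// scaleE// O0 mulr0.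
Qed.

Lemma stretch_inner k w u : (0 < k)%R -> inner_block w (stretch k u) <-> inner_block w u.
Proof.
move=> k0; have [->//|[v [a [t ->]]]] := lp_cases u.
have [a' [t' e]] := stretch_index k v a t; rewrite e !inner_lp.
suff h : (start v < lp v a' t') = (start v < lp v a t).
  by split=> -[vw]; subst w; rewrite h.
by rewrite -e -{1}(stretch_start v k0) (leW_mono (stretch_mono k0)).
Qed.

(** Every block is mapped to itself, so its reversal is respected. *)
Lemma stretch_L_mono k : (0 < k)%R -> {mono (stretch k : L -> L) : x y / x <= y}.
Proof.
move=> k0 x y; rewrite !Lambda_leE /rev_le.
have -> : same_block (@reversed_blocks R K A) (stretch k x) (stretch k y) =
    same_block (@reversed_blocks R K A) (x : L0) (y : L0).
  apply/idP/idP => /blkP[J [/(reversed_blocksP A PS _)[w rw ->] Jx Jy]]; apply/blkP;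
    exists (inner_block w); split; try (by apply/(reversed_blocksP A PS _); exists w);
    by [apply/(stretch_inner w _ k0)|move/(stretch_inner w _ k0): Jx|move/(stretch_inner w _ k0): Jy].
by case: ifP => _; rewrite stretch_mono.
Qed.
End stretch.

(** Two inner points of a block lie in a countable initial piece, where one is moved to the other by a
   multiplication in the coordinate of [short_ray]. *)
Lemma block_homogeneous w (x y : L0) : inner_block w x -> inner_block w y ->
  exists h h' : L -> L, [/\ {mono h : u v / u <= v}, cancel h h', cancel h' h & h x = y].
Proof.
have [->|[v [a [s ->]]]] := lp_cases x; first by move=> /inner_none.
have [->|[v' [b [t ->]]]] := lp_cases y; first by move=> _ /inner_none.
move=> /inner_lp[-> xs] /inner_lp[-> ys] {v v'}.
have [xi abxi] := omega1_up (Order.max a b); move: abxi; rewrite gt_max => /andP[axi bxi].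
have xi0 : omega1_0 < xi by exact: le_lt_trans (omega1_0_le a) axi.
have [O [O_lt O_ge0 O_onto]] := short_ray R xi0.
have Opos c (r : unit_co R) : c < xi -> start w < lp w c r -> (0 < O (c, r))%R.
  move=> cx; rewrite startE lp_lt_same => lt.
  by apply: le_lt_trans (O_lt ((omega1_0, unit_co0 R) : point) ((c, r) : point) xi0 cx lt); exact: O_ge0.
have Ox := Opos a s axi xs; have Oy := Opos b t bxi ys.
pose k := (O (b, t) / O (a, s))%R; have k0 : (0 < k)%R by rewrite divr_gt0.
have kV0 : (0 < k^-1)%R by rewrite invr_gt0.
exists (stretch w O_ge0 O_onto k : L -> L), (stretch w O_ge0 O_onto k^-1 : L -> L); split.
- exact: stretch_L_mono.
- by apply: stretchK => //; rewrite mulVf ?gt_eqF.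
- by apply: stretchK => //; rewrite mulfV ?gt_eqF.
- apply: (@stretch_eq w xi O O_lt O_ge0 O_onto k ((a, s) : point) ((b, t) : point)) => //.
  by rewrite /k divfK// gt_eqF.
Qed.
End automorphisms.

(** * Orbits *)

Lemma homeomorphism_inv (X Y : topologicalType) (f : X -> Y) : homeomorphism f ->
  exists2 g, homeomorphism g & cancel f g /\ cancel g f.
Proof. by move=> [g [fc gc fK gK]]; exists g => //; exists f. Qed.

Lemma homeomorphism_comp (X Y Z : topologicalType) (f : X -> Y) (g : Y -> Z) :
  homeomorphism f -> homeomorphism g -> homeomorphism (g \o f).
Proof.
move=> [f' [fc f'c fK f'K]] [g' [gc g'c gK g'K]]; exists (f' \o g'); split.
- by move=> x; apply: continuous_comp; [exact: fc|exact: gc].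
- by move=> x; apply: continuous_comp; [exact: g'c|exact: f'c].
- exact: can_comp.
- exact: can_comp.
Qed.

Lemma homeo_orbit_eq (Y : topologicalType) (f : Y -> Y) (x y : Y) :
  homeomorphism f -> f x = y -> homeo_orbit x = homeo_orbit y.
Proof.
move=> hf e; have [g hg [fK gK]] := homeomorphism_inv hf.
apply/seteqP; split=> z [h hh <-].
- by exists (h \o g); [exact: homeomorphism_comp|rewrite /= -e fK].
- by exists (h \o f); [exact: homeomorphism_comp|rewrite /= e].
Qed.

Section Lambda_solenoid.
Variables (R : realType) (K : ordnum) (p : nat -> nat).
Hypothesis p_gt0 : forall n, (0 < p n)%N.
Hypothesis infK : infinite_cardinal K.
Local Notation P := (ord_pow omega K).
Variables (pw : K -> P) (rk : P -> K).
Hypothesis PS : pow_structure pw rk.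

Let Kup (b : K) : exists b', b < b' := infinite_cardinal_up b infK.
Let sqK : [set: K * K] #<= [set: K] := card_sq infK.2.
Let cardP : [set: P] #<= [set: K] := card_pow infK.2.

(** The points [omega1 * omega^b] have distinct ranks. *)
Lemma orbit_lower (A : set K) :
  [set: K] #<= range (@homeo_orbit (solenoid (Lambda R A) p)).
Proof.
apply: (inj_card (f := fun b => homeo_orbit (pw_point R A pw p_gt0 b))) => [b _|b b' _ _ e].
  by exists (pw_point R A pw p_gt0 b).
have : homeo_orbit (pw_point R A pw p_gt0 b') (pw_point R A pw p_gt0 b').
  by exists idfun => //; exists idfun; split=> //; move=> x; exact: cvg_id.
rewrite -e => -[f hf fb].
have := exact_rank_homeo hf (pw_point_rank R A PS p_gt0 b); rewrite fb => -[rb nrb].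
have [rb' nrb'] := pw_point_rank R A PS p_gt0 b'.
by case: (ltgtP b b') => // lt; [case: (nrb b')|case: (nrb' b)].
Qed.

(** Up to homeomorphism, a point is given by its block and by whether it is the start of the block; there are
   as many blocks as points of [omega ^ K], which is no larger than [K]. *)
Lemma orbit_upper (A : set K) :
  range (@homeo_orbit (solenoid (Lambda R A) p)) #<= [set: K].
Proof.
have [a a0] := omega1_up omega1_0.
pose L := Lambda R A.
have cL : compact [set: order_topology L] := continuum_compact (L_dense PS) (L_filled PS).
pose bt := @L_bot_top R K A.
pose code (c : option (P * bool)) : L := match c with
  | None => None | Some (w, true) => start R w | Some (w, false) => lp w a (unit_co0 R) end.
pose Phi c := homeo_orbit (spt bt (thread0_proof p_gt0) (code c)).
apply: (@card_le_trans _ _ _ (Phi @` setT)).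
  apply: subset_card_le => _ [x _ <-].
  have [g [tg [z [z0 ->]]]] := spt_surj bt x.
  suff [c [h [h' [hm hK h'K hz]]]] : exists c (h h' : L -> L),
      [/\ {mono h : u v / u <= v}, cancel h h', cancel h' h & h (code c) = z].
    exists c => //; have [F hF Fz] := shift_homeomorphism bt cL p_gt0 (thread0_proof p_gt0) tg hm hK h'K.
    by apply: (homeo_orbit_eq hF); rewrite Fz hz.
  have [->|[w [b [s ->]]]] := lp_cases z; first by exists None, id, id; split.
  have [->|iw] := lp_block w b s; first by exists (Some (w, true)), id, id; split.
  have [h [h' hh]] := block_homogeneous A PS (inner_lp_gt w (unit_co0 R) a0) iw.
  by exists (Some (w, false)), h, h'.
apply: card_le_trans (card_image_le _ _) _.
have [[i ii] [j ji]] := (infinite_nat_inj infK.2, cardT_inj sqK).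
have [f fi] := cardT_inj cardP.
apply: (card_le_trans _ (option_card_le infK.2 sqK)).
apply: (inj_cardT (f := omap (fun c => j (f c.1, i (nat_of_bool c.2))))) => -[[w c]|] [[w' c']|] //=.
by move=> [/ji[/fi -> /ii]]; case: c c' => [] [].
Qed.

Lemma Lambda_homogeneous (A : set K) : homogeneous K (solenoid (Lambda R A) p).
Proof. by apply/card_eqPle; split; [exact: orbit_upper|exact: orbit_lower]. Qed.

Lemma Lambda_not_homeomorphic (A A' : set K) : A <> A' ->
  ~ homeomorphic (solenoid (Lambda R A) p) (solenoid (Lambda R A') p).
Proof.
suff sub (B B' : set K) : homeomorphic (solenoid (Lambda R B) p) (solenoid (Lambda R B') p) -> B `<=` B'.
  move=> AA' AhA'; apply: AA'; apply/seteqP; split; first exact: (sub A A' AhA').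
  apply: (sub A' A); case: AhA' => f /homeomorphism_inv[g hg _]; by exists g.
move=> [f hf] b /(mem_A R B PS Kup p_gt0)[x [ts xb]].
apply/(mem_A R B' PS Kup p_gt0); exists (f x); split; last exact: exact_rank_homeo.
by case: hf => g [fc gc fK _]; exact: (two_sided_homeo fc gc fK ts).
Qed.

(** ** Weight *)

Section weight.
Variable A : set K.
Hypothesis ncK : ~ countable [set: K].
Local Notation L := (Lambda R A).
Local Notation oL := (order_topology L).

(** The blocks at the powers of omega contain disjoint cells. *)
Lemma basis_lower (B : set (set oL)) : basis B -> [set: K] #<= B.
Proof.
move=> [_ Bb]; have [a a0] := omega1_up omega1_0.
have cl (b : K) : {O : set oL | [/\ open O, O !=set0 & forall z, O z -> exists s, z = lp (pw b) a s]}.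
  by apply: cid; exact: (cell R A PS).
have ch (b : K) : {U : set oL | [/\ B U, U !=set0 & U `<=` sval (cl b)]}.
  apply: cid; case: (cl b) => /= O [oO [x Ox] _].
  have [U [BU Ux] UO] := Bb x O (open_nbhs_nbhs (conj oO Ox)).
  by exists U; split=> //; exists x.
apply: (inj_card (f := fun b => sval (ch b))) => [b _|b b' _ _]; first by case: (ch b) => U [].
case: (ch b) => U /= [_ [x Ux] Ub]; case: (ch b') => U' /= [_ _ Ub'] e; subst U'.
move: (Ub x Ux) (Ub' x Ux); case: (cl b) => /= O [_ _ h]; case: (cl b') => /= O' [_ _ h'].
move=> /h[s ->] /h'[s' [e _]]; by rewrite -(rk_pw PS b) e (rk_pw PS).
Qed.

Lemma card_rational_pts : (@rational_pts R (ord_mul omega1 P)) #<= [set: K].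
Proof.
pose f (x : P * (omega1 * rat)) : Lambda0 R K := lp x.1 x.2.1 (insubd (unit_co0 R) (ratr x.2.2)).
apply: (@card_le_trans _ _ _ (f @` setT)).
  apply: subset_card_le => _ [[w a] [t [q [-> tq]]]]; exists (w, (a, q)) => //.
  by rewrite /f /= -tq /insubd valK.
apply: card_le_trans (card_image_le _ _) _.
have [[i ii] [j ji]] := (infinite_nat_inj infK.2, cardT_inj sqK).
have [[g gi] [h hi]] := (cardT_inj cardP, cardT_inj (card_omega1 ncK)).
apply: (inj_cardT (f := fun x : P * (omega1 * rat) => j (g x.1, j (h x.2.1, i (choice.pickle x.2.2))))).
by move=> [w [a q]] [w' [a' q']] /ji[/gi -> /ji[/hi -> /ii/(pcan_inj (@choice.pickleK _)) ->]].
Qed.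

(** The intervals with end points among the rational points form a base. *)
Lemma Lambda_weight : has_weight oL K.
Proof.
split; last exact: basis_lower.
pose D : set L := @rational_pts R (ord_mul omega1 P).
pose ray (i : option L * option L) : set oL :=
  [set x : L | (if i.1 is Some u then u < x else true) /\ (if i.2 is Some v then x < v else true)].
pose I : set (option L * option L) :=
  [set i | (if i.1 is Some u then D u else True) /\ (if i.2 is Some v then D v else True)].
have otrue : open ([set x | true] : set oL).
  have -> : [set x : oL | true] = setT by apply/seteqP; split.
  exact: openT.
have bI : basis (ray @` I).
  split=> [_ [[i j] _ <-]|x U /order_nbhsP[Q [Q' [Qe Q'e QU]]]].
    apply: openI.
    - by case: i => [u|] /=; [exact: open_rray|exact: otrue].
    - by case: j => [u|] /=; [exact: open_lray|exact: otrue].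
  have [i [Di ix iQ]] : exists i : option L, [/\ if i is Some u then D u else True,
      if i is Some u then u < x else true &
      forall y : L, (if i is Some u then u < y else true) -> Q y].
    case: Qe => [->|[u ux ->]]; first by exists None.
    have [v [Dv uv vx]] := L_dense_set PS ux; exists (Some v); split=> // y; exact: lt_trans.
  have [j [Dj jx jQ]] : exists i : option L, [/\ if i is Some u then D u else True,
      if i is Some u then x < u else true &
      forall y : L, (if i is Some u then y < u else true) -> Q' y].
    case: Q'e => [->|[u ux ->]]; first by exists None.
    have [v [Dv uv vx]] := L_dense_set PS ux; exists (Some v); split=> // y yv; exact: lt_trans vx.
  exists (ray (i, j)); first by split=> //; exists (i, j).
  move=> y [iy jy]; apply: QU; split; [apply: (iQ y); by case: (i) iy|apply: (jQ y); by case: (j) jy].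
exists (ray @` I) => //; apply/card_eqPle; split; last exact: basis_lower.
apply: card_le_trans (card_image_le _ _) _.
apply: (card_le_trans _ (card_option_sq infK.2 sqK)).
have [f fi] : exists f : L -> K, forall x y, D x -> D y -> f x = f y -> x = y.
  have [f fi] : exists f : D -> K, injective f.
    by apply: cardT_inj; rewrite (card_le_eql (card_setT D)); exact: card_rational_pts.
  have [z [Dz _ _]] := @rational_dense R _ _ _ (lp_lt_none (pow_0 K) omega1_0 (unit_co0 R)).
  exists (fun x => if pselect (D x) is left h then f (SigSub (mem_set h)) else f (SigSub (mem_set Dz))).
  by move=> x y Dx Dy; case: pselect => // ?; case: pselect => // ? /fi[].
apply: (inj_card (f := fun i => (omap f i.1, omap f i.2))) => // -[u v] [u' v'] [/= Du Dv] [/= Du' Dv'] [].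
have oi (x y : option L) : (if x is Some t then D t else True) -> (if y is Some t then D t else True) ->
    omap f x = omap f y -> x = y.
  by case: x y => [x|] [y|] //= Dx Dy [/fi ->].
by move=> /oi -> // /oi ->.
Qed.
End weight.

Lemma Lambda_compact (A : set K) : compact [set: order_topology (Lambda R A)].
Proof. exact: continuum_compact (L_dense PS) (L_filled PS). Qed.

Lemma Lambda_connected (A : set K) : connected [set: order_topology (Lambda R A)].
Proof. exact: continuum_connected (L_dense PS) (L_filled PS). Qed.
End Lambda_solenoid.

Theorem theorem4p2 (R : realType) (p : nat -> nat) 
    (p_gt0 : forall n, (0 < p n)%N) :
  (forall K : ordnum, infinite_cardinal K ->
    (forall A : set K, homogeneous K (solenoid (Lambda R A) p)) /\
    (forall A A' : set K, A <> A' ->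
      ~ homeomorphic (solenoid (Lambda R A) p) (solenoid (Lambda R A') p))) /\
  (forall K : ordnum, uncountable_cardinal K ->
    exists L : set K -> ordered_continuum,
      (forall A, has_weight (order_topology (L A)) K /\
                 homogeneous K (solenoid (L A) p)) /\
      (forall A A', A <> A' ->
        ~ homeomorphic (solenoid (L A) p) (solenoid (L A') p))).
Proof.
split=> K cK.
  have [k0 _] := infinite_setN0 cK.2.
  have [pw [rk PS]] := pow_structure_exists (inhabits k0).
  split; first exact: (Lambda_homogeneous R p_gt0 cK PS).
  exact: (Lambda_not_homeomorphic p_gt0 cK PS).
have infK : infinite_cardinal K.
  by split; [exact: cK.1|apply: contra_not cK.2; exact: finite_set_countable].
have [k0 _] := infinite_setN0 infK.2.
have [pw [rk PS]] := pow_structure_exists (inhabits k0).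
have ne (A : set K) : exists x y : Lambda R A, x <> y by exists \bot, \top.
exists (fun A => OrderedContinuum (Lambda_compact (R := R) PS (A := A)) (Lambda_connected (R := R) PS (A := A)) (ne A)).
split=> [A|]; first by split; [exact: (Lambda_weight R infK PS A cK.2)|exact: (Lambda_homogeneous R p_gt0 infK PS)].
exact: (Lambda_not_homeomorphic p_gt0 infK PS).
Qed.
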